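(* Let $n\geq 3$. Let $p:(0,\infty)\to\mathbb{R}$ be continuously differentiable with $p'(\rho)>0$ on $(0,\infty)$, and let $\mathbf{B}$ be a constant real $n\times n$ matrix. Consider the steady compressible Euler system with source term $$\operatorname{div}(\rho u)=0,\qquad \operatorname{div}(\rho u\otimes u)+\nabla p(\rho)=\mathbf{B}(\rho u).$$ \begin{itemize} \item[(a)] Let $\Omega=\mathbb{T}^n$ and let $\rho\in C(\mathbb{T}^n)$ be positive. Then for any given continuous function $q:\mathbb{T}^n\to(0,\infty)$ there exist infinitely many $u\in L^\infty(\mathbb{T}^n;\mathbb{R}^n)$ such that $(\rho,\rho u)$ is a weak solution of the system on $\mathbb{T}^n$ and $|u|^2=\frac{nq}{\rho}$ a.e. \item[(b)] Let $\Omega\subset\mathbb{R}^n$ be open and bounded, let $\mathbf{B}=a\mathbf{I}_n$ for some $a>0$, and let $\rho\in C^1(\mathbb{R}^n)$ be positive with $\rho(x)=\bar\rho>0$ for $x\in\mathbb{R}^n\setminus\Omega$ and $\int_\Omega p(\rho(x))\,dx=p(\bar\rho)|\Omega|$. Then there exists a function $q=q(x)$ such that there are infinitely many compactly supported $u\in L^\infty(\mathbb{R}^n;\mathbb{R}^n)$ for which $(\rho,\rho u)$ is a weak solution of the system on $\mathbb{R}^n$ and $|u|^2=\frac{nq}{\rho}$. \item[(c)] Let $\Omega\subset\mathbb{R}^n$ be open and bounded, and let $\rho:\mathbb{R}^n\to\mathbb{R}$ satisfy $\rho(x)=\bar\rho>0$ for $x\in\mathbb{R}^n\setminus\Omega$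 and $0<\rho(x)<\bar\rho$ for $x\in\Omega$. Then there exists a function $q=q(x)$ such that there are infinitely many compactly supported $u\in L^\infty(\mathbb{R}^n;\mathbb{R}^n)$ for which $(\rho,\rho u)$ is a weak solution of the system on $\mathbb{R}^n$ and $|u|^2=\frac{nq}{\rho}$. \end{itemize}
   Context: Let $\Omega$ be $\mathbb{T}^n$ or $\mathbb{R}^n$. A pair $(\rho,m)\in L^\infty(\Omega;(0,\infty)\times\mathbb{R}^n)$ is called a weak solution of the system if $$\int_\Omega \frac{m\otimes m}{\rho}:\nabla\Phi+\Phi\cdot\mathbf{B}m\,dx=0,\qquad \int_\Omega m\cdot\nabla\psi\,dx=0$$ for every smooth test vector field $\Phi:\Omega\to\mathbb{R}^n$ with $\operatorname{div}\Phi=0$ and every smooth scalar test function $\psi:\Omega\to\mathbb{R}$ (compactly supported when $\Omega=\mathbb{R}^n$). Here $m=\rho u$ is the momentum.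
   Formalization: In (c) the density ρ is additionally assumed (Borel) measurable: for non-measurable ρ the pair (ρ,ρu) is never in L^∞, so it cannot be a weak solution; a Lebesgue measurable ρ is covered after a change on a null set. *)

(* Defs.v *)
From mathcomp Require Import all_boot all_order all_algebra all_classical all_reals all_analysis.
Import numFieldNormedType.Exports.
Import Order.TTheory GRing.Theory Num.Theory.
Set Implicit Arguments. Unset Strict Implicit. Unset Printing Implicit Defensive.
Local Open Scope classical_set_scope.
Local Open Scope ring_scope.

Section Euler.
Variable R : realType.

(* iint n f = \int_R ... \int_R f(x_1,...,x_n) dx_n ... dx_1 (Lebesgue measure
   on each factor).  For the integrable integrands used below this equals the
   Lebesgue integral on R^n by Fubini. *)
Fixpoint iint (n : nat) : ('rV[R]_n -> R) -> \bar R :=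
  match n return ('rV[R]_n -> R) -> \bar R with
  | 0 => fun f => (f 0)%:E
  | n'.+1 => fun f =>
      (\int[@lebesgue_measure R]_(t in setT)
          iint (fun y : 'rV[R]_n' => f (row_mx (const_mx t : 'rV[R]_1) y)))%E
  end.

Variable n : nat.

(* coordinates: R^n  <->  n.-tuple R (which carries the product sigma-algebra) *)
Definition t2rv (t : n.-tuple R) : 'rV[R]_n := \row_i tnth t i.

Definition measurableN (A : set 'rV[R]_n) : Prop := measurable (t2rv @^-1` A).

Definition mfunN (f : 'rV[R]_n -> R) : Prop :=
  forall B : set R, measurable B -> measurableN (f @^-1` B).

Definition mvfN (u : 'rV[R]_n -> 'rV[R]_n) : Prop :=
  forall i, mfunN (fun x => u x 0 i).

Definition volN (A : set 'rV[R]_n) : \bar R := iint (\1_A).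

Definition negligibleN (A : set 'rV[R]_n) : Prop :=
  exists B, [/\ measurableN B, A `<=` B & volN B = 0%E].

Definition ae_on (D : set 'rV[R]_n) (P : 'rV[R]_n -> Prop) : Prop :=
  negligibleN [set x | D x /\ ~ P x].

Definition ess_bdd_on (D : set 'rV[R]_n) (u : 'rV[R]_n -> 'rV[R]_n) : Prop :=
  exists M : R, ae_on D (fun x => forall i, `|u x 0 i| <= M).

Definition ess_bdd_sc_on (D : set 'rV[R]_n) (f : 'rV[R]_n -> R) : Prop :=
  exists M : R, ae_on D (fun x => `|f x| <= M).

Definition ev (i : 'I_n) : 'rV[R]_n := delta_mx 0 i.

Definition partial (i : 'I_n) (f : 'rV[R]_n -> R) : 'rV[R]_n -> R :=
  fun x => derive f x (ev i).

Fixpoint dpart (s : seq 'I_n) (f : 'rV[R]_n -> R) : 'rV[R]_n -> R :=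
  match s with
  | [::] => f
  | i :: s' => partial i (dpart s' f)
  end.

Definition smooth (f : 'rV[R]_n -> R) : Prop :=
  forall s : seq 'I_n,
    continuous (dpart s f) /\ forall i x, derivable (dpart s f) x (ev i).

Definition C1 (f : 'rV[R]_n -> R) : Prop :=
  continuous f /\
  forall i, (forall x, derivable f x (ev i)) /\ continuous (partial i f).

Definition smooth_vf (Phi : 'rV[R]_n -> 'rV[R]_n) : Prop :=
  forall i, smooth (fun x => Phi x 0 i).

Definition div_free (Phi : 'rV[R]_n -> 'rV[R]_n) : Prop :=
  forall x, \sum_(i < n) partial i (fun y => Phi y 0 i) x = 0.

(* Z^n-Zn_periodic = function on the torus T^n = R^n / Z^n *)
Definition Zn_periodic {T : Type} (f : 'rV[R]_n -> T) : Prop :=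
  forall x i, f (x + ev i) = f x.

Definition cpt_supp {T : zmodType} (f : 'rV[R]_n -> T) : Prop :=
  exists M : R, forall x, M < `|x| -> f x = 0.

Definition bounded_setN (A : set 'rV[R]_n) : Prop :=
  exists M : R, forall x, A x -> `|x| <= M.

Definition cube01 : set 'rV[R]_n := [set x | forall i, 0 <= x 0 i < 1].

Definition sqnorm (v : 'rV[R]_n) : R := \sum_(i < n) v 0 i ^+ 2.

Definition mom_integrand (B : 'M[R]_n) (rho : 'rV[R]_n -> R)
  (m Phi : 'rV[R]_n -> 'rV[R]_n) (x : 'rV[R]_n) : R :=
  \sum_(i < n) \sum_(j < n)
      (m x 0 i * m x 0 j / rho x) * partial j (fun y => Phi y 0 i) x
  + \sum_(i < n) Phi x 0 i * (\sum_(j < n) B i j * m x 0 j).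

Definition mass_integrand (m : 'rV[R]_n -> 'rV[R]_n) (psi : 'rV[R]_n -> R)
  (x : 'rV[R]_n) : R :=
  \sum_(i < n) m x 0 i * partial i psi x.

Definition weak_sol_Rn (B : 'M[R]_n) (rho : 'rV[R]_n -> R)
  (m : 'rV[R]_n -> 'rV[R]_n) : Prop :=
  mfunN rho /\ ess_bdd_sc_on setT rho /\ (forall x, 0 < rho x) /\
  mvfN m /\ ess_bdd_on setT m /\
  (forall Phi, smooth_vf Phi -> div_free Phi -> cpt_supp Phi ->
      iint (mom_integrand B rho m Phi) = 0%E) /\
  (forall psi, smooth psi -> cpt_supp psi ->
      iint (mass_integrand m psi) = 0%E).

(* Omega = T^n : Zn_periodic functions, integrals over the fundamental domain *)
Definition on_cube (f : 'rV[R]_n -> R) : 'rV[R]_n -> R :=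
  fun x => \1_cube01 x * f x.

Definition weak_sol_Tn (B : 'M[R]_n) (rho : 'rV[R]_n -> R)
  (m : 'rV[R]_n -> 'rV[R]_n) : Prop :=
  Zn_periodic rho /\ Zn_periodic m /\
  mfunN rho /\ ess_bdd_sc_on cube01 rho /\ (forall x, 0 < rho x) /\
  mvfN m /\ ess_bdd_on cube01 m /\
  (forall Phi, smooth_vf Phi -> div_free Phi -> Zn_periodic Phi ->
      iint (on_cube (mom_integrand B rho m Phi)) = 0%E) /\
  (forall psi, smooth psi -> Zn_periodic psi ->
      iint (on_cube (mass_integrand m psi)) = 0%E).

(* "infinitely many" L^infty vector fields: a sequence of pairwise distinct
   elements of L^infty (distinct modulo a.e. equality on D) *)
Definition pairwise_ae_distinct (D : set 'rV[R]_n)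
  (U : nat -> 'rV[R]_n -> 'rV[R]_n) : Prop :=
  forall k l, k <> l -> ~ ae_on D (fun x => U k x = U l x).

End Euler.

(* Main.v *)
From Pilot Require Import Defs.
From HB Require Import structures.
From mathcomp Require Import all_boot all_order all_algebra all_classical all_reals all_analysis.
From mathcomp Require Import measurable_realfun ring lra.
Import numFieldNormedType.Exports.
Import Pilot.Defs.
Import Order.TTheory GRing.Theory Num.Theory.
Set Implicit Arguments. Unset Strict Implicit. Unset Printing Implicit Defensive.
Local Open Scope classical_set_scope.
Local Open Scope ring_scope.

(* Convex integration inside one unit cube.  A subsolution is a continuous pair
   (m, U), with U symmetric and traceless, which solves weakly the linear system
   div m = 0, div U = B m modulo gradients, and whose gap matrix
   q I - m m^T / rho + U is positive definite on the cube.  In each cell of a fine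
   grid one adds to (m, U) a pair built from second derivatives of a high-frequency
   wave times a cutoff: m then oscillates along a direction w, U along
   b w^T + w b^T, and b is chosen so that the gap matrix loses only a controlled
   rank-one part.  The wave vector has to be orthogonal to w and b, which is
   possible because n >= 3.  The perturbations vanish near the faces of the cells,
   so the weak identities hold against all smooth test fields, with no boundary
   condition.  Each step raises the energy by a fixed multiple of the mean square
   of tr (q I - m m^T / rho + U) = n q - |m|^2 / rho, and its increments are nearly
   orthogonal to any finite family of continuous fields.  The iterates are thus
   Cauchy in L^2 and the gap tends to 0: the limit satisfies |m|^2 = n q rho and
   m m^T / rho = U + q I, whose part q I is invisible to divergence-free fields.
   Asking that the next solution be nearly orthogonal to continuous fields which
   have mean 1 against the earlier ones produces infinitely many solutions.
   On the torus the cube is the fundamental domain.  On R^n it is placed away from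
   Omega, where rho is constant, and q is the indicator function of the cube. *)

(** * Iterated integrals over a unit cube *)

(** The iteration survives because the gain of a step does not deteriorate. The positivity constant
    of the gap matrix does shrink (only a quarter of it is guaranteed after a step), but it affects
    only the tolerance and the fineness of the grid; the amplitude of a wave is a fixed multiple of
    the trace of the gap, so the gain depends on bounds for rho and q alone. The trace is enough to
    measure progress: an entry of a positive matrix is bounded by its trace, so once the trace tends
    to 0 the whole matrix does, and positivity also yields |m|^2 <= n q rho, one bound for all
    iterates, which makes dominated convergence available. The source term need not be small: B
    times the oscillation of m is exactly the divergence of a symmetric matrix containing only first
    derivatives of the wave, and it is this matrix that is small at high frequency. Solutions are
    merely measurable, while the step accepts only continuous fields to be tested against; hence the
    continuous field that singles out a solution is a rescaled iterate. *)

Section CubeMeasure.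
Context {R : realType}.
Implicit Types (c : R) (n : nat).

Lemma ltr_unit_itv c : c < c + 1.
Proof. by rewrite ltrDl. Qed.

(** The uniform law is transported along this identity from one measurable copy of the reals to the
    other, so that it can be a factor of the law on tuples. *)
Definition idR : measurableTypeR R -> R := idfun.

Lemma measurable_idR : measurable_fun setT idR.
Proof. by move=> _ B mB; rewrite setTI. Qed.

HB.instance Definition _ := isMeasurableFun.Build _ _ _ _ idR measurable_idR.

Definition unif c : probability R R :=
  distribution (uniform_prob (ltr_unit_itv c)) idR.

Lemma ge0_integral_unif c (f : R -> \bar R) :
  measurable_fun setT f -> (forall x, 0 <= f x)%E ->
  (\int[unif c]_x f x = \int[lebesgue_measure]_(x in `[c, (c + 1)%R]) f x)%E.
Proof.
move=> mf f0; rewrite ge0_integral_distribution//.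
have mfi : measurable_fun setT (f \o idR) by move=> mT B mB; exact: mf.
rewrite (integral_uniform (ltr_unit_itv c) mfi)//.
by rewrite addrAC subrr add0r invr1 mul1e.
Qed.

Lemma integral_unif c (f : R -> \bar R) : measurable_fun setT f ->
  (\int[unif c]_x f x = \int[lebesgue_measure]_(x in `[c, (c + 1)%R]) f x)%E.
Proof.
move=> mf; rewrite integralE ge0_integral_unif//; last exact: measurable_funepos.
rewrite ge0_integral_unif//; last exact: measurable_funeneg.
by rewrite [RHS]integralE.
Qed.

Definition tcons n (z : R * n.-tuple R) : n.+1.-tuple R := [tuple of z.1 :: z.2].

Lemma measurable_tcons n : measurable_fun setT (@tcons n).
Proof. exact: measurable_cons. Qed.

HB.instance Definition _ n := isMeasurableFun.Build _ _ _ _ (@tcons n) (@measurable_tcons n).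

(** The first coordinate is peeled off in the same order as in [iint], so the two are compared by
    induction. Working with a probability makes every bounded measurable function integrable. *)
Fixpoint mu c n : probability (n.-tuple R) R :=
  match n with
  | 0 => \d_([tuple] : 0.-tuple R)
  | n'.+1 => distribution (unif c \x mu c n')%E (@tcons n')
  end.

End CubeMeasure.

Section TupleIntegral.
Context {R : realType}.
Implicit Types (c : R) (n : nat).

Lemma integrable_bounded d (T : measurableType d) (P : probability T R)
    (D : set T) (f : T -> R) :
  measurable D -> measurable_fun D f -> (exists M, forall x, D x -> `|f x| <= M) ->
  P.-integrable D (EFin \o f).
Proof.
move=> mD mf [M fM]; apply: measurable_bounded_integrable => //.
- by rewrite (le_lt_trans (probability_le1 P mD))// ltry.
- by exists M; split; [exact: num_real|move=> y My x /= Dx; exact: le_trans (fM x Dx) (ltW My)].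
Qed.

Lemma Rintegral_EFin d (T : measurableType d) (P : probability T R)
    (D : set T) (f : T -> R) :
  measurable D -> measurable_fun D f -> (exists M, forall x, D x -> `|f x| <= M) ->
  (\int[P]_(x in D) (f x)%:E = (\int[P]_(x in D) f x)%R%:E)%E.
Proof.
move=> mD mf fM; rewrite /Rintegral fineK//; apply: integrable_fin_num => //.
exact: integrable_bounded.
Qed.

Lemma integral_mu_consl c n (f : n.+1.-tuple R -> R) :
  measurable_fun setT f -> (exists M, forall x, `|f x| <= M) ->
  (\int[mu c n.+1]_x (f x)%:E =
   \int[unif c]_t \int[mu c n]_s (f (tcons (t, s)))%:E)%E.
Proof.
move=> mf [M fM] /=; rewrite integral_distribution//; last 2 first.
- exact: measurableT_comp.
- apply: (@integrable_bounded _ _ _ _ (f \o @tcons R n)) => //.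
  + exact: measurableT_comp (@measurable_tcons R n).
  + by exists M => *; exact: fM.
rewrite -integral12_prod_meas1//.
apply: (@integrable_bounded _ _ _ _ (f \o @tcons R n)) => //.
- exact: measurableT_comp (@measurable_tcons R n).
- by exists M => *; exact: fM.
Qed.

(** Fubini with the first coordinate innermost, the order in which a derivative in that coordinate
    can be integrated out. *)
Lemma integral_mu_consr c n (f : n.+1.-tuple R -> R) :
  measurable_fun setT f -> (exists M, forall x, `|f x| <= M) ->
  (\int[mu c n.+1]_x (f x)%:E =
   \int[mu c n]_s \int[unif c]_t (f (tcons (t, s)))%:E)%E.
Proof.
move=> mf [M fM] /=; rewrite integral_distribution//; last 2 first.
- exact: measurableT_comp.
- apply: (@integrable_bounded _ _ _ _ (f \o @tcons R n)) => //.
  + exact: measurableT_comp (@measurable_tcons R n).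
  + by exists M => *; exact: fM.
rewrite -integral21_prod_meas1//.
apply: (@integrable_bounded _ _ _ _ (f \o @tcons R n)) => //.
- exact: measurableT_comp (@measurable_tcons R n).
- by exists M => *; exact: fM.
Qed.

Lemma measurable_tcons_pair1 n (t : R) : measurable_fun setT (fun s : n.-tuple R => tcons (t, s)).
Proof. exact: measurableT_comp (@measurable_tcons R n) (pair1_measurable t). Qed.

Lemma t2rv_tcons n (t : R) (s : n.-tuple R) :
  t2rv (tcons (t, s)) = row_mx (const_mx t : 'rV[R]_1) (t2rv s).
Proof.
apply/rowP => i; rewrite !mxE; case: splitP => j ij.
  by rewrite mxE (tnth_nth t)/= ij (ord1 j).
by rewrite mxE !(tnth_nth t)/= ij.
Qed.

Lemma unif_itv c a h : c <= a -> 0 <= h -> a + h <= c + 1 ->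
  unif c `[a, (a + h)[%classic = h%:E.
Proof.
move=> ca h0 ac; rewrite -[LHS]mul1e -integral_cst// integral_mkcond.
rewrite integral_unif//; last first.
  apply/(measurable_restrictT _ _).1 => //.
rewrite -integral_mkcondr integral_cst//; last exact: measurableI.
rewrite mul1e; transitivity (lebesgue_measure (`[a, (a + h)[%classic : set R)).
  congr lebesgue_measure; apply/seteqP; split => x /=; rewrite !in_itv/=; first by case.
  case/andP=> ax xh.
  by rewrite ax xh (le_trans ca ax) (le_trans (ltW xh) ac).
rewrite lebesgue_measure_itv/= lte_fin ltrDl; case: ltrP => h1.
  by rewrite -EFinD addrAC subrr add0r.
by congr EFin; apply/eqP; rewrite eq_le h0 h1.
Qed.

End TupleIntegral.

(** * Boxes, and the iterated integral as an integral against the product law *)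

Section Boxes.
Context {R : realType}.
Implicit Types (c : R) (n : nat).

(** Half-open sides: the cells of a grid tile the cube without overlap, and [cube 0] is exactly the
    fundamental domain [cube01]. *)
Definition box n (a : 'rV[R]_n) (h : R) : set 'rV[R]_n :=
  [set x | forall i, a 0 i <= x 0 i < a 0 i + h].

Definition cube c {n} : set 'rV[R]_n := box (const_mx c) 1.

Lemma cubeP c n (x : 'rV[R]_n) : cube c x <-> forall i, c <= x 0 i < c + 1.
Proof. by split => H i; move: (H i); rewrite mxE. Qed.

Lemma measurable_coord n (i : 'I_n) : measurable_fun setT (fun t : n.-tuple R => t2rv t 0 i).
Proof.
rewrite (_ : (fun t : n.-tuple R => _) = (fun t : n.-tuple R => tnth t i)); first exact: measurable_tnth.
by apply/funext => t; rewrite mxE.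
Qed.

Lemma measurable_box n (a : 'rV[R]_n) h : measurableN (box a h).
Proof.
rewrite /measurableN (_ : _ @^-1` _ =
  \bigcap_(i : 'I_n) ((fun t : n.-tuple R => t2rv t 0 i) @^-1` `[a 0 i, (a 0 i + h)[%classic)).
  apply: fin_bigcap_measurable => // i _; rewrite -[X in measurable X]setTI.
  exact: measurable_coord.
by apply/seteqP; split => t /= H i => [_|]; have := H i; rewrite /= in_itv/=; [|apply].
Qed.

Lemma measurable_cube c n : measurableN (cube c : set 'rV[R]_n).
Proof. exact: measurable_box. Qed.

Lemma mu_box c n (a : 'rV[R]_n) h : 0 <= h ->
  (forall i, c <= a 0 i /\ a 0 i + h <= c + 1) ->
  mu c n (@t2rv R n @^-1` box a h) = (h ^+ n)%:E.
Proof.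
move=> h0; elim: n a => [|n IH] a ha /=.
  by rewrite diracE mem_set//= => -[].
have e : @tcons R n @^-1` (@t2rv R n.+1 @^-1` box a h) =
    `[a 0 ord0, (a 0 ord0 + h)[%classic `*`
    (@t2rv R n @^-1` box (\row_j a 0 (lift ord0 j)) h).
  apply/seteqP; split => -[t s] /=; rewrite /box /= in_itv/=.
    move=> H; split; first by have := H ord0; rewrite mxE /tcons/= (tnth_nth t)/=.
    move=> i; have := H (lift ord0 i); rewrite !mxE /tcons/= !(tnth_nth t)/=.
    by rewrite /bump /=.
  move=> [H1 H2] i; rewrite mxE /tcons/= (tnth_nth t)/=.
  case: (unliftP ord0 i) => [j ->|->]//.
  by have := H2 j; rewrite !mxE (tnth_nth t)/=.
transitivity ((unif c \x mu c n)%E (`[a 0 ord0, (a 0 ord0 + h)[%classic `*`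
    (@t2rv R n @^-1` box (\row_j a 0 (lift ord0 j)) h))); first by rewrite -e.
rewrite product_measure1E//; last exact: measurable_box.
transitivity (h%:E * (h ^+ n)%:E)%E; last by rewrite -EFinM -exprS.
congr (_ * _)%E; first by apply: unif_itv => //; case: (ha ord0).
by apply: IH => i; rewrite mxE; exact: ha.
Qed.

Lemma mu_cube c n : mu c n (@t2rv R n @^-1` cube c) = 1%E.
Proof. by rewrite mu_box ?expr1n// => i; rewrite mxE. Qed.

Lemma mfunNP n (f : 'rV[R]_n -> R) : mfunN f <-> measurable_fun setT (f \o @t2rv R n).
Proof.
split => [mf _ B mB|mf B mB]; first by rewrite setTI; exact: mf.
by rewrite /measurableN -comp_preimage -[X in measurable X]setTI; exact: mf.
Qed.

(** The bridge between the integrals of the statement and [mu]: sections of [f] outside [[c, c + 1]]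
    vanish, so each integral over the line becomes one against [unif c]. *)
Lemma iintE c n (f : 'rV[R]_n -> R) :
  mfunN f -> (exists M, forall x, `|f x| <= M) -> (forall x, ~ cube c x -> f x = 0) ->
  iint f = (\int[mu c n]_t (f (t2rv t))%:E)%E.
Proof.
elim: n f => [|n IH] f /mfunNP mf [M fM] f0.
  rewrite /=; rewrite integral_dirac//=; last exact/measurable_EFinP.
  rewrite diracT mul1e; congr (f _)%:E; apply/rowP; by case.
have fQ (t : R) (s : n.-tuple R) : ~ (c <= t <= c + 1) ->
    f (row_mx (const_mx t : 'rV[R]_1) (t2rv s)) = 0.
  move=> H; apply: f0 => /cubeP /(_ ord0).
  rewrite mxE; case: splitP => // j _; rewrite mxE => /andP[h1 h2].
  by apply: H; rewrite h1 ltW.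
have msec (t : R) : mfunN (fun y : 'rV[R]_n => f (row_mx (const_mx t : 'rV[R]_1) y)).
  apply/mfunNP; rewrite (_ : _ \o _ = (f \o @t2rv R n.+1) \o (fun s : n.-tuple R => tcons (t, s))).
    exact: (measurableT_comp mf (@measurable_tcons_pair1 R n t)).
  by apply/funext => s /=; rewrite t2rv_tcons.
rewrite (@integral_mu_consl _ _ _ (f \o @t2rv R n.+1))//; last by exists M => x; exact: fM.
set F := fun t : R => (\int[mu c n]_s (f (t2rv (tcons (t, s))))%:E)%E.
have mF : measurable_fun setT F.
  apply: (@measurable_fubini_F _ _ _ _ _ (unif c) (mu c n)
    (fun z => (f (t2rv (tcons z)))%:E)).
  apply: (@integrable_bounded _ _ _ _ _ (f \o @t2rv R n.+1 \o @tcons R n)) => //.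
  - exact: measurableT_comp (@measurable_tcons R n).
  - by exists M => *; exact: fM.
rewrite -/F integral_unif// integral_mkcond /=; apply: eq_integral => t _.
rewrite /patch; case: ifPn => [|] tc.
  rewrite IH.
  - by apply: eq_integral => s _; rewrite t2rv_tcons.
  - exact: msec.
  - by exists M => y; exact: fM.
  - move=> y yQ; apply: f0 => /cubeP H; apply: yQ; apply/cubeP => i.
    have := H (rshift 1 i : 'I_n.+1); rewrite mxE; case: splitP => j /=.
      by move=> /esym; case: j => -[].
    by move=> [/val_inj ->].
move: tc; rewrite notin_setE/= in_itv/= => tc.
have f0t : (fun y : 'rV[R]_n => f (row_mx (const_mx t : 'rV[R]_1) y)) = cst 0.
  apply/funext => y; have := fQ t [tuple y 0 i | i < n] tc.
  by rewrite (_ : t2rv _ = y)//; apply/rowP => i; rewrite mxE tnth_mktuple.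
transitivity (iint (cst 0 : 'rV[R]_n -> R)); first by rewrite -f0t.
rewrite IH.
- by rewrite integral0_eq.
- by apply/mfunNP; exact: measurable_cst.
- by exists 0 => x; rewrite normr0.
- by [].
Qed.

End Boxes.

(** * Bounded measurable functions on a cube and their means *)

Section MeanValue.
Context {R : realType} {n : nat}.
Implicit Types (c : R) (f g : 'rV[R]_n -> R).

Lemma ball_rV (x y : 'rV[R]_n) e : ball x e y <-> 0 < e /\ forall i, `|x 0 i - y 0 i| < e.
Proof.
split=> [[e0 H]|[e0 H]]; split => //; first by move=> i; have := H 0 i.
by move=> i j; rewrite (ord1 i); exact: H.
Qed.

(** Balls are boxes in the sup norm, and the rational ones form a countable base; this links the
    topology of row vectors with the product sigma-algebra of tuples. *)
Lemma open_measurableN (U : set 'rV[R]_n) : open U -> measurableN U.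
Proof.
move=> oU; pose q2r (p : 'rV[rat]_n) : 'rV[R]_n := map_mx ratr p.
pose B (z : 'rV[rat]_n * nat) : set 'rV[R]_n := ball (q2r z.1) (z.2.+1%:R^-1).
pose S z := if `[< B z `<=` U >] then B z else set0.
have -> : U = \bigcup_z S z.
  apply/seteqP; split=> [x Ux|x [z _]]; last first.
    by rewrite /S; case: asboolP => // BU /BU.
  have /nbhs_ballP[e /= e0 eU] : nbhs x U by exact: open_nbhs_nbhs.
  have [k ke] : exists k : nat, k.+1%:R^-1 < e / 2.
    have [k _ H] := near_infty_natSinv_lt (PosNum (divr_gt0 e0 (ltr0Sn R 1))).
    by exists k; exact: (H k (leqnn k)).
  set d := k.+1%:R^-1 : R; have d0 : 0 < d by rewrite invr_gt0.
  have de : d < e / 2 by exact: ke.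
  have /choice[p pP] : forall i, exists q : rat, `|ratr q - x 0 i| < d.
    move=> i; have : x 0 i - d < x 0 i + d by lra.
    move=> /rat_in_itvoo[q]; rewrite in_itv/= => /andP[h1 h2]; exists q.
    by rewrite ltr_norml; apply/andP; split; lra.
  exists (\row_i p i, k) => //; rewrite /S ifT.
    by apply/ball_rV; split => // i; rewrite !mxE.
  apply/asboolP => y /ball_rV[_ H]; apply: eU; apply/ball_rV; split => // i.
  have := H i; have := pP i; rewrite !mxE -/d => h1 h2.
  rewrite (_ : x 0 i - y 0 i = (ratr (p i) - y 0 i) - (ratr (p i) - x 0 i)); last by ring.
  by apply: (le_lt_trans (ler_normB _ _)); lra.
rewrite /measurableN preimage_bigcup; apply: countable_bigcupT_measurable => [|z]; first exact: countableP.
rewrite /S; case: asboolP => _; last by rewrite preimage_set0.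
rewrite (_ : _ @^-1` _ = \bigcap_(i : 'I_n) ((fun t : n.-tuple R => t2rv t 0 i) @^-1`
    `](q2r z.1 0 i - z.2.+1%:R^-1), (q2r z.1 0 i + z.2.+1%:R^-1)[%classic)).
  apply: fin_bigcap_measurable => // i _; rewrite -[X in measurable X]setTI.
  exact: measurable_coord.
apply/seteqP; split => t /=.
  by move=> /ball_rV[_ H] i _ /=; have := H i; rewrite in_itv/= distrC ltr_norml; move: (z.2.+1%:R^-1) => d /andP[? ?]; apply/andP; split; lra.
move=> H; apply/ball_rV; split; first by rewrite invr_gt0.
by move=> i; have := H i I; rewrite /= in_itv/= distrC ltr_norml; move: (z.2.+1%:R^-1) => d /andP[? ?]; apply/andP; split; lra.
Qed.

Lemma continuous_mfunN f : continuous f -> mfunN f.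
Proof.
move=> cf; apply/mfunNP; apply: (measurability _ (RGenOpens.measurableE R)).
move=> _ [_ [a [b ->] <-]]; rewrite setTI comp_preimage.
apply: open_measurableN; move/continuousP : cf; apply; exact: interval_open.
Qed.

(** The closed cube: compactness is available here, not on the half-open [cube]. *)
Let kube c : set 'rV[R]_n := [set x | forall i, x ord0 i \in `[c, c + 1]].

Let compact_kube c : compact (kube c).
Proof. by apply: (rV_compact (A := fun=> `[c, c + 1]%classic)) => _; exact: segment_compact. Qed.

Let cube_kube c : cube c `<=` kube c.
Proof.
move=> x /cubeP xc i; rewrite in_itv/=; have /andP[-> /ltW ->]// := xc i.
Qed.

Lemma continuous_cube_unif c f : continuous f -> forall e, 0 < e -> exists2 d, 0 < d &
  forall x y, cube c x -> cube c y -> (forall i, `|x 0 i - y 0 i| < d) -> `|f x - f y| < e.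
Proof.
move=> cf e e0.
have : \forall d \near 0^'+, kube c `<=`
    [set x : 'rV[R]_n | forall y : 'rV[R]_n, (forall i, `|x 0 i - y 0 i| < d) -> `|f x - f y| < e].
  have /compact_near_coveringP := @compact_kube c; apply => x _.
  have /(cvgrPdist_lt _ _) /(_ _ (divr_gt0 e0 (ltr0Sn R 1))) /nbhs_ballP [r /= r0 xr] := cf x.
  near=> x' d => y /= yd.
  have xx' : ball x (r / 2) x' by near: x'; apply: nbhsx_ballx; exact: divr_gt0.
  have dr : d < r / 2 by near: d; apply: nbhs_right_lt; exact: divr_gt0.
  have h1 : `|f x - f x'| < e / 2.
    by apply: xr; apply: le_ball xx'; rewrite ler_pdivrMr//; lra.
  have h2 : `|f x - f y| < e / 2.
    apply: xr; move/ball_rV: xx' => [_ H]; apply/ball_rV; split => // i.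
    rewrite (_ : x 0 i - y 0 i = (x 0 i - x' 0 i) + (x' 0 i - y 0 i)); last by ring.
    by apply: (le_lt_trans (ler_normD _ _)); have := H i; have := yd i; lra.
  rewrite (_ : f x' - f y = (f x - f y) - (f x - f x')); last by ring.
  by apply: (le_lt_trans (ler_normB _ _)); lra.
move=> H; have : \forall d \near 0^'+, 0 < d /\ kube c `<=`
    [set x : 'rV[R]_n | forall y : 'rV[R]_n, (forall i, `|x 0 i - y 0 i| < d) -> `|f x - f y| < e].
  near=> d; split; near: d => //; exact: nbhs_right_gt.
move=> /filter_ex[d [d0 Hd]]; exists d => // x y xc yc; apply: Hd; exact: cube_kube.
Unshelve. all: by end_near. Qed.

Lemma continuous_cube_bounded c f : continuous f ->
  exists2 M, 0 < M & forall x, cube c x -> `|f x| <= M.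
Proof.
move=> cf; have : compact (f @` kube c).
  by apply: continuous_compact; [exact: continuous_subspaceT|exact: compact_kube].
move=> /compact_bounded[M [_ /(_ (`|M| + 1))]]; rewrite (le_lt_trans (ler_norm M)) ?ltrDl//.
move=> /(_ isT) H; exists (`|M| + 1); first by rewrite ltr_wpDl.
by move=> x /cube_kube xc; apply: H; exists x.
Qed.

(** The class on which [mean] is linear and monotone. The bound is local to the cube, since a
    continuous function may have no global one. *)
Definition bm c f := mfunN f /\ exists M, forall x, cube c x -> `|f x| <= M.

Lemma bm_cont c f : continuous f -> bm c f.
Proof.
move=> cf; split; first exact: continuous_mfunN.
by have [M _ H] := continuous_cube_bounded c cf; exists M.
Qed.

Lemma bm_cst c a : bm c (fun=> a).
Proof. by apply: bm_cont; exact: cst_continuous. Qed.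

Lemma bmD c f g : bm c f -> bm c g -> bm c (fun x => f x + g x).
Proof.
move=> [/mfunNP mf [M fM]] [/mfunNP mg [N gN]]; split.
  by apply/mfunNP; exact: measurable_funD.
exists (M + N) => x xc; apply: (le_trans (ler_normD _ _)).
by apply: lerD; [exact: fM|exact: gN].
Qed.

Lemma bmM c f g : bm c f -> bm c g -> bm c (fun x => f x * g x).
Proof.
move=> [/mfunNP mf [M fM]] [/mfunNP mg [N gN]]; split.
  by apply/mfunNP; exact: measurable_funM.
exists (M * N) => x xc; rewrite normrM.
by apply: ler_pM => //; [exact: fM|exact: gN].
Qed.

Lemma bmN c f : bm c f -> bm c (fun x => - f x).
Proof.
move=> bf; rewrite (_ : (fun x => _) = (fun x => (-1) * f x)); last by apply/funext => x; rewrite mulN1r.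
by apply: bmM => //; exact: bm_cst.
Qed.

Lemma bmB c f g : bm c f -> bm c g -> bm c (fun x => f x - g x).
Proof. by move=> bf bg; apply: bmD => //; exact: bmN. Qed.

Lemma bm_norm c f : bm c f -> bm c (fun x => `|f x|).
Proof.
move=> [/mfunNP mf [M fM]]; split; last by exists M => x /fM; rewrite normr_id.
by apply/mfunNP; exact: measurableT_comp mf.
Qed.

Lemma bm_sum c I (r : seq I) (P : pred I) (F : I -> 'rV[R]_n -> R) :
  (forall i, P i -> bm c (F i)) -> bm c (fun x => \sum_(i <- r | P i) F i x).
Proof.
move=> bF; elim: r => [|a r IH].
  by rewrite (_ : (fun x => _) = (fun=> 0)); [exact: bm_cst|apply/funext => x; rewrite big_nil].
case: (boolP (P a)) => Pa.
  rewrite (_ : (fun x => _) = (fun x => F a x + \sum_(i <- r | P i) F i x)).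
    by apply: bmD => //; exact: bF.
  by apply/funext => x; rewrite big_cons Pa.
by rewrite (_ : (fun x => _) = (fun x => \sum_(i <- r | P i) F i x))//;
  apply/funext => x; rewrite big_cons (negbTE Pa).
Qed.

Definition mean c f : R := (\int[mu c n]_(t in @t2rv R n @^-1` cube c) f (t2rv t))%R.

Lemma measurable_tcube c : measurable (@t2rv R n @^-1` cube c).
Proof. exact: measurable_cube. Qed.
Hint Resolve measurable_tcube : core.

Lemma bm_integrable c f : bm c f ->
  (mu c n).-integrable (@t2rv R n @^-1` cube c) (EFin \o (fun t => f (t2rv t))).
Proof.
move=> [/mfunNP mf [M fM]]; apply: integrable_bounded => //.
  exact: measurable_funTS.
by exists M => t tc; exact: fM.
Qed.

Lemma mean_cst c a : mean c (fun=> a) = a.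
Proof. by rewrite /mean Rintegral_cst// -[RHS]mulr1; congr (_ * _); exact: (congr1 fine (mu_cube c n)). Qed.

Lemma eq_mean c f g : (forall x, cube c x -> f x = g x) -> mean c f = mean c g.
Proof. by move=> fg; apply: eq_Rintegral => t; rewrite inE => tc; exact: fg. Qed.

Lemma meanD c f g : bm c f -> bm c g -> mean c (fun x => f x + g x) = mean c f + mean c g.
Proof. by move=> bf bg; rewrite /mean RintegralD//; exact: bm_integrable. Qed.

Lemma meanB c f g : bm c f -> bm c g -> mean c (fun x => f x - g x) = mean c f - mean c g.
Proof. by move=> bf bg; rewrite /mean RintegralB//; exact: bm_integrable. Qed.

Lemma meanZ c a f : bm c f -> mean c (fun x => a * f x) = a * mean c f.
Proof. by move=> bf; rewrite /mean RintegralZl//; exact: bm_integrable. Qed.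

Lemma mean0 c : mean c (fun=> 0) = 0.
Proof. exact: mean_cst. Qed.

Lemma mean_sum c I (r : seq I) (P : pred I) (F : I -> 'rV[R]_n -> R) :
  (forall i, P i -> bm c (F i)) ->
  mean c (fun x => \sum_(i <- r | P i) F i x) = \sum_(i <- r | P i) mean c (F i).
Proof.
move=> bF; elim: r => [|a r IH].
  by rewrite big_nil -[RHS](mean0 c); apply: eq_mean => x _; rewrite big_nil.
rewrite big_cons; case: (boolP (P a)) => Pa.
  rewrite -IH -meanD; [|exact: bF|exact: bm_sum].
  by apply: eq_mean => x _; rewrite big_cons Pa.
by rewrite -IH; apply: eq_mean => x _; rewrite big_cons (negbTE Pa).
Qed.

Lemma le_mean c f g : bm c f -> bm c g -> (forall x, cube c x -> f x <= g x) ->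
  mean c f <= mean c g.
Proof.
by move=> bf bg fg; apply: le_Rintegral => //; [exact: bm_integrable..|move=> t; exact: fg].
Qed.

Lemma mean_ge0 c f : (forall x, cube c x -> 0 <= f x) -> 0 <= mean c f.
Proof. by move=> f0; apply: Rintegral_ge0 => t; exact: f0. Qed.

Lemma norm_mean c f : bm c f -> `|mean c f| <= mean c (fun x => `|f x|).
Proof. by move=> bf; exact: le_normr_Rintegral (measurable_tcube c) (bm_integrable bf). Qed.

Lemma norm_mean_le c f M : bm c f -> (forall x, cube c x -> `|f x| <= M) -> `|mean c f| <= M.
Proof.
move=> bf fM; have : mean c (fun x => `|f x|) <= mean c (fun=> M).
  by apply: le_mean => //; [exact: bm_norm|exact: bm_cst].
by rewrite mean_cst; apply: le_trans; exact: norm_mean.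
Qed.

End MeanValue.
#[global] Hint Resolve measurable_tcube : core.

(** * Partial derivatives of functions of class C^k *)

Section PartialDerivatives.
Context {R : realType} {n : nat}.
Implicit Types (f g : 'rV[R]_n -> R) (i j : 'I_n) (x a b : 'rV[R]_n).

(** Directional derivatives are treated as derivatives along lines, so that the one-variable chain
    rule, mean value theorem and fundamental theorem apply without total differentiability. *)
Lemma is_derive_line f x (v : 'rV[R]_n) (t df : R) :
  is_derive (t *: v + x) v f df -> is_derive t 1 (fun s : R => f (s *: v + x)) df.
Proof.
have e : (fun h : R => h^-1 *: (((fun s : R => f (s *: v + x)) \o shift t) (h *: 1) - f (t *: v + x)))
    = (fun h => h^-1 *: ((f \o shift (t *: v + x)) (h *: v) - f (t *: v + x))).
  by apply/funext => h /=; congr (_ *: (f _ - _)); rewrite [h *: 1]mulr1 scalerDl addrA.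
by case=> d1 d2; apply: DeriveDef; rewrite /derivable /derive e.
Qed.

Lemma is_derive_line0 f x (v : 'rV[R]_n) (df : R) :
  is_derive (0 : R) 1 (fun s : R => f (s *: v + x)) df -> is_derive x v f df.
Proof.
have e : (fun h : R => h^-1 *: (((fun s : R => f (s *: v + x)) \o shift 0) (h *: 1) - f ((0 : R) *: v + x)))
    = (fun h => h^-1 *: ((f \o shift x) (h *: v) - f x)).
  by apply/funext => h /=; rewrite addr0 scale0r add0r [h *: 1]mulr1.
by rewrite -/(is_derive x v f df); case; rewrite /derivable /derive e => d1 d2; apply: DeriveDef.
Qed.

Lemma is_derive_compR (g : R -> R) f x (v : 'rV[R]_n) (df dg : R) :
  is_derive x v f df -> is_derive (f x) 1 g dg ->
  is_derive x v (fun y => g (f y)) (dg * df).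
Proof.
move=> hf hg; apply: is_derive_line0.
have hf' : is_derive (0 : R) 1 (fun s : R => f (s *: v + x)) df.
  by apply: is_derive_line; rewrite scale0r add0r.
have hg' : is_derive ((fun s : R => f (s *: v + x)) 0) 1 g dg by rewrite scale0r add0r.
exact: (@is_derive1_comp _ g (fun s : R => f (s *: v + x)) 0 dg df).
Qed.

(** A finite order has to be tracked because the cutoff below is only of class C^2; test functions
    enter through [smooth_Ck] at whatever order is needed. *)
Fixpoint Ck (k : nat) f : Prop :=
  match k with
  | 0 => continuous f
  | k'.+1 => continuous f /\ forall i, (forall x, derivable f x (ev R i)) /\ Ck k' (partial i f)
  end.

Lemma Ck_cont k f : Ck k f -> continuous f.
Proof. by case: k => [//|k []]. Qed.

Lemma CkS k f : Ck k.+1 f -> Ck k f.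
Proof.
elim: k f => [|k IH] f; first by case.
by move=> [cf H]; split => // i; have [H1 H2] := H i; split => //; exact: IH.
Qed.

Lemma Ck_partial k f i : Ck k.+1 f -> Ck k (partial i f).
Proof. by case=> _ /(_ i)[]. Qed.

Lemma Ck_derivable k f i x : Ck k.+1 f -> is_derive x (ev R i) f (partial i f x).
Proof. by case=> _ /(_ i)[+ _] => /(_ x) /derivableP. Qed.

Lemma Ck_intro k f (df : 'I_n -> 'rV[R]_n -> R) : continuous f ->
  (forall i x, is_derive x (ev R i) f (df i x)) -> (forall i, Ck k (df i)) -> Ck k.+1 f.
Proof.
move=> cf hf hk; split => // i; split => [x|]; first by have [] := hf i x.
by rewrite (_ : partial i f = df i)//; apply/funext => x; have [] := hf i x.
Qed.

Lemma partialE f i x df : is_derive x (ev R i) f df -> partial i f x = df.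
Proof. by case. Qed.

Lemma partial_cst i (a : R) : partial i (fun=> a : R) = fun=> 0.
Proof. by apply/funext => x; apply: partialE; exact: is_derive_cst. Qed.

Lemma Ck_cst k (a : R) : Ck k (fun=> a).
Proof.
elim: k a => [|k IH] a; first exact: cst_continuous.
apply: (@Ck_intro _ _ (fun _ _ => 0)) => //; first exact: cst_continuous.
Qed.

Lemma is_derive_add f g x (v : 'rV[R]_n) df dg : is_derive x v f df -> is_derive x v g dg ->
  is_derive x v (fun y => f y + g y) (df + dg).
Proof. exact: is_deriveD. Qed.

Lemma is_derive_mul f g x (v : 'rV[R]_n) df dg : is_derive x v f df -> is_derive x v g dg ->
  is_derive x v (fun y => f y * g y) (df * g x + f x * dg).
Proof. by move=> hf hg; rewrite addrC [df * _]mulrC; exact: is_deriveM. Qed.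

Lemma continuous_add f g : continuous f -> continuous g -> continuous (fun x => f x + g x).
Proof. by move=> cf cg x; exact: (continuousD (cf x) (cg x)). Qed.

Lemma continuous_mul f g : continuous f -> continuous g -> continuous (fun x => f x * g x).
Proof. by move=> cf cg x; exact: (continuousM (cf x) (cg x)). Qed.

Lemma CkD k f g : Ck k f -> Ck k g -> Ck k (fun x => f x + g x).
Proof.
elim: k f g => [|k IH] f g hf hg; first exact: continuous_add.
apply: (@Ck_intro _ _ (fun i x => partial i f x + partial i g x)).
- by apply: continuous_add; apply: (@Ck_cont k.+1).
- by move=> i x; apply: is_derive_add; apply: (@Ck_derivable k).
- by move=> i; apply: IH; apply: Ck_partial.
Qed.

Lemma CkM k f g : Ck k f -> Ck k g -> Ck k (fun x => f x * g x).
Proof.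
elim: k f g => [|k IH] f g hf hg; first exact: continuous_mul.
apply: (@Ck_intro _ _ (fun i x => partial i f x * g x + f x * partial i g x)).
- by apply: continuous_mul; apply: (@Ck_cont k.+1).
- by move=> i x; apply: is_derive_mul; apply: (@Ck_derivable k).
- by move=> i; apply: CkD; apply: IH; rewrite ?(Ck_partial, CkS)//; [exact: Ck_partial|exact: CkS|exact: CkS|exact: Ck_partial].
Qed.

Lemma CkZ k (a : R) f : Ck k f -> Ck k (fun x => a * f x).
Proof. by move=> hf; apply: CkM => //; exact: Ck_cst. Qed.

Lemma Ck_sum k I (r : seq I) (P : pred I) (F : I -> 'rV[R]_n -> R) :
  (forall i : I, Ck k (F i)) -> Ck k (fun x => \sum_(i <- r | P i) F i x).
Proof.
move=> hF; elim: r => [|a r IH].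
  by rewrite (_ : (fun x => _) = (fun=> 0)); [exact: Ck_cst|apply/funext => x; rewrite big_nil].
rewrite (_ : (fun x => _) = (fun x => (if P a then F a x else 0) + \sum_(i <- r | P i) F i x)).
  by apply: CkD => //; case: (P a) => //; exact: Ck_cst.
by apply/funext => x; rewrite big_cons; case: (P a); rewrite ?add0r.
Qed.

Lemma Ck_comp k (g g' : R -> R) f : continuous g -> (forall y : R, is_derive y 1 g (g' y)) ->
  Ck k.+1 f -> Ck k (fun x => g' (f x)) -> Ck k.+1 (fun x => g (f x)).
Proof.
move=> cg hg hf hk; apply: (@Ck_intro _ _ (fun i x => g' (f x) * partial i f x)).
- by move=> x; apply: (@continuous_comp _ _ _ f g); [exact: (Ck_cont hf)|exact: cg].
- by move=> i x; apply: is_derive_compR => //; exact: (Ck_derivable i x hf).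
- by move=> i; apply: CkM => //; exact: Ck_partial.
Qed.

Lemma is_derive_coord j i x : is_derive x (ev R i) (fun y : 'rV[R]_n => y 0 j) ((i == j)%:R).
Proof.
apply: is_derive_line0.
rewrite (_ : (fun s : R => _) = ((i == j)%:R \*: (@id R)) + cst (x 0 j)); last first.
  by apply/funext => s; rewrite !mxE eqxx /= eq_sym mulrC.
apply: is_derive_eq.
by rewrite addr0; exact: mulr1.
Qed.

Lemma Ck_coord k j : Ck k (fun y : 'rV[R]_n => y 0 j).
Proof.
case: k => [|k]; first exact: coord_continuous.
apply: (@Ck_intro _ _ (fun i _ => (i == j)%:R)); first exact: coord_continuous.
  by move=> i x; exact: is_derive_coord.
by move=> i; exact: Ck_cst.
Qed.

Lemma smooth_Ck k f : smooth f -> Ck k f.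
Proof.
move=> sf; suff H : forall s, Ck k (dpart s f) by exact: (H [::]).
elim: k => [|k IH] s; first by have [] := sf s.
have [h1 h2] := sf s; split => // i; split; first exact: h2.
exact: (IH (i :: s)).
Qed.

Lemma smooth_coord j : smooth (fun y : 'rV[R]_n => y 0 j).
Proof.
have H s : exists b : bool, dpart s (fun y : 'rV[R]_n => y 0 j) =
    (if s is [::] then fun y => y 0 j else fun=> b%:R).
  elim: s => [|i s IH]; first by exists true.
  case: s IH => [|i' s] [b E]; last by exists false; rewrite /= -/(dpart (i' :: s) _) E partial_cst.
  by exists (i == j); apply/funext => x; apply: partialE; exact: is_derive_coord.
move=> s; have [b ->] := H s; case: s {H} => [|i s].
  by split => [|i x]; [exact: coord_continuous|have [] := is_derive_coord j i x].
by split => [|i' x]; [exact: cst_continuous|exact: derivable_cst].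
Qed.

Lemma schwarz f i j x : Ck 2 f -> partial i (partial j f) x = partial j (partial i f) x.
Proof.
have fin (u v z e : R) : `|u - z| < e / 2 -> `|v - z| < e / 2 -> `|u - v| <= e.
  move=> a1 a2; rewrite (_ : u - v = (u - z) - (v - z)); last by ring.
  by apply: (le_trans (ler_normB _ _)); lra.
move=> hf; set p := partial i _; set q := partial j _.
have cp : continuous p by apply: (@Ck_cont 0); do 2 apply: Ck_partial.
have cq : continuous q by apply: (@Ck_cont 0); do 2 apply: Ck_partial.
(* Both mixed derivatives are attained near x by the same second difference quotient. *)
have mvt (k l : 'I_n) (h : R) : 0 < h -> exists s t : R, [/\ 0 < s < h, 0 < t < h &
   f (h *: ev R k + (h *: ev R l + x)) - f (h *: ev R k + x) - f (h *: ev R l + x) + f x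
   = partial l (partial k f) (t *: ev R l + (s *: ev R k + x)) * h * h].
  move=> h0.
  have [s /itvP sh E1] : exists2 s, s \in `]0, h[ &
      (f (h *: ev R k + (h *: ev R l + x)) - f (h *: ev R k + x)) -
      (f (0 *: ev R k + (h *: ev R l + x)) - f (0 *: ev R k + x)) =
      (partial k f (s *: ev R k + (h *: ev R l + x)) - partial k f (s *: ev R k + x)) * (h - 0).
    have dd (t : R) : is_derive t 1
        (fun s => f (s *: ev R k + (h *: ev R l + x)) - f (s *: ev R k + x))
        (partial k f (t *: ev R k + (h *: ev R l + x)) - partial k f (t *: ev R k + x)).
      by apply: is_deriveB; apply: is_derive_line; apply: (@Ck_derivable 1).
    apply: (MVT (f := fun s => f (s *: ev R k + (h *: ev R l + x)) - f (s *: ev R k + x))) => //.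
    by apply: derivable_within_continuous => t _; have [] := dd t.
  have [t /itvP th E2] : exists2 t, t \in `]0, h[ &
      partial k f (h *: ev R l + (s *: ev R k + x)) - partial k f (0 *: ev R l + (s *: ev R k + x)) =
      partial l (partial k f) (t *: ev R l + (s *: ev R k + x)) * (h - 0).
    have dd (t : R) : is_derive t 1 (fun t => partial k f (t *: ev R l + (s *: ev R k + x)))
        (partial l (partial k f) (t *: ev R l + (s *: ev R k + x))).
      by apply: is_derive_line; apply: (@Ck_derivable 0); apply: Ck_partial.
    apply: (MVT (f := fun t => partial k f (t *: ev R l + (s *: ev R k + x)))) => //.
    by apply: derivable_within_continuous => u _; have [] := dd u.
  exists s, t; split; rewrite ?sh ?th//.
  move: E1 E2; rewrite !scale0r !add0r !subr0 => E1 E2.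
  rewrite addrCA in E2; rewrite -E2 -E1; ring.
apply/eqP; rewrite -subr_eq0 -normr_le0; apply/ler_addgt0Pr => e e0; rewrite add0r.
have e20 : 0 < e / 2 by lra.
have /(cvgrPdist_lt _ _) /(_ _ e20) /nbhs_ballP [r1 /= r10 h1] := cp x.
have /(cvgrPdist_lt _ _) /(_ _ e20) /nbhs_ballP [r2 /= r20 h2] := cq x.
pose h := Num.min r1 r2 / 3.
have h0 : 0 < h by rewrite divr_gt0// lt_min r10 r20.
have hr1 : h + h < r1 by rewrite /h; have : Num.min r1 r2 <= r1 by [rewrite ge_min lexx]; lra.
have hr2 : h + h < r2 by rewrite /h; have : Num.min r1 r2 <= r2 by [rewrite ge_min lexx orbT]; lra.
have near_x (k l : 'I_n) (s t r : R) : 0 < s < h -> 0 < t < h -> h + h < r ->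
    ball x r (t *: ev R l + (s *: ev R k + x)).
  move=> /andP[s0 sh] /andP[t0 th] hr; apply/ball_rV; split; first lra.
  move=> m; rewrite !mxE eqxx /= !opprD !addrA.
  case: eqP => _; case: eqP => _ /=; rewrite ?mulr1 ?mulr0 ltr_norml; apply/andP; split; lra.
have [s [t [sh th E1]]] := mvt i j h h0.
have [s' [t' [sh' th' E2]]] := mvt j i h h0.
have E : q (t *: ev R j + (s *: ev R i + x)) = p (t' *: ev R i + (s' *: ev R j + x)).
  have hh : h * h != 0 by rewrite mulf_neq0// gt_eqF.
  apply: (mulIf hh).
  apply: (etrans (mulrA _ _ _)); apply: (etrans (esym E1)).
  apply: (etrans _ (esym (mulrA _ _ _))); apply: (etrans _ E2).
  have -> : h *: ev R j + (h *: ev R i + x) = h *: ev R i + (h *: ev R j + x) by rewrite addrCA.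
  by congr (_ + _); exact: addrAC.
have a1 := h1 _ (near_x j i s' t' r1 sh' th' hr1).
have a2 := h2 _ (near_x i j s t r2 sh th hr2).
rewrite /= E in a2; rewrite /= in a1.
exact: fin a1 a2.
Qed.

(** Combining partials, instead of taking [derive f x a], makes linearity in the direction
    immediate, and contractions with a gradient turn into [D] directly, as in [ctr_ten]. *)
Definition D a f x := \sum_i a 0 i * partial i f x.

Lemma Ck_D k a f : Ck k.+1 f -> Ck k (D a f).
Proof. by move=> hf; apply: Ck_sum => i; apply: CkZ; exact: Ck_partial. Qed.

Lemma partial_D i a f x : Ck 2 f -> partial i (D a f) x = \sum_j a 0 j * partial i (partial j f) x.
Proof.
move=> hf; apply: partialE; rewrite (_ : D a f = \sum_j (fun y => a 0 j * partial j f y)); last first.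
  by apply/funext => y; rewrite /D fct_sumE.
apply: is_derive_sum => j.
have h1 : is_derive x (ev R i) (fun=> a 0 j) 0 by exact: is_derive_cst.
have h2 : is_derive x (ev R i) (partial j f) (partial i (partial j f) x).
  by apply: (@Ck_derivable 0); exact: Ck_partial.
by apply: is_derive_eq (is_derive_mul h1 h2) _; rewrite mul0r add0r.
Qed.

Lemma D_comm a b f : Ck 2 f -> D a (D b f) = D b (D a f).
Proof.
move=> hf; apply/funext => x; rewrite /D.
under eq_bigr do rewrite partial_D// mulr_sumr.
under [RHS]eq_bigr do rewrite partial_D// mulr_sumr.
rewrite exchange_big; apply: eq_bigr => i _; apply: eq_bigr => j _.
by rewrite (schwarz _ _ _ hf); ring.
Qed.

Lemma D_add a f g : Ck 1 f -> Ck 1 g -> D a (fun x => f x + g x) = fun x => D a f x + D a g x.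
Proof.
move=> hf hg; apply/funext => x; rewrite /D -big_split; apply: eq_bigr => i _ /=.
rewrite -mulrDr; congr (_ * _); apply: partialE.
by apply: is_derive_add; apply: (@Ck_derivable 0).
Qed.

Lemma D_mul a f g : Ck 1 f -> Ck 1 g -> D a (fun x => f x * g x) = fun x => D a f x * g x + f x * D a g x.
Proof.
move=> hf hg; apply/funext => x; rewrite /D mulr_suml mulr_sumr -big_split; apply: eq_bigr => i _ /=.
rewrite (partialE (is_derive_mul (Ck_derivable i x hf) (Ck_derivable i x hg))); ring.
Qed.

Lemma D_cst a (k : R) : D a (fun=> k) = fun=> 0.
Proof.
by apply/funext => x; rewrite /D big1// => i _; rewrite partial_cst mulr0.
Qed.

Lemma D_scale a (k : R) f : Ck 1 f -> D a (fun x => k * f x) = fun x => k * D a f x.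
Proof.
move=> hf; rewrite D_mul//; last exact: Ck_cst.
by rewrite D_cst; apply/funext => x; rewrite mul0r add0r.
Qed.

Lemma D_comp a (g g' : R -> R) f : (forall y : R, is_derive y 1 g (g' y)) -> Ck 1 f ->
  D a (fun x => g (f x)) = fun x => g' (f x) * D a f x.
Proof.
move=> hg hf; apply/funext => x; rewrite /D mulr_sumr; apply: eq_bigr => i _.
rewrite (partialE (is_derive_compR (Ck_derivable i x hf) (hg (f x)))); ring.
Qed.

Lemma D_sum a I (r : seq I) (F : I -> 'rV[R]_n -> R) : (forall i : I, Ck 1 (F i)) ->
  D a (fun x => \sum_(i <- r) F i x) = fun x => \sum_(i <- r) D a (F i) x.
Proof.
move=> hF; elim: r => [|i r IH].
  rewrite (_ : (fun x => \sum_(i <- [::]) F i x) = fun=> 0); last by apply/funext => x; rewrite big_nil.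
  by rewrite D_cst; apply/funext => x; rewrite big_nil.
rewrite (_ : (fun x => \sum_(j <- i :: r) F j x) = fun x => F i x + \sum_(j <- r) F j x); last first.
  by apply/funext => x; rewrite big_cons.
rewrite D_add//; last exact: Ck_sum.
by rewrite IH; apply/funext => x; rewrite big_cons.
Qed.

Lemma D_coord a j : D a (fun y : 'rV[R]_n => y 0 j) = fun=> a 0 j.
Proof.
apply/funext => x; rewrite /D (bigD1 j)//= (partialE (is_derive_coord j j x)) eqxx mulr1.
rewrite big1 ?addr0// => i ij.
by rewrite (partialE (is_derive_coord j i x)) (negbTE ij) mulr0.
Qed.

End PartialDerivatives.

(** * Integration by parts on the cube *)

Section IntegrationByParts.
Context {R : realType}.
Implicit Types (c : R).

Definition tset n (s : n.-tuple R) (i : 'I_n) (t : R) : n.-tuple R :=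
  [tuple if j == i then t else tnth s j | j < n].

Lemma tset_tcons0 n (s : n.-tuple R) (t u : R) :
  tset (tcons (t, s)) ord0 u = tcons (u, s).
Proof.
apply: eq_from_tnth => j; rewrite tnth_mktuple !(tnth_nth t)/=.
by case: (unliftP ord0 j) => [k ->|->]; rewrite ?eqxx// (tnth_nth t).
Qed.

Lemma tset_tconsS n (s : n.-tuple R) (t u : R) (k : 'I_n) :
  tset (tcons (t, s)) (lift ord0 k) u = tcons (t, tset s k u).
Proof.
apply: eq_from_tnth => j; rewrite tnth_mktuple.
case: (unliftP ord0 j) => [l ->|->].
  by rewrite (inj_eq lift_inj) /tcons/= !tnthS tnth_mktuple.
by rewrite -(inj_eq val_inj)/= !(tnth_nth t).
Qed.

Lemma integral_mu_coord0 c n (g : n.-tuple R -> R) (i : 'I_n) :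
  measurable_fun setT g -> (exists M, forall s, `|g s| <= M) ->
  (forall s, (\int[unif c]_t (g (tset s i t))%:E)%E = 0%E) ->
  (\int[mu c n]_s (g s)%:E)%E = 0%E.
Proof.
elim: n g i => [|n IH] g i mg [M gM] g0; first by case: i g0.
case: (unliftP ord0 i) g0 => [k ->|->] g0.
  rewrite integral_mu_consl//; last by exists M.
  rewrite integral0_eq// => t _; apply: (IH (fun s => g (tcons (t, s))) k).
  - exact: (measurableT_comp mg (@measurable_tcons_pair1 R n t)).
  - by exists M.
  - by move=> s; rewrite -[RHS](g0 (tcons (t, s))); apply: eq_integral => u _; rewrite tset_tconsS.
rewrite integral_mu_consr//; last by exists M.
rewrite integral0_eq// => s _; rewrite -[RHS](g0 (tcons (0, s))).
by apply: eq_integral => u _; rewrite tset_tcons0.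
Qed.

Lemma t2rv_tset n (s : n.-tuple R) i t :
  t2rv (tset s i t) = t *: ev R i + t2rv (tset s i 0).
Proof.
apply/rowP => j; rewrite !mxE !tnth_mktuple eqxx/=.
by case: eqP => _; rewrite ?mulr1 ?addr0 ?mulr0 ?add0r.
Qed.

Context {n : nat}.
Implicit Types (F f g : 'rV[R]_n -> R).

(** Fubini in the [i]-th variable, then the fundamental theorem of calculus on each segment, whose
    endpoints lie where [F] vanishes. *)
Lemma mean_partial0 c F (i : 'I_n) :
  Ck 1 F -> (forall x : 'rV[R]_n, x 0 i = c \/ x 0 i = c + 1 -> F x = 0) -> mean c (partial i F) = 0.
Proof.
move=> hF F0; have cF := Ck_cont hF; have cp : continuous (partial i F) by apply: (@Ck_cont _ _ 0); exact: Ck_partial.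
pose g (s : n.-tuple R) : R := \1_(cube c : set 'rV[R]_n) (t2rv s) * partial i F (t2rv s).
have mp := continuous_mfunN cp.
have mg : measurable_fun setT g.
  apply: measurable_funM; last by apply/mfunNP.
  by apply: (@measurable_indic _ (n.-tuple R) R setT (@t2rv R n @^-1` cube c)); exact: measurable_tcube.
have [M M0 hM] := continuous_cube_bounded c cp.
have gM : exists M, forall s, `|g s| <= M.
  exists M => s; rewrite /g indicE; case: (asboolP (cube c (t2rv s))) => h.
    by rewrite mem_set// mul1r; exact: hM.
  by rewrite memNset// mul0r normr0 ltW.
rewrite /mean Rintegral_mkcond /Rintegral.
rewrite (_ : (\int[mu c n]_x _)%E = (\int[mu c n]_s (g s)%:E)%E); last first.
  apply: eq_integral => s _; rewrite /patch /g indicE.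
  have -> : (s \in @t2rv R n @^-1` cube c) = (t2rv s \in cube c) by apply/idP/idP; rewrite !inE.
  by case: ifPn => _; rewrite ?mul1r ?mul0r.
rewrite (@integral_mu_coord0 c n g i)// => s.
have mgi : measurable_fun setT (fun t : R => g (tset s i t)).
  apply: (measurableT_comp mg); apply/measurable_fun_tnthP => j.
  rewrite (_ : _ \o _ = (fun t => if j == i then t else tnth s j)); last first.
    by apply/funext => t /=; rewrite tnth_mktuple.
  by case: eqP => _; [exact: measurable_id|exact: measurable_cst].
rewrite integral_unif//; last by apply/measurable_EFinP.
set x0 := t2rv (tset s i 0).
pose h (t : R) := partial i F (t *: ev R i + x0).
pose G (t : R) := F (t *: ev R i + x0).
have ch : continuous h.
  move=> t; apply: (@continuous_comp _ _ _ (fun t : R => t *: ev R i + x0) (partial i F)); last exact: cp.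
  by apply: cvgD; [exact: scalel_continuous|exact: cvg_cst].
have dG (t : R) : is_derive t 1 G (h t) by apply: is_derive_line; exact: (@Ck_derivable _ _ 0).
have coord t : (t *: ev R i + x0) 0 i = t.
  by rewrite /x0 -t2rv_tset mxE tnth_mktuple eqxx.
have G0 : G c = 0 by apply: F0; left; exact: coord.
have G1 : G (c + 1) = 0 by apply: F0; right; exact: coord.
have int_h : (\int[lebesgue_measure]_(t in `[c, (c + 1)%R[) (h t)%:E = 0)%E.
  rewrite integral_itv_bndo_bndc; last first.
    by apply: measurable_funTS; apply/measurable_EFinP; exact: continuous_measurable_fun.
  rewrite (continuous_FTC2 (F := G)).
  - by rewrite G0 G1 subee.
  - by rewrite ltrDl.
  - exact: continuous_subspaceT.
  - have cG : continuous G.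
      by move=> t; apply/differentiable_continuous/derivable1_diffP; have [] := dG t.
    split.
    + by move=> t _; have [] := dG t.
    + exact/cvg_at_right_filter/cG.
    + exact/cvg_at_left_filter/cG.
  - by move=> t _; rewrite derive1E; have [] := dG t.
(* The line meets the cube in a full segment if the remaining coordinates are admissible, and not at
   all otherwise. *)
have [other|other] := pselect (forall j, j != i -> c <= tnth s j < c + 1).
  rewrite -[RHS]int_h.
  rewrite (eq_integral (fun t : measurableTypeR R => ((fun t => (h t)%:E) \_ (`[c, (c + 1)%R[%classic : set R)) t)); last first.
    move=> t _; rewrite /patch /= /g /h /x0 -t2rv_tset indicE.
    have -> : (t2rv (tset s i t) \in cube c) = (t \in (`[c, (c + 1)%R[%classic : set R)).
      apply/idP/idP; rewrite !inE/= in_itv/=.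
        by move=> /cubeP /(_ i); rewrite mxE tnth_mktuple eqxx.
      move=> ht; apply/cubeP => j; rewrite mxE tnth_mktuple.
      by case: eqP => [//|/eqP ji]; exact: other.
    by case: ifPn => _; rewrite ?mul1r ?mul0r.
  rewrite -integral_mkcondr; congr (integral _ _ _).
  apply/seteqP; split => t /=; rewrite !in_itv/=; first by case.
  by move=> /andP[-> /[dup] /ltW -> ->].
apply: integral0_eq => t _; rewrite /g indicE memNset ?mul0r// => /cubeP H.
by apply: other => j ji; have := H j; rewrite mxE tnth_mktuple (negbTE ji).
Qed.

Definition face0 c F := forall (x : 'rV[R]_n) i, x 0 i = c \/ x 0 i = c + 1 -> F x = 0.

Lemma mean_D0 c F a : Ck 1 F -> face0 c F -> mean c (D a F) = 0.
Proof.
move=> hF F0; rewrite /D mean_sum => [|i _].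
  rewrite big1// => i _; rewrite meanZ.
    by rewrite mean_partial0 ?mulr0// => x; exact: F0.
  by apply: bm_cont; apply: (@Ck_cont _ _ 0); exact: Ck_partial.
by apply: bm_cont; apply: (@Ck_cont _ _ 0); apply: CkZ; exact: Ck_partial.
Qed.

(** Only [f] vanishes on the faces; leaving [g] free is what allows test functions with no boundary
    condition. *)
Lemma mean_by_parts c f g a : Ck 1 f -> Ck 1 g -> face0 c f ->
  mean c (fun x => D a f x * g x) = - mean c (fun x => f x * D a g x).
Proof.
move=> hf hg f0; have := @mean_D0 c (fun x => f x * g x) a (CkM hf hg).
rewrite D_mul// meanD; last 2 first.
- by apply: bm_cont; apply: continuous_mul; [apply: (@Ck_cont _ _ 0); exact: Ck_D|exact: Ck_cont hg].
- by apply: bm_cont; apply: continuous_mul; [exact: Ck_cont hf|apply: (@Ck_cont _ _ 0); exact: Ck_D].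
move=> H; apply/eqP; rewrite -subr_eq0 opprK H// => x i xi.
by rewrite (f0 x i xi) mul0r.
Qed.

End IntegrationByParts.

(** * Localized waves *)

Section Bump.
Context {R : realType}.

(** A quadratic bound on the remainder settles the derivative of [pos_part s ^+ 2] also at 0, where
    the formula changes. *)
Lemma is_derive_quad (g : R -> R) (s d : R) :
  (forall h, `|g (s + h) - g s - d * h| <= h ^+ 2) -> is_derive s 1 g d.
Proof.
move=> H; have L : (fun h => h^-1 *: ((g \o shift s) (h *: 1) - g s)) @ 0^' --> d.
  apply/cvgrPdist_le => e e0; near=> h.
  have h0 : h != 0 by near: h; exact: nbhs_dnbhs_neq.
  have -> : d - h^-1 *: ((g \o shift s) (h *: 1) - g s) = - (h^-1 * (g (s + h) - g s - d * h)).
    rewrite /= [h *: 1]mulr1 [h + s]addrC; change (d - h^-1 * (g (s + h) - g s) = - (h^-1 * (g (s + h) - g s - d * h))).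
    by field.
  rewrite normrN normrM normfV ler_pdivrMl ?normr_gt0//.
  apply: (le_trans (H h)); rewrite -(real_normK (num_real h)) expr2.
  rewrite ler_pM2l ?normr_gt0//; near: h; apply: dnbhs0_le => //.
split; first by apply/cvg_ex; exists d.
exact: cvg_lim L.
Unshelve. all: by end_near. Qed.

Definition pos_part (s : R) : R := Num.max s 0.

Lemma continuous_pos_part : continuous pos_part.
Proof. by move=> s; apply: continuous_max; [exact: cvg_id|exact: cvg_cst]. Qed.

Lemma is_derive_pos2 (s : R) : is_derive s 1 (fun s : R => pos_part s ^+ 2) (2 * pos_part s).
Proof.
apply: is_derive_quad => h; rewrite /pos_part ler_norml.
by case: (lerP s 0) => s0; case: (lerP (s + h) 0) => h0; apply/andP; split; nra.
Qed.

Lemma is_derive_pos3 (s : R) : is_derive s 1 (fun s => s * pos_part s ^+ 2) (3 * pos_part s ^+ 2).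
Proof.
have h1 : is_derive s 1 (fun s : R => s) 1 by exact: is_derive_id.
have h2 := is_derive_pos2 s.
apply: is_derive_eq (is_deriveM h1 h2) _.
change (s * (2 * pos_part s) + pos_part s ^+ 2 * 1 = 3 * pos_part s ^+ 2).
by rewrite /pos_part; case: (lerP s 0) => s0; ring.
Qed.

Context {n : nat}.
Implicit Types (x y a b xi : 'rV[R]_n) (c r lam al : R).

Definition dist2 y r x : R := 1 - (\sum_(i < n) (x 0 i - y 0 i) ^+ 2) * r ^- 2.

Lemma Ck_dist2 k y r : Ck k (dist2 y r).
Proof.
have h : Ck k (fun x => 1 + (- r ^- 2) * \sum_(i < n) (x 0 i + - y 0 i) * (x 0 i + - y 0 i)).
  apply: CkD; first exact: Ck_cst.
  apply: CkZ; apply: Ck_sum => i.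
  by apply: CkM; apply: CkD; (exact: Ck_coord || exact: Ck_cst).
rewrite (_ : dist2 y r = (fun x => 1 + (- r ^- 2) * \sum_(i < n) (x 0 i + - y 0 i) * (x 0 i + - y 0 i)))//.
apply/funext => x; rewrite /dist2 mulNr mulrC; congr (_ - _ * _).
Qed.

(** The third power of the positive part of 1 - |x - y|^2 / r^2: the lowest integer power of class
    C^2, as the perturbation takes two derivatives. Its support is the Euclidean ball inscribed in a
    cell of half-side [r]. *)
Definition cutoff y r x : R := dist2 y r x * pos_part (dist2 y r x) ^+ 2.

Lemma cutoffE y r x : cutoff y r x = pos_part (dist2 y r x) ^+ 3.
Proof. by rewrite /cutoff /pos_part; case: (lerP (dist2 y r x) 0) => _; ring. Qed.

Lemma Ck_cutoff y r : Ck 2 (cutoff y r).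
Proof.
apply: (@Ck_comp _ _ 1 (fun s => s * pos_part s ^+ 2) (fun s => 3 * pos_part s ^+ 2)).
- move=> s; have [d _] := is_derive_pos3 s.
  exact/differentiable_continuous/derivable1_diffP.
- exact: is_derive_pos3.
- exact: Ck_dist2.
- apply: CkZ; apply: (@Ck_comp _ _ 0 (fun s => pos_part s ^+ 2) (fun s => 2 * pos_part s)).
  + move=> s; have [d _] := is_derive_pos2 s.
    exact/differentiable_continuous/derivable1_diffP.
  + exact: is_derive_pos2.
  + exact: Ck_dist2.
  + move=> x; apply: (@continuous_comp _ _ _ (dist2 y r) (fun s => 2 * pos_part s)).
      exact: (@Ck_cont _ _ 0 _ (Ck_dist2 0 y r)).
    by apply: cvgM; [exact: cvg_cst|exact: continuous_pos_part].
Qed.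

Lemma D_cutoff a y r : D a (cutoff y r) = fun x => 3 * pos_part (dist2 y r x) ^+ 2 * D a (dist2 y r) x.
Proof.
exact: (@D_comp _ _ a (fun s => s * pos_part s ^+ 2) (fun s => 3 * pos_part s ^+ 2) _ is_derive_pos3 (Ck_dist2 1 y r)).
Qed.

(** Each term keeps a factor [pos_part (dist2 y r x)], so second derivatives vanish outside the ball
    and on its boundary. *)
Lemma DD_cutoff a b y r : D b (D a (cutoff y r)) = fun x =>
  3 * (2 * pos_part (dist2 y r x) * D b (dist2 y r) x) * D a (dist2 y r) x
  + 3 * pos_part (dist2 y r x) ^+ 2 * D b (D a (dist2 y r)) x.
Proof.
have h2 : Ck 1 (fun x => pos_part (dist2 y r x) ^+ 2).
  apply: (@Ck_comp _ _ 0 (fun s => pos_part s ^+ 2) (fun s => 2 * pos_part s)).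
  + move=> s; have [d _] := is_derive_pos2 s.
    exact/differentiable_continuous/derivable1_diffP.
  + exact: is_derive_pos2.
  + exact: Ck_dist2.
  + move=> x; apply: (@continuous_comp _ _ _ (dist2 y r) (fun s => 2 * pos_part s)).
      exact: (@Ck_cont _ _ 0 _ (Ck_dist2 0 y r)).
    by apply: cvgM; [exact: cvg_cst|exact: continuous_pos_part].
rewrite D_cutoff D_mul; [|exact: CkZ|by apply: Ck_D; exact: Ck_dist2].
by rewrite D_scale// (@D_comp _ _ b _ _ _ is_derive_pos2 (Ck_dist2 1 y r)).
Qed.

Lemma dist2_le0 y r x i : 0 < r -> r <= `|x 0 i - y 0 i| -> dist2 y r x <= 0.
Proof.
move=> r0 h; rewrite subr_le0 ler_pdivlMr ?exprn_gt0// mul1r (bigD1 i)//=.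
apply: (@le_trans _ _ ((x 0 i - y 0 i) ^+ 2)).
  by rewrite -[leRHS]real_normK ?num_real// ler_pXn2r ?nnegrE// ltW.
by rewrite lerDl sumr_ge0// => j _; exact: sqr_ge0.
Qed.

Lemma pos_part_le0 (s : R) : s <= 0 -> pos_part s = 0.
Proof. by move=> s0; rewrite /pos_part max_r. Qed.

Section Off.
Variables (y x : 'rV[R]_n) (r : R) (i : 'I_n).
Hypotheses (r0 : 0 < r) (off : r <= `|x 0 i - y 0 i|).

Lemma cutoff_off : cutoff y r x = 0.
Proof. by rewrite cutoffE pos_part_le0 ?expr0n//; exact: dist2_le0 off. Qed.

Lemma D_cutoff_off a : D a (cutoff y r) x = 0.
Proof. by rewrite D_cutoff pos_part_le0 ?expr0n/= ?mulr0 ?mul0r//; exact: dist2_le0 off. Qed.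

Lemma DD_cutoff_off a b : D b (D a (cutoff y r)) x = 0.
Proof. by rewrite DD_cutoff pos_part_le0 ?expr0n/= ?(mulr0, mul0r, addr0)//; exact: dist2_le0 off. Qed.

End Off.

Lemma cutoff_ge0 y r x : 0 <= cutoff y r x.
Proof. by rewrite cutoffE exprn_ge0// /pos_part le_max lexx orbT. Qed.

Lemma cutoff_le1 y r x : cutoff y r x <= 1.
Proof.
rewrite cutoffE exprn_ile1// /pos_part ?le_max ?lexx ?orbT// ge_max ler01 andbT.
rewrite /dist2 lerBlDr lerDl mulr_ge0// ?sumr_ge0// => [i _|]; first exact: sqr_ge0.
by rewrite invr_ge0 exprn_even_ge0.
Qed.

(** On this box |x - y|^2 <= n (r / 2n)^2 <= r^2 / 4, hence [dist2] is at least 3/4, and (3/4)^6 >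
    1/8. *)
Lemma cutoff_sqr_ge y r x : 0 < r -> (0 < n)%N -> (forall i, `|x 0 i - y 0 i| <= r / (2 * n%:R)) ->
  1 / 8 <= cutoff y r x ^+ 2.
Proof.
move=> r0 n0 h; have nR : 1 <= n%:R :> R by rewrite ler1n.
have n0R : 0 < n%:R :> R by rewrite ltr0n.
have hs : 3 / 4 <= dist2 y r x.
  have : (\sum_(i < n) (x 0 i - y 0 i) ^+ 2) <= \sum_(i < n) (r / (2 * n%:R)) ^+ 2.
    apply: ler_sum => i _; rewrite -[leLHS]real_normK ?num_real// ler_pXn2r ?nnegrE//.
    by rewrite divr_ge0 ?mulr_ge0// ltW.
  rewrite sumr_const card_ord -[_ *+ n]mulr_natr => hS.
  have : (\sum_(i < n) (x 0 i - y 0 i) ^+ 2) * r ^- 2 <= 1 / 4.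
    rewrite ler_pdivrMr ?exprn_gt0//; apply: (le_trans hS).
    have -> : (r / (2 * n%:R)) ^+ 2 * n%:R = r ^+ 2 * (1 / 4 / n%:R) by field; rewrite gt_eqF.
    by rewrite [leRHS]mulrC ler_pM2l ?exprn_gt0// ler_pdivrMr//; lra.
  by rewrite /dist2; lra.
rewrite cutoffE /pos_part max_l; last lra.
set s := dist2 y r x in hs *.
have h2 : 9 / 16 <= s * s by nra.
have h3 : 27 / 64 <= s * s * s by nra.
have -> : s ^+ 3 ^+ 2 = (s * s * s) * (s * s * s) by ring.
by nra.
Qed.

Lemma dcos (y : R) : is_derive y 1 (@cos R) (- sin y).
Proof. exact (is_derive_cos y). Qed.

Lemma dsin (y : R) : is_derive y 1 (@sin R) (cos y).
Proof. exact (is_derive_sin y). Qed.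

Lemma normrM3_le (u k s M : R) : `|u| <= M -> `|s| <= 1 -> `|u * k * s| <= M * `|k|.
Proof.
move=> uM s1; rewrite !normrM -[leRHS]mulr1; apply: ler_pM => //.
by rewrite ler_wpM2r.
Qed.

Definition phase lam al xi x : R := lam * (\sum_(i < n) xi 0 i * x 0 i) + al.

Definition dotp x y : R := \sum_(i < n) x 0 i * y 0 i.

Lemma Ck_phase k lam al xi : Ck k (phase lam al xi).
Proof.
apply: CkD; last exact: Ck_cst.
by apply: CkZ; apply: Ck_sum => i; apply: CkZ; exact: Ck_coord.
Qed.

Lemma D_phase a lam al xi : D a (phase lam al xi) = fun=> lam * dotp xi a.
Proof.
have h (i : 'I_n) : Ck 1 (fun x => xi 0 i * x 0 i) by apply: CkZ; exact: Ck_coord.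
rewrite D_add; [|by apply: CkZ; exact: Ck_sum|exact: Ck_cst].
rewrite D_scale; last exact: Ck_sum.
rewrite D_cst D_sum//; apply/funext => x; rewrite addr0; congr (_ * _).
by apply: eq_bigr => i _; rewrite D_scale ?D_coord//; exact: Ck_coord.
Qed.

Lemma Ck_trig k lam al xi : Ck k (fun x => cos (phase lam al xi x)) /\ Ck k (fun x => sin (phase lam al xi x)).
Proof.
elim: k => [|k [IHc IHs]].
  split=> x.
    by apply: (@continuous_comp _ _ _ (phase lam al xi) cos); [exact: (@Ck_cont _ _ 0 _ (Ck_phase 0 lam al xi))|exact: continuous_cos].
  by apply: (@continuous_comp _ _ _ (phase lam al xi) sin); [exact: (@Ck_cont _ _ 0 _ (Ck_phase 0 lam al xi))|exact: continuous_sin].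
split.
  apply: (@Ck_comp _ _ k _ _ _ (@continuous_cos R) dcos (Ck_phase _ _ _ _)).
  by have := CkZ (-1) IHs; rewrite (_ : (fun x => -1 * _) = (fun x => - sin (phase lam al xi x)))//; apply/funext => x; rewrite mulN1r.
exact: (@Ck_comp _ _ k _ _ _ (@continuous_sin R) dsin (Ck_phase _ _ _ _)).
Qed.

(* Normalized so that D_b D_a wave = (xi . a) (xi . b) cutoff cos(phase) + O(1/lam)
   for |xi| = 1, while the first derivatives are O(1/lam). *)
Definition wave lam al xi y r x : R := cutoff y r x * (- lam ^- 2 * cos (phase lam al xi x)).

Section Wave.
Variables (lam al : R) (xi y : 'rV[R]_n) (r : R).
Hypothesis lam0 : lam != 0.
Let cs x := cos (phase lam al xi x).
Let sn x := sin (phase lam al xi x).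

Lemma Ck_wave : Ck 2 (wave lam al xi y r).
Proof. by apply: CkM; [exact: Ck_cutoff|apply: CkZ; apply: (Ck_trig _ _ _ _).1]. Qed.

Let D_cs a : D a (fun x => - lam ^- 2 * cs x) = fun x => lam^-1 * dotp xi a * sn x.
Proof.
rewrite D_scale; last exact: (Ck_trig _ _ _ _).1.
rewrite (@D_comp _ _ a _ _ _ dcos (Ck_phase 1 lam al xi)).
by apply/funext => x; rewrite D_phase /sn; field.
Qed.

Let D_sn a (k : R) : D a (fun x => lam^-1 * k * sn x) = fun x => k * dotp xi a * cs x.
Proof.
rewrite D_scale; last exact: (Ck_trig _ _ _ _).2.
rewrite (@D_comp _ _ a _ _ _ dsin (Ck_phase 1 lam al xi)).
by apply/funext => x; rewrite D_phase /cs; field.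
Qed.

Lemma D_wave a : D a (wave lam al xi y r) = fun x =>
  D a (cutoff y r) x * (- lam ^- 2 * cs x) + cutoff y r x * (lam^-1 * dotp xi a * sn x).
Proof.
rewrite /wave D_mul ?D_cs//; first by apply: CkS; exact: Ck_cutoff.
by apply: CkZ; apply: (Ck_trig _ _ _ _).1.
Qed.

Lemma DD_wave a b : D b (D a (wave lam al xi y r)) = fun x =>
  D b (D a (cutoff y r)) x * (- lam ^- 2 * cs x) + D a (cutoff y r) x * (lam^-1 * dotp xi b * sn x)
  + (D b (cutoff y r) x * (lam^-1 * dotp xi a * sn x) + cutoff y r x * (dotp xi a * dotp xi b * cs x)).
Proof.
have k1 : Ck 1 (fun x => - lam ^- 2 * cs x) by apply: CkZ; apply: (Ck_trig _ _ _ _).1.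
have k2 : Ck 1 (fun x => lam^-1 * dotp xi a * sn x) by apply: CkZ; apply: (Ck_trig _ _ _ _).2.
have k3 : Ck 1 (cutoff y r) by apply: CkS; exact: Ck_cutoff.
have k4 : Ck 1 (D a (cutoff y r)) by apply: Ck_D; exact: Ck_cutoff.
rewrite D_wave D_add; [|exact: CkM|exact: CkM].
rewrite (D_mul _ k4 k1) (D_mul _ k3 k2) D_cs D_sn//.
Qed.

Lemma wave_off x i : 0 < r -> r <= `|x 0 i - y 0 i| -> wave lam al xi y r x = 0.
Proof. by move=> r0 off; rewrite /wave (cutoff_off r0 off) mul0r. Qed.

Lemma D_wave_off a x i : 0 < r -> r <= `|x 0 i - y 0 i| -> D a (wave lam al xi y r) x = 0.
Proof. by move=> r0 off; rewrite D_wave (cutoff_off r0 off) (D_cutoff_off r0 off) !mul0r addr0. Qed.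

Lemma DD_wave_off a b x i : 0 < r -> r <= `|x 0 i - y 0 i| -> D b (D a (wave lam al xi y r)) x = 0.
Proof.
move=> r0 off; rewrite DD_wave (cutoff_off r0 off) !(D_cutoff_off r0 off) (DD_cutoff_off r0 off).
by rewrite !mul0r !addr0.
Qed.

End Wave.

(** Uniform in the phase [al], which is chosen only after the frequency. The two terms of the
    derivative carry [lam ^- 2] and [lam^-1]. *)
Lemma D_wave_small c y r xi a eta : 0 < eta -> \forall lam \near +oo, forall al x, cube c x ->
  `|D a (wave lam al xi y r) x| <= eta.
Proof.
move=> eta0; have cDb : continuous (D a (cutoff y r)).
  by apply: (@Ck_cont _ _ 0); apply: CkS; apply: Ck_D; exact: Ck_cutoff.
have [M M0 hM] := continuous_cube_bounded c cDb.
pose K := M + `|dotp xi a|; have K0 : 0 < K by rewrite ltr_pwDl.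
near=> lam => al x cx.
have l1 : 1 <= lam by near: lam; exact: nbhs_pinfty_ge.
have lK : K / eta <= lam by near: lam; apply: nbhs_pinfty_ge; exact: num_real.
have lam0 : 0 < lam by lra.
rewrite D_wave ?gt_eqF//; apply: (@le_trans _ _ (K / lam)); last first.
  by rewrite ler_pdivrMr// mulrC -ler_pdivrMr.
have i0 : 0 < lam^-1 by rewrite invr_gt0.
have i1 : lam^-1 <= 1 by rewrite invf_le1.
apply: (le_trans (ler_normD _ _)); rewrite /K mulrDl; apply: lerD.
  rewrite normrM; apply: ler_pM => //; first exact: hM.
  rewrite normrM normrN -exprVn normrX (ger0_norm (ltW i0)) -[leRHS]mulr1.
  apply: ler_pM => //; first by rewrite exprn_ge0// ltW.
    by rewrite expr2 ger_pMl.
  by rewrite ler_norml cos_geN1 cos_le1.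
have := cutoff_ge0 y r x; have := cutoff_le1 y r x; move: (cutoff y r x) => bb bb1 bb0.
rewrite (_ : bb * _ = (bb * dotp xi a * sin (phase lam al xi x)) * lam^-1); last by ring.
rewrite normrM (ger0_norm (ltW i0)) ler_pM2r// -[leRHS]mul1r; apply: normrM3_le.
  by rewrite ger0_norm.
by rewrite ler_norml sin_geN1 sin_le1.
Unshelve. all: by end_near. Qed.

(** The leading term is the one where both derivatives hit the cosine; every other term carries at
    least one factor [lam^-1]. *)
Lemma DD_wave_approx c y r xi a b eta : 0 < eta -> \forall lam \near +oo, forall al x, cube c x ->
  `|D b (D a (wave lam al xi y r)) x - cutoff y r x * cos (phase lam al xi x) * (dotp xi a * dotp xi b)| <= eta.
Proof.
move=> eta0.
have cD e : continuous (D e (cutoff y r)).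
  by apply: (@Ck_cont _ _ 0); apply: CkS; apply: Ck_D; exact: Ck_cutoff.
have cDD : continuous (D b (D a (cutoff y r))).
  by apply: (@Ck_cont _ _ 0); apply: Ck_D; apply: Ck_D; exact: Ck_cutoff.
have [M1 M10 hM1] := continuous_cube_bounded c (cD a).
have [M2 M20 hM2] := continuous_cube_bounded c (cD b).
have [M3 M30 hM3] := continuous_cube_bounded c cDD.
pose K := M3 + M1 * `|dotp xi b| + M2 * `|dotp xi a|.
have K0 : 0 < K by rewrite /K -addrA ltr_pwDl// addr_ge0// mulr_ge0// ltW.
near=> lam => al x cx.
have l1 : 1 <= lam by near: lam; exact: nbhs_pinfty_ge.
have lK : K / eta <= lam by near: lam; apply: nbhs_pinfty_ge; exact: num_real.
have lam0 : 0 < lam by lra.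
apply: (@le_trans _ _ (K / lam)); last by rewrite ler_pdivrMr// mulrC -ler_pdivrMr.
have i0 : 0 < lam^-1 by rewrite invr_gt0.
have i1 : lam^-1 <= 1 by rewrite invf_le1.
rewrite DD_wave ?gt_eqF//.
set C := cos _; set S := sin _; set u := D b (D a _) x; set v := D a _ x; set w := D b _ x.
have -> : u * (- lam ^- 2 * C) + v * (lam^-1 * dotp xi b * S) +
   (w * (lam^-1 * dotp xi a * S) + cutoff y r x * (dotp xi a * dotp xi b * C)) -
   cutoff y r x * C * (dotp xi a * dotp xi b) =
   (- (lam^-1 * C) * u + v * dotp xi b * S + w * dotp xi a * S) * lam^-1.
  by rewrite -exprVn; ring.
have C1 : `|C| <= 1 by rewrite ler_norml cos_geN1 cos_le1.
have S1 : `|S| <= 1 by rewrite ler_norml sin_geN1 sin_le1.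
rewrite normrM (ger0_norm (ltW i0)) ler_pM2r//.
apply: (le_trans (ler_normD _ _)); apply: lerD; last by apply: normrM3_le => //; exact: hM2.
apply: (le_trans (ler_normD _ _)); apply: lerD; last by apply: normrM3_le => //; exact: hM1.
rewrite normrM normrN -[leRHS]mul1r; apply: ler_pM => //; last exact: hM3.
rewrite normrM (ger0_norm (ltW i0)) -[leRHS]mulr1; apply: ler_pM => //; exact: ltW.
Unshelve. all: by end_near. Qed.

Lemma mean_box c (a : 'rV[R]_n) h : 0 <= h -> (forall i, c <= a 0 i /\ a 0 i + h <= c + 1) ->
  bm c (\1_(box a h) : 'rV[R]_n -> R) /\ mean c (\1_(box a h)) = h ^+ n.
Proof.
move=> h0 ha; have mb := measurable_box a h.
have mi : measurable_fun setT (fun s : n.-tuple R => (\1_(box a h) : 'rV[R]_n -> R) (t2rv s)).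
  exact: (@measurable_indic _ (n.-tuple R) R setT (@t2rv R n @^-1` box a h)).
split.
  split; first by apply/mfunNP.
  by exists 1 => x _; rewrite indicE; case: (x \in _); rewrite ?normr1 ?normr0.
rewrite /mean /Rintegral.
rewrite (_ : (\int[_]_(_ in _) _)%E = (h ^+ n)%:E)//.
transitivity (mu c n ((@t2rv R n @^-1` box a h) `&` (@t2rv R n @^-1` cube c))).
  exact: (integral_indic _ (measurable_tcube c) mb).
rewrite setIidl ?mu_box// => s /= H; apply/cubeP => i.
by have /andP[h1 h2] := H i; have [h3 h4] := ha i; apply/andP; split; lra.
Qed.

Lemma mean_cutoff_ge c y r : 0 < r -> (0 < n)%N -> (forall i, c <= y 0 i - r /\ y 0 i + r <= c + 1) ->
  1 / 8 * (r / n%:R) ^+ n <= mean c (fun x => cutoff y r x ^+ 2).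
Proof.
move=> r0 n0 hy; have n1 : 1 <= n%:R :> R by rewrite ler1n.
have n0R : 0 < n%:R :> R by rewrite ltr0n.
set h := r / n%:R; have h0 : 0 < h by exact: divr_gt0.
have hr : h <= r by rewrite ler_pdivrMr// ler_peMr// ltW.
set a : 'rV[R]_n := \row_i (y 0 i - h / 2).
have [b1 b2] : bm c (\1_(box a h) : 'rV[R]_n -> R) /\ mean c (\1_(box a h)) = h ^+ n.
  by apply: mean_box; [exact: ltW|move=> i; rewrite mxE; have := hy i; lra].
rewrite -b2 -meanZ//; apply: le_mean.
- by apply: bmM => //; exact: bm_cst.
- by apply: bm_cont; apply: continuous_mul; apply: (@Ck_cont _ _ 2); exact: Ck_cutoff.
move=> x _; rewrite indicE; case: (asboolP (box a h x)) => hx; last first.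
  by rewrite memNset// mulr0 sqr_ge0.
rewrite mem_set// mulr1; apply: cutoff_sqr_ge => // i.
have := hx i; rewrite mxE ler_norml => /andP[h1 h2].
have -> : r / (2 * n%:R) = h / 2 by rewrite /h; field; rewrite gt_eqF.
by apply/andP; split; lra.
Qed.

(* cos^2 + sin^2 = 1: one of two phases carries half of the mass of the cutoff *)
Lemma mean_wave_ge c y r lam xi : exists al,
  mean c (fun x => cutoff y r x ^+ 2) / 2 <= mean c (fun x => (cutoff y r x * cos (phase lam al xi x)) ^+ 2).
Proof.
have cc al : continuous (fun x => (cutoff y r x * cos (phase lam al xi x)) ^+ 2).
  have h : continuous (fun x => cutoff y r x * cos (phase lam al xi x)).
    apply: continuous_mul; first by apply: (@Ck_cont _ _ 2); exact: Ck_cutoff.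
    by apply: (@Ck_cont _ _ 0); apply: (Ck_trig _ _ _ _).1.
  exact: continuous_mul.
have : mean c (fun x => cutoff y r x ^+ 2) = mean c (fun x => (cutoff y r x * cos (phase lam 0 xi x)) ^+ 2)
   + mean c (fun x => (cutoff y r x * cos (phase lam (pi / 2) xi x)) ^+ 2).
  rewrite -meanD; [|exact: bm_cont|exact: bm_cont].
  apply: eq_mean => x _; rewrite /phase addr0 cosDpihalf !exprMn -mulrDr sqrrN.
  by rewrite cos2Dsin2 mulr1.
move=> H.
have [h|h] := lerP (mean c (fun x => cutoff y r x ^+ 2) / 2) (mean c (fun x => (cutoff y r x * cos (phase lam 0 xi x)) ^+ 2)).
  by exists 0.
by exists (pi / 2); lra.
Qed.

End Bump.

(** * Weak forms and their perturbations *)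

Section WeakForms.
Context {R : realType} {n : nat}.
Implicit Types (c : R) (p q x : 'rV[R]_n) (A : 'M[R]_n) (Phi m : 'rV[R]_n -> 'rV[R]_n)
  (U : 'rV[R]_n -> 'M[R]_n).

Definition ctr A (P : 'I_n -> 'I_n -> R) : R := \sum_i \sum_j A i j * P i j.

Lemma ctrD A1 A2 P : ctr (A1 + A2) P = ctr A1 P + ctr A2 P.
Proof.
rewrite /ctr -big_split; apply: eq_bigr => i _; rewrite -big_split; apply: eq_bigr => j _.
by rewrite mxE mulrDl.
Qed.

Lemma ctrZ (a : R) A P : ctr (a *: A) P = a * ctr A P.
Proof.
rewrite /ctr mulr_sumr; apply: eq_bigr => i _; rewrite mulr_sumr; apply: eq_bigr => j _.
by rewrite mxE mulrA.
Qed.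

Definition grad Phi x (i j : 'I_n) : R := partial j (fun y => Phi y 0 i) x.

(** With [U] equal to m m^T / rho this is [mom_integrand]; keeping [U] independent makes the form
    linear in the pair. *)
Definition mom_form (B : 'M[R]_n) m U Phi x : R :=
  ctr (U x) (grad Phi x) + \sum_(i < n) Phi x 0 i * (\sum_(j < n) B i j * m x 0 j).

Definition weak_mom c B m U := forall Phi, smooth_vf Phi -> div_free Phi ->
  mean c (mom_form B m U Phi) = 0.

Definition weak_mass c m := forall psi, smooth psi -> mean c (mass_integrand m psi) = 0.

(** The contraction of the identity with a gradient is the divergence. This frees the trace of [U],
    and it removes [q I] from the limit equation. *)
Lemma ctr_scalar (a : R) Phi x : div_free Phi -> ctr (a%:M) (grad Phi x) = 0.
Proof.
move=> dPhi; transitivity (a * \sum_(i < n) partial i (fun y => Phi y 0 i) x); last by rewrite dPhi mulr0.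
rewrite /ctr mulr_sumr; apply: eq_bigr => i _.
rewrite (bigD1 i)//= mxE eqxx mulr1n big1 ?addr0// => j ji.
by rewrite mxE eq_sym (negbTE ji) mulr0n mul0r.
Qed.

Definition ten p q : 'M[R]_n := \matrix_(i, j) (p 0 i * q 0 j).
Definition sy p q : 'M[R]_n := ten p q + ten q p.
Definition vdot p Phi x : R := \sum_i p 0 i * Phi x 0 i.

Lemma Ck_vdot k p Phi : smooth_vf Phi -> Ck k (vdot p Phi).
Proof. by move=> sPhi; apply: Ck_sum => i; apply: CkZ; apply: smooth_Ck; exact: sPhi. Qed.

Lemma ctr_ten p q Phi x : smooth_vf Phi -> ctr (ten p q) (grad Phi x) = D q (vdot p Phi) x.
Proof.
move=> sPhi; have h (i : 'I_n) : Ck 1 (fun y => Phi y 0 i) by apply: smooth_Ck; exact: sPhi.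
rewrite /vdot D_sum => [|i]; last exact: CkZ.
apply: eq_bigr => i _; rewrite D_scale// /D mulr_sumr; apply: eq_bigr => j _.
by rewrite mxE mulrA.
Qed.

Lemma ctr_sy p q Phi x : smooth_vf Phi ->
  ctr (sy p q) (grad Phi x) = D q (vdot p Phi) x + D p (vdot q Phi) x.
Proof. by move=> sPhi; rewrite ctrD !ctr_ten. Qed.

(** A list of weighted terms handles a sum of eighteen means at once; the [foldr] hypothesis
    computes to the conjunction of their continuity. *)
Lemma mean_comb c (s : seq (R * ('rV[R]_n -> R))) :
  foldr (fun (p : R * ('rV[R]_n -> R)) P => continuous p.2 /\ P) True s ->
  mean c (fun x => \sum_(p <- s) p.1 * p.2 x) = \sum_(p <- s) p.1 * mean c p.2.
Proof.
move=> h; suff : bm c (fun x => \sum_(p <- s) p.1 * p.2 x) /\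
  mean c (fun x => \sum_(p <- s) p.1 * p.2 x) = \sum_(p <- s) p.1 * mean c p.2 by case.
elim: s h => [_|p s IH /= [cp /IH [b E]]].
  rewrite (_ : (fun x => _) = fun=> 0); last by apply/funext => x; rewrite big_nil.
  by rewrite mean0 big_nil; split => //; exact: bm_cst.
rewrite (_ : (fun x => _) = fun x => p.1 * p.2 x + \sum_(q <- s) q.1 * q.2 x); last first.
  by apply/funext => x; rewrite big_cons.
have b1 : bm c (fun x => p.1 * p.2 x) by apply: bmM; [exact: bm_cst|exact: bm_cont].
split; first exact: bmD.
by rewrite meanD// E meanZ ?big_cons//; exact: bm_cont.
Qed.

Section Perturbation.
Variables (c : R) (theta : 'rV[R]_n -> R).
Hypotheses (Cth : Ck 2 theta) (th0 : face0 c theta) (Dth0 : forall a, face0 c (D a theta)).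

Let T (g : 'rV[R]_n -> R) : R := mean c (fun x => theta x * g x).

Let mean1 a g : Ck 1 g -> mean c (fun x => D a theta x * g x) = - T (D a g).
Proof. by move=> hg; rewrite (mean_by_parts a (CkS Cth) hg th0). Qed.

Let mean2 a b g : Ck 2 g -> mean c (fun x => D a (D b theta) x * g x) = T (D b (D a g)).
Proof.
move=> hg; rewrite (mean_by_parts a (Ck_D b Cth) (CkS hg) (Dth0 b)).
rewrite mean1 ?opprK//; exact: (Ck_D _ hg).
Qed.

Variables (B : 'M[R]_n) (w b xi cc dd : 'rV[R]_n).
Hypothesis ccE : forall i, cc 0 i = \sum_(j < n) B i j * w 0 j.
Hypothesis ddE : forall i, dd 0 i = \sum_(j < n) B i j * xi 0 j.

(** Formally divergence-free because D_w D_xi D_xi theta cancels D_xi D_w D_xi theta. With [xi]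
    orthogonal to [w] the second term is small at high frequency, and [w] is the direction of
    oscillation. *)
Definition pert_m x : 'rV[R]_n := D xi (D xi theta) x *: w - D w (D xi theta) x *: xi.

(* The first four terms are a double curl of theta; the remaining ones form a
   symmetric matrix whose divergence is B pert_m, via
   div [c (.) a D_b + c (.) b D_a - a (.) b D_c] theta / 2 = c D_a D_b theta. *)
Definition pert_V x : 'M[R]_n :=
  D xi (D xi theta) x *: sy b w + (- D w (D xi theta) x) *: sy b xi
  + (- D b (D xi theta) x) *: sy w xi + (2 * D w (D b theta) x) *: ten xi xi
  + (D xi theta x *: sy cc xi + (- D cc theta x) *: ten xi xi)
  + (- 2^-1) *: (D xi theta x *: sy dd w + D w theta x *: sy dd xi + (- D dd theta x) *: sy w xi).

(** The trace is subtracted because subsolutions are traceless; divergence-free test fields do not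
    see the change. *)
Definition pert_U x : 'M[R]_n := pert_V x + (- (\tr (pert_V x) / n%:R))%:M.

Lemma weak_mass_pert : weak_mass c pert_m.
Proof.
move=> psi spsi; have hk k : Ck k psi by exact: smooth_Ck.
have cD1 a e : continuous (D a (D e theta)) := Ck_cont (Ck_D a (Ck_D e Cth)).
have cD2 a : continuous (D a psi) := Ck_cont (Ck_D a (hk 1)).
rewrite (_ : mass_integrand _ _ = fun x => \sum_(p <- [::
   (1, fun x => D xi (D xi theta) x * D w psi x); (-1, fun x => D w (D xi theta) x * D xi psi x)]) p.1 * p.2 x).
  rewrite mean_comb; last by split; [|split => //]; apply: continuous_mul.
  rewrite !big_cons big_nil /= !mean2; [|exact: (Ck_D _ (hk 3))..].
  by rewrite (D_comm w xi (hk 2)); ring.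
apply/funext => x; rewrite !big_cons big_nil /= addr0 mul1r mulN1r /mass_integrand [D w psi x]/D [D xi psi x]/D !mulr_sumr -sumrB.
by apply: eq_bigr => i _; rewrite !mxE; ring.
Qed.

Local Opaque D.

(** All derivatives are moved from [theta] to the test field; once they are commuted only eight
    distinct means remain, and their coefficients cancel. *)
Lemma weak_mom_pert : weak_mom c B pert_m pert_U.
Proof.
move=> Phi sPhi dPhi; have hk k p : Ck k (vdot p Phi) by exact: Ck_vdot.
have hD k a p : Ck k (D a (vdot p Phi)) := Ck_D a (hk k.+1 p).
have c2 a e : continuous (D a (D e theta)) := Ck_cont (Ck_D a (Ck_D e Cth)).
have c1 a : continuous (D a theta) := Ck_cont (Ck_D a Cth).
have cv p : continuous (vdot p Phi) := Ck_cont (hk 0 p).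
have cDv a p : continuous (D a (vdot p Phi)) := Ck_cont (hD 0 a p).
pose s : seq (R * ('rV[R]_n -> R)) := [::
  (1, fun x => D xi (D xi theta) x * D w (vdot b Phi) x);
  (1, fun x => D xi (D xi theta) x * D b (vdot w Phi) x);
  (-1, fun x => D w (D xi theta) x * D xi (vdot b Phi) x);
  (-1, fun x => D w (D xi theta) x * D b (vdot xi Phi) x);
  (-1, fun x => D b (D xi theta) x * D xi (vdot w Phi) x);
  (-1, fun x => D b (D xi theta) x * D w (vdot xi Phi) x);
  (2, fun x => D w (D b theta) x * D xi (vdot xi Phi) x);
  (1, fun x => D xi theta x * D xi (vdot cc Phi) x);
  (1, fun x => D xi theta x * D cc (vdot xi Phi) x);
  (-1, fun x => D cc theta x * D xi (vdot xi Phi) x);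
  (- 2^-1, fun x => D xi theta x * D w (vdot dd Phi) x);
  (- 2^-1, fun x => D xi theta x * D dd (vdot w Phi) x);
  (- 2^-1, fun x => D w theta x * D xi (vdot dd Phi) x);
  (- 2^-1, fun x => D w theta x * D dd (vdot xi Phi) x);
  (2^-1, fun x => D dd theta x * D xi (vdot w Phi) x);
  (2^-1, fun x => D dd theta x * D w (vdot xi Phi) x);
  (1, fun x => D xi (D xi theta) x * vdot cc Phi x);
  (-1, fun x => D w (D xi theta) x * vdot dd Phi x)].
have -> : mom_form B pert_m pert_U Phi = fun x => \sum_(p <- s) p.1 * p.2 x.
  apply/funext => x; rewrite /mom_form /pert_U ctrD ctr_scalar// addr0 /pert_V.
  have -> : \sum_(i < n) Phi x 0 i * (\sum_(j < n) B i j * pert_m x 0 j) =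
      D xi (D xi theta) x * vdot cc Phi x - D w (D xi theta) x * vdot dd Phi x.
    rewrite /vdot !mulr_sumr -sumrB; apply: eq_bigr => i _.
    have -> : \sum_(j < n) B i j * pert_m x 0 j = D xi (D xi theta) x * cc 0 i - D w (D xi theta) x * dd 0 i.
      rewrite ccE ddE !mulr_sumr -sumrB; apply: eq_bigr => j _; rewrite !mxE; ring.
    ring.
  rewrite !(ctrD, ctrZ, ctr_sy, ctr_ten)// /s !big_cons big_nil /=.
  by do ![move: (D _ _ x) => ?]; do ![move: (vdot _ _ x) => ?]; field.
rewrite mean_comb; last by rewrite /s /=; do ?[split; first exact: continuous_mul].
rewrite /s !big_cons big_nil /=.
have C3 a e f p : D a (D e (D f (vdot p Phi))) = D e (D a (D f (vdot p Phi))) := D_comm a e (hD 2 f p).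
have C2 a e p : D a (D e (vdot p Phi)) = D e (D a (vdot p Phi)) := D_comm a e (hk 2 p).
have N (g h : 'rV[R]_n -> R) : g = h -> - T g = - T h by move=> ->.
have lc (a x y S S' : R) : x = y -> S = S' -> a * x + S = a * y + S' by move=> -> ->.
(* The cancellation, in the order of the list [s]; terms with a single derivative on [theta] change
   sign. *)
have fin (t1 t2 t3 t4 t5 t6 t7 t8 : R) :
  1 * t1 + (1 * t2 + (-1 * t1 + (-1 * t3 + (-1 * t2 + (-1 * t3 + (2 * t3 + (1 * - t4 + (1 * - t5 +
  (-1 * - t5 + (- 2^-1 * - t6 + (- 2^-1 * - t7 + (- 2^-1 * - t6 + (- 2^-1 * - t8 + (2^-1 * - t7 +
  (2^-1 * - t8 + (1 * t4 + (-1 * t6 + 0))))))))))))))))) = 0 by field.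
apply: (etrans _ (fin (T (D xi (D xi (D w (vdot b Phi))))) (T (D xi (D xi (D b (vdot w Phi)))))
  (T (D xi (D w (D b (vdot xi Phi))))) (T (D xi (D xi (vdot cc Phi)))) (T (D xi (D cc (vdot xi Phi))))
  (T (D xi (D w (vdot dd Phi)))) (T (D xi (D dd (vdot w Phi)))) (T (D w (D dd (vdot xi Phi)))))).
have h7 : D b (D w (D xi (vdot xi Phi))) = D xi (D w (D b (vdot xi Phi))).
  exact: (etrans (congr1 (D b) (C2 w xi xi)) (etrans (C3 b xi w xi) (congr1 (D xi) (C2 b w xi)))).
apply: (lc _ _ _ _ _ (mean2 xi xi (hD 2 w b))).
apply: (lc _ _ _ _ _ (mean2 xi xi (hD 2 b w))).
apply: (lc _ _ _ _ _ (etrans (mean2 w xi (hD 2 xi b)) (congr1 T (congr1 (D xi) (C2 w xi b))))).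
apply: (lc _ _ _ _ _ (mean2 w xi (hD 2 b xi))).
apply: (lc _ _ _ _ _ (etrans (mean2 b xi (hD 2 xi w)) (congr1 T (congr1 (D xi) (C2 b xi w))))).
apply: (lc _ _ _ _ _ (etrans (mean2 b xi (hD 2 w xi)) (congr1 T (congr1 (D xi) (C2 b w xi))))).
apply: (lc _ _ _ _ _ (etrans (mean2 w b (hD 2 xi xi)) (congr1 T h7))).
apply: (lc _ _ _ _ _ (mean1 xi (hD 1 xi cc))).
apply: (lc _ _ _ _ _ (mean1 xi (hD 1 cc xi))).
apply: (lc _ _ _ _ _ (etrans (mean1 cc (hD 1 xi xi)) (N _ _ (C2 cc xi xi)))).
apply: (lc _ _ _ _ _ (mean1 xi (hD 1 w dd))).
apply: (lc _ _ _ _ _ (mean1 xi (hD 1 dd w))).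
apply: (lc _ _ _ _ _ (etrans (mean1 w (hD 1 xi dd)) (N _ _ (C2 w xi dd)))).
apply: (lc _ _ _ _ _ (mean1 w (hD 1 dd xi))).
apply: (lc _ _ _ _ _ (etrans (mean1 dd (hD 1 xi w)) (N _ _ (C2 dd xi w)))).
apply: (lc _ _ _ _ _ (etrans (mean1 dd (hD 1 w xi)) (N _ _ (C2 dd w xi)))).
apply: (lc _ _ _ _ _ (mean2 xi xi (hk 2 cc))).
exact: (lc _ _ _ _ _ (mean2 w xi (hk 2 dd)) erefl).
Qed.

Local Transparent D.

End Perturbation.
End WeakForms.

(** * The perturbation supported in one cell *)

Section Cell.
Context {R : realType} {n : nat}.
Implicit Types (c : R) (x y p q : 'rV[R]_n).

Lemma pert_VE (theta : 'rV[R]_n -> R) w b xi cc dd x i j :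
  pert_V theta w b xi cc dd x i j =
  D xi (D xi theta) x * sy b w i j + (- D w (D xi theta) x) * sy b xi i j
  + (- D b (D xi theta) x) * sy w xi i j + (2 * D w (D b theta) x) * ten xi xi i j
  + (D xi theta x * sy cc xi i j + (- D cc theta x) * ten xi xi i j)
  + (- 2^-1) * (D xi theta x * sy dd w i j + D w theta x * sy dd xi i j + (- D dd theta x) * sy w xi i j).
Proof.
rewrite /pert_V; move: (sy b w) (sy b xi) (sy w xi) (ten xi xi) (sy cc xi) (sy dd w) (sy dd xi) => A1 A2 A3 A4 A5 A6 A7.
by rewrite !mxE.
Qed.

Lemma pert_UE (theta : 'rV[R]_n -> R) w b xi cc dd x i j :
  pert_U theta w b xi cc dd x i j =
  pert_V theta w b xi cc dd x i j - \tr (pert_V theta w b xi cc dd x) / n%:R * (i == j)%:R.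
Proof.
rewrite /pert_U; move: (pert_V _ _ _ _ _ _ _) => A; rewrite mxE; congr (_ + _).
by rewrite mxE; case: eqP => _; rewrite ?mulr1n ?mulr0n ?mulr1 ?mulr0 ?oppr0.
Qed.

Lemma sy_sym p q i j : sy p q i j = sy p q j i.
Proof. by rewrite !mxE; ring. Qed.

Lemma ten_sym p i j : ten p p i j = ten p p j i.
Proof. by rewrite !mxE; ring. Qed.

Lemma tr_sy p q : \tr (sy p q) = 2 * dotp p q.
Proof. by rewrite /mxtrace /dotp mulr_sumr; apply: eq_bigr => i _; rewrite !mxE; ring. Qed.

Lemma mxtrace_scalar_n (a : R) : (0 < n)%N -> \tr ((a / n%:R)%:M : 'M[R]_n) = a.
Proof.
move=> n0; rewrite mxtrace_scalar -mulr_natr; field.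
by rewrite pnatr_eq0 -lt0n.
Qed.

Lemma continuous_opp (f : 'rV[R]_n -> R) : continuous f -> continuous (fun x => - f x).
Proof. by move=> cf x; exact: (continuousN (cf x)). Qed.

Lemma continuous_cmul (f : 'rV[R]_n -> R) (k : R) : continuous f -> continuous (fun x => f x * k).
Proof. by move=> cf; apply: continuous_mul => //; exact: cst_continuous. Qed.

Lemma continuous_sum I (s : seq I) (F : I -> 'rV[R]_n -> R) :
  (forall i, continuous (F i)) -> continuous (fun x => \sum_(i <- s) F i x).
Proof. by move=> cF; apply: (@Ck_cont _ _ 0); exact: Ck_sum. Qed.

Lemma continuous_comb8 (f1 f2 f3 f4 f5 f6 f7 f8 : 'rV[R]_n -> R) (s1 s2 s3 s4 s5 s6 s7 : R) :
  continuous f1 -> continuous f2 -> continuous f3 -> continuous f4 ->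
  continuous f5 -> continuous f6 -> continuous f7 -> continuous f8 ->
  continuous (fun x => f1 x * s1 + (- f2 x) * s2 + (- f3 x) * s3 + (2 * f4 x) * s4
    + (f5 x * s5 + (- f6 x) * s4) + (- 2^-1) * (f5 x * s6 + f7 x * s7 + (- f8 x) * s3)).
Proof.
move=> h1 h2 h3 h4 h5 h6 h7 h8.
have c1 := continuous_cmul (k:=s1) h1; have c2 := continuous_cmul (k:=s2) (continuous_opp h2).
have c3 := continuous_cmul (k:=s3) (continuous_opp h3).
have c4 := continuous_cmul (k:=s4) (continuous_mul (@cst_continuous _ _ (2 : R)) h4).
have c5 := continuous_cmul (k:=s5) h5; have c6 := continuous_cmul (k:=s4) (continuous_opp h6).
have c7 := continuous_cmul (k:=s6) h5; have c8 := continuous_cmul (k:=s7) h7.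
have c9 := continuous_cmul (k:=s3) (continuous_opp h8).
have d1 := continuous_add (continuous_add (continuous_add c1 c2) c3) c4.
have d2 := continuous_add c5 c6.
have d3 := continuous_mul (@cst_continuous _ _ (- 2^-1 : R)) (continuous_add (continuous_add c7 c8) c9).
exact: continuous_add (continuous_add d1 d2) d3.
Qed.

(** [tau] is the scalar profile of the wave: up to [eta] the pair is [tau] times the constant pair
    [(w, sy b w)]. The last clause keeps a fixed share of the volume of the cell; its 1/16 is 1/8
    from the cutoff times 1/2 from the choice of phase. *)
Definition cell_perturbation c (B : 'M[R]_n) y (r : R) (w b : 'rV[R]_n) (eta : R)
    (wt : 'rV[R]_n -> 'rV[R]_n) (Ut : 'rV[R]_n -> 'M[R]_n) (tau : 'rV[R]_n -> R) : Prop :=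
  [/\ [/\ forall i, continuous (fun x => wt x 0 i),
          forall i j, continuous (fun x => Ut x i j) & continuous tau],
      forall x i, r <= `|x 0 i - y 0 i| -> [/\ wt x = 0, Ut x = 0 & tau x = 0],
      forall x, cube c x -> [/\ `|tau x| <= 1,
        forall i, `|wt x 0 i - tau x * w 0 i| <= eta &
        forall i j, `|Ut x i j - tau x * sy b w i j| <= eta],
      (forall x i j, Ut x i j = Ut x j i) /\ (forall x, \tr (Ut x) = 0) &
      [/\ weak_mass c wt, weak_mom c B wt Ut &
        1 / 16 * (r / n%:R) ^+ n <= mean c (fun x => tau x ^+ 2)]].

(** As [xi] is orthogonal to [w] and [b], among the second derivatives of the wave that occur only
    D_xi D_xi survives at high frequency, leaving [tau * w] and [tau * sy b w]. *)
Lemma ex_cell_perturbation c (B : 'M[R]_n) y r w b xi eta :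
  (0 < n)%N -> 0 < r -> (forall i, c <= y 0 i - r /\ y 0 i + r <= c + 1) ->
  dotp xi xi = 1 -> dotp xi w = 0 -> dotp xi b = 0 -> dotp b w = 0 -> 0 < eta ->
  exists wt Ut tau, cell_perturbation c B y r w b eta wt Ut tau.
Proof.
move=> n0 r0 hy xi1 xiw xib bw eta0.
pose cc : 'rV[R]_n := \row_i \sum_(j < n) B i j * w 0 j.
pose dd : 'rV[R]_n := \row_i \sum_(j < n) B i j * xi 0 j.
have ccE i : cc 0 i = \sum_(j < n) B i j * w 0 j by rewrite mxE.
have ddE i : dd 0 i = \sum_(j < n) B i j * xi 0 j by rewrite mxE.
pose S p := \sum_(i < n) `|p 0 i|.
have S0 p : 0 <= S p by apply: sumr_ge0.
have pS p i : `|p 0 i| <= S p by rewrite /S (bigD1 i)//= lerDl sumr_ge0.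
pose M := 1 + S w + S b + S xi + S cc + S dd.
have [Mw Mb Mxi Mcc Mdd] : [/\ S w <= M, S b <= M, S xi <= M, S cc <= M & S dd <= M].
  have := S0 w; have := S0 b; have := S0 xi; have := S0 cc; have := S0 dd.
  by rewrite /M; clear => *; split; lra.
have M1 : 1 <= M.
  have := S0 w; have := S0 b; have := S0 xi; have := S0 cc; have := S0 dd.
  by rewrite /M => *; lra.
clearbody M.
have M0 : 0 < M by lra.
have MM0 : 0 < M ^+ 2 by rewrite exprn_gt0.
(* The nine terms of [V] are off by at most 14 M^2 e in total, and subtracting the trace at most
   doubles this. *)
pose e := eta / (28 * M ^+ 2); have e0 : 0 < e by rewrite divr_gt0// mulr_gt0.
pose approx2 lam a a' := forall (al : R) x, cube c x -> `|D a (D a' (wave lam al xi y r)) x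
  - cutoff y r x * cos (phase lam al xi x) * (dotp xi a' * dotp xi a)| <= e.
pose small1 lam a := forall (al : R) x, cube c x -> `|D a (wave lam al xi y r) x| <= e.
have [lam [lam0 [H1 H2 H3 H4] [K1 K2 K3 K4]]] : exists lam : R, [/\ 0 < lam,
   [/\ approx2 lam xi xi, approx2 lam w xi, approx2 lam b xi & approx2 lam w b] &
   [/\ small1 lam xi, small1 lam w, small1 lam cc & small1 lam dd]].
  apply: (@filter_ex _ (pinfty_nbhs R)); near=> lam.
  split; first by near: lam; exact: nbhs_pinfty_gt.
    by split; near: lam; exact: DD_wave_approx.
  by split; near: lam; exact: D_wave_small.
have [al hal] := mean_wave_ge c y r lam xi.
have lamN0 : lam != 0 by rewrite gt_eqF.
rewrite /approx2 /small1 in H1 H2 H3 H4 K1 K2 K3 K4; clear approx2 small1.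
set th := wave lam al xi y r in H1 H2 H3 H4 K1 K2 K3 K4 *.
have Cth : Ck 2 th by exact: Ck_wave.
have face (x : 'rV[R]_n) i : x 0 i = c \/ x 0 i = c + 1 -> r <= `|x 0 i - y 0 i|.
  have [h1 h2] := hy i; case=> ->; first by rewrite distrC ler_normr; apply/orP; left; lra.
  by rewrite ler_normr; apply/orP; left; lra.
have th0 : face0 c th by move=> x i /face; exact: wave_off.
have Dth0 a : face0 c (D a th) by move=> x i /face; exact: D_wave_off.
pose tau x := cutoff y r x * cos (phase lam al xi x).
pose V := pert_V th w b xi cc dd.
have cD1 a : continuous (D a th) := Ck_cont (Ck_D a Cth).
have cD2 a a' : continuous (D a (D a' th)) := Ck_cont (Ck_D a (Ck_D a' Cth)).
have cV i j : continuous (fun x => V x i j).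
  have VE := funext (fun x => pert_VE th w b xi cc dd x i j).
  rewrite /V VE.
  exact: continuous_comb8.
exists (pert_m th w xi), (pert_U th w b xi cc dd), tau; split.
- split=> [i|i j|].
  + rewrite (_ : (fun x => _) = fun x => D xi (D xi th) x * w 0 i + (- D w (D xi th) x) * xi 0 i).
      exact: continuous_add (continuous_cmul (cD2 xi xi)) (continuous_cmul (continuous_opp (cD2 w xi))).
    by apply/funext => x; rewrite /pert_m !mxE; ring.
  + rewrite (_ : (fun x => _) = fun x => V x i j + (\sum_(k < n) V x k k) * (- (n%:R^-1 * (i == j)%:R))).
      apply: continuous_add; first exact: cV.
      by apply: continuous_cmul; apply: continuous_sum => k; exact: cV.
    by apply/funext => x; rewrite pert_UE -/V /mxtrace; ring.
  + apply: continuous_mul; first exact: (Ck_cont (Ck_cutoff y r)).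
    exact: (Ck_cont (Ck_trig 0 lam al xi).1).
- move=> x i off.
  have d1 a : D a th x = 0 by exact: D_wave_off off.
  have d2 a a' : D a (D a' th) x = 0 by exact: DD_wave_off off.
  have v0 : V x = 0 by apply/matrixP => k l; rewrite pert_VE !d2 !d1 [RHS]mxE; ring.
  split; last by rewrite /tau (cutoff_off r0 off) mul0r.
    by rewrite /pert_m !d2 !scale0r subr0.
  by rewrite /pert_U -/V v0 mxtrace0 mul0r oppr0 raddf0 addr0.
- move=> x cx.
  have C1 : `|cos (phase lam al xi x)| <= 1 by rewrite ler_norml cos_geN1 cos_le1.
  have tau1 : `|tau x| <= 1.
    rewrite normrM -[leRHS]mulr1; apply: ler_pM => //.
    by rewrite ger0_norm ?cutoff_ge0 ?cutoff_le1.
  have {}H1 := H1 al x cx; have {}H2 := H2 al x cx; have {}H3 := H3 al x cx; have {}H4 := H4 al x cx.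
  have {}K1 := K1 al x cx; have {}K2 := K2 al x cx; have {}K3 := K3 al x cx; have {}K4 := K4 al x cx.
  rewrite -/(tau x) -/th xi1 mulr1 mulr1 in H1.
  rewrite -/(tau x) -/th xiw !mulr0 subr0 in H2.
  rewrite -/(tau x) -/th xib !mulr0 subr0 in H3.
  rewrite -/(tau x) -/th xiw !mulr0 subr0 in H4.
  have eE : 28 * (M ^+ 2 * e) = eta by rewrite /e; field; rewrite gt_eqF.
  have bd (a z k : R) : `|a| <= e -> `|z| <= k -> `|a * z| <= e * k.
    by move=> ? ?; rewrite normrM; apply: ler_pM.
  have Me : M * e <= M ^+ 2 * e by rewrite ler_pM2r// expr2 ler_peMl// ltW.
  have tM p q i j : S p <= M -> S q <= M -> `|ten p q i j| <= M ^+ 2.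
    move=> pM qM; rewrite mxE normrM expr2; apply: ler_pM => //.
      exact: le_trans (pS _ _) pM.
    exact: le_trans (pS _ _) qM.
  have sM p q i j : S p <= M -> S q <= M -> `|sy p q i j| <= 2 * M ^+ 2.
    move=> pM qM; rewrite mxE; apply: (le_trans (ler_normD _ _)).
    by have h1 := tM p q i j pM qM; have h2 := tM q p i j qM pM; clear - h1 h2; lra.
  have eM0 : 0 < M ^+ 2 * e by rewrite mulr_gt0.
  have hV i j : `|V x i j - tau x * sy b w i j| <= 14 * (M ^+ 2 * e).
    rewrite /V pert_VE.
    have b1 := bd _ _ _ H1 (sM b w i j Mb Mw).
    have b2 := bd _ _ _ H2 (sM b xi i j Mb Mxi).
    have b3 := bd _ _ _ H3 (sM w xi i j Mw Mxi).
    have b4 := bd _ _ _ H4 (tM xi xi i j Mxi Mxi).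
    have b5 := bd _ _ _ K1 (sM cc xi i j Mcc Mxi).
    have b6 := bd _ _ _ K3 (tM xi xi i j Mxi Mxi).
    have b7 := bd _ _ _ K1 (sM dd w i j Mdd Mw).
    have b8 := bd _ _ _ K2 (sM dd xi i j Mdd Mxi).
    have b9 := bd _ _ _ K4 (sM w xi i j Mw Mxi).
    move: b1 b2 b3 b4 b5 b6 b7 b8 b9; rewrite !ler_norml.
    move: (sy b w i j) (sy b xi i j) (sy w xi i j) (ten xi xi i j) (sy cc xi i j) (sy dd w i j) (sy dd xi i j).
    move: (D xi (D xi th) x) (D w (D xi th) x) (D b (D xi th) x) (D w (D b th) x) (D xi th x) (D cc th x) (D w th x) (D dd th x) (tau x).
    clear - M; move=> d1 d2 d3 d4 d5 d6 d7 d8 t s1 s2 s3 s4 s5 s6 s7.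
    move=> /andP[? ?] /andP[? ?] /andP[? ?] /andP[? ?] /andP[? ?] /andP[? ?] /andP[? ?] /andP[? ?] /andP[? ?].
    by apply/andP; split; lra.
  split => // [i|i j].
    rewrite (_ : _ - _ = (D xi (D xi th) x - tau x) * w 0 i + (- D w (D xi th) x) * xi 0 i); last first.
      by rewrite /pert_m !mxE; ring.
    apply: (le_trans (ler_normD _ _)).
    have h1 := bd _ _ _ H1 (le_trans (pS w i) Mw).
    have h2 : `|(- D w (D xi th) x) * xi 0 i| <= e * M.
      by apply: bd; [rewrite normrN|exact: le_trans (pS _ _) Mxi].
    by rewrite ![e * _]mulrC in h1 h2; clear - h1 h2 Me eE eM0; lra.
  (* Since [b] is orthogonal to [w], the target [sy b w] is traceless, so the trace of [V] is itself
     an error term. *)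
  have trV : `|\tr (V x) / n%:R| <= 14 * (M ^+ 2 * e).
    have -> : \tr (V x) = \sum_(k < n) (V x k k - tau x * sy b w k k).
      have := tr_sy b w; rewrite bw mulr0 /mxtrace => tr0.
      by rewrite sumrB -mulr_sumr tr0 mulr0 subr0.
    rewrite normrM normfV normr_nat ler_pdivrMr ?ltr0n//.
    apply: (le_trans (ler_norm_sum _ _ _)).
    apply: (@le_trans _ _ (\sum_(k < n) 14 * (M ^+ 2 * e))); first exact: ler_sum.
    by rewrite sumr_const card_ord mulr_natr.
  rewrite (_ : _ - _ = (V x i j - tau x * sy b w i j) - (\tr (V x) / n%:R) * (i == j)%:R); last first.
    by rewrite pert_UE -/V; ring.
  apply: (le_trans (ler_normB _ _)); rewrite -eE.
  have hd : `|\tr (V x) / n%:R * (i == j)%:R| <= 14 * (M ^+ 2 * e).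
    case: eqP => _; first by rewrite mulr1.
    by rewrite mulr0 normr0; clear - eM0; lra.
  by have h := hV i j; clear - h hd; lra.
- have sV x i j : V x i j = V x j i.
    by rewrite !pert_VE (sy_sym b w) (sy_sym b xi) (sy_sym w xi) (ten_sym xi) (sy_sym cc xi) (sy_sym dd w) (sy_sym dd xi).
  split=> [x i j|x]; last first.
    by rewrite /pert_U raddfD /= -/V -mulNr mxtrace_scalar_n// subrr.
  rewrite (pert_UE _ _ _ _ _ _ x i j) (pert_UE _ _ _ _ _ _ x j i).
  by congr (_ - _ * _); [exact: sV|rewrite eq_sym].
- split.
  + exact: weak_mass_pert.
  + exact: weak_mom_pert.
  + apply: le_trans hal; have := mean_cutoff_ge r0 n0 hy.
    by move: (mean c _) ((r / n%:R) ^+ n) => u v; lra.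
Unshelve. all: by end_near. Qed.

End Cell.

(** * Linear algebra of the gap matrix *)

Section LinearAlgebra.
Context {R : realType} {n : nat}.
Implicit Types (p q u v m e w b xi : 'rV[R]_n) (A G : 'I_n -> 'I_n -> R).

Lemma dotpC p q : dotp p q = dotp q p.
Proof. by apply: eq_bigr => i _; rewrite mulrC. Qed.

Lemma dotpDr p q v : dotp p (q + v) = dotp p q + dotp p v.
Proof. by rewrite /dotp -big_split; apply: eq_bigr => i _; rewrite mxE mulrDr. Qed.

Lemma dotpZr (a : R) p q : dotp p (a *: q) = a * dotp p q.
Proof. by rewrite /dotp mulr_sumr; apply: eq_bigr => i _; rewrite mxE mulrCA. Qed.

Lemma dotpDl p q v : dotp (p + q) v = dotp p v + dotp q v.
Proof. by rewrite dotpC dotpDr !(dotpC v). Qed.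

Lemma dotpZl (a : R) p q : dotp (a *: p) q = a * dotp p q.
Proof. by rewrite dotpC dotpZr dotpC. Qed.

Lemma dotp_ge0 p : 0 <= dotp p p.
Proof. by apply: sumr_ge0 => i _; rewrite -expr2 sqr_ge0. Qed.

Lemma dotp_coord p i : p 0 i ^+ 2 <= dotp p p.
Proof. by rewrite /dotp (bigD1 i)//= expr2 lerDl sumr_ge0// => j _; rewrite -expr2 sqr_ge0. Qed.

Lemma dotp_eq0 p : (dotp p p == 0) = (p == 0).
Proof.
apply/eqP/eqP => [p0|->]; last by rewrite /dotp big1// => i _; rewrite mxE mul0r.
apply/rowP => i; rewrite mxE; apply/eqP; rewrite -sqrf_eq0 eq_le sqr_ge0 andbT.
by rewrite -p0 dotp_coord.
Qed.

Lemma dotp_unit_le m e : dotp e e = 1 -> dotp m e ^+ 2 <= dotp m m.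
Proof.
move=> e1; have := dotp_ge0 (m + (- dotp m e) *: e).
rewrite !(dotpDl, dotpDr, dotpZl, dotpZr) e1 (dotpC e m).
by rewrite -subr_ge0; set a := dotp m e; set b := dotp m m => h; nra.
Qed.

(** The matrix with columns [p] and [q] has rank at most 2, so its left kernel is nonzero in
    dimension at least 3. *)
Lemma exists_unit_orthogonal p q : (3 <= n)%N ->
  exists xi, [/\ dotp xi xi = 1, dotp xi p = 0 & dotp xi q = 0].
Proof.
move=> n3; pose A : 'M[R]_(n, 1 + 1) := row_mx p^T q^T.
have : kermx A != 0.
  rewrite kermx_eq0 /row_free; apply/eqP => rA.
  by have := rank_leq_col A; rewrite rA leqNgt n3.
move=> /rowV0Pn [v /sub_kermxP vA v0].
have [vp vq] : v *m p^T = 0 /\ v *m q^T = 0.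
  by move: vA; rewrite mul_mx_row -[RHS]row_mx0 => /eq_row_mx.
have dot0 (u : 'rV[R]_n) : v *m u^T = 0 -> dotp v u = 0.
  move=> /matrixP /(_ 0 0); rewrite !mxE => E; rewrite -[RHS]E.
  by apply: eq_bigr => i _; rewrite mxE.
have vv : 0 < dotp v v by rewrite lt_def dotp_eq0 v0 dotp_ge0.
exists ((Num.sqrt (dotp v v))^-1 *: v); split; rewrite !(dotpZl, dotpZr); last 2 first.
- by rewrite (dot0 _ vp) mulr0.
- by rewrite (dot0 _ vq) mulr0.
by rewrite mulrA -expr2 exprVn sqr_sqrtr ?mulVf ?gt_eqF// ltW.
Qed.

Definition bf A u v : R := \sum_i \sum_j u 0 i * A i j * v 0 j.
Definition qf A v : R := bf A v v.

Lemma bfDl A u1 u2 v : bf A (u1 + u2) v = bf A u1 v + bf A u2 v.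
Proof.
rewrite /bf -big_split; apply: eq_bigr => i _; rewrite -big_split; apply: eq_bigr => j _.
by rewrite mxE /=; ring.
Qed.

Lemma bfDr A u v1 v2 : bf A u (v1 + v2) = bf A u v1 + bf A u v2.
Proof.
rewrite /bf -big_split; apply: eq_bigr => i _; rewrite -big_split; apply: eq_bigr => j _.
by rewrite mxE /=; ring.
Qed.

Lemma bfZl A (a : R) u v : bf A (a *: u) v = a * bf A u v.
Proof.
rewrite /bf mulr_sumr; apply: eq_bigr => i _; rewrite mulr_sumr; apply: eq_bigr => j _.
by rewrite mxE; ring.
Qed.

Lemma bfZr A (a : R) u v : bf A u (a *: v) = a * bf A u v.
Proof.
rewrite /bf mulr_sumr; apply: eq_bigr => i _; rewrite mulr_sumr; apply: eq_bigr => j _.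
by rewrite mxE; ring.
Qed.

Lemma bf_evl A i v : bf A (ev R i) v = \sum_j A i j * v 0 j.
Proof.
rewrite /bf (bigD1 i)//= [X in _ + X]big1 ?addr0 => [|k ki].
  by apply: eq_bigr => j _; rewrite mxE !eqxx mul1r.
by apply: big1 => j _; rewrite mxE (negbTE ki) andbF !mul0r.
Qed.

Lemma bf_evr A i v : bf A v (ev R i) = \sum_j v 0 j * A j i.
Proof.
rewrite /bf; apply: eq_bigr => j _; rewrite (bigD1 i)//= big1 ?addr0 => [|k ki].
  by rewrite mxE !eqxx mulr1.
by rewrite mxE (negbTE ki) andbF !mulr0.
Qed.

(* A positive form dominates the rank-one form of each of its rows; the row with
   the largest diagonal entry captures at least the average of the trace. *)
Lemma exists_large_direction G (d : R) : (0 < n)%N -> 0 < d ->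
  (forall i j, G i j = G j i) -> (forall v, d * dotp v v <= qf G v) ->
  exists e lam, [/\ dotp e e = 1, \sum_i G i i <= n%:R * lam &
    forall v, lam * dotp e v ^+ 2 <= qf G v].
Proof.
move=> n0 d0 Gs Gd; pose i0 : 'I_n := Ordinal n0.
pose i := [arg max_(k > i0) G k k]%O.
have imax k : G k k <= G i i by rewrite /i; case: arg_maxP => // k' _; apply.
have Gii : 0 < G i i.
  have := Gd (ev R i); rewrite /qf bf_evl (bigD1 i)//= big1 => [|j ji]; last first.
    by rewrite mxE (negbTE ji) andbF mulr0.
  rewrite mxE !eqxx mulr1 addr0; apply: lt_le_trans; rewrite mulr_gt0// lt_def dotp_ge0 andbT dotp_eq0.
  by apply/eqP => /rowP /(_ i); rewrite !mxE !eqxx => /eqP; rewrite oner_eq0.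
pose Y : 'rV[R]_n := \row_j G i j.
have YY : 0 < dotp Y Y.
  by apply: lt_le_trans (dotp_coord Y i); rewrite mxE exprn_gt0.
have CS v : dotp Y v ^+ 2 <= G i i * qf G v.
  have Yl : bf G (ev R i) v = dotp Y v by rewrite bf_evl; apply: eq_bigr => j _; rewrite mxE.
  have Yr : bf G v (ev R i) = dotp Y v by rewrite bf_evr; apply: eq_bigr => j _; rewrite mxE mulrC Gs.
  have Ye : bf G (ev R i) (ev R i) = G i i.
    rewrite bf_evl (bigD1 i)//= big1 => [|j ji]; last by rewrite mxE (negbTE ji) andbF mulr0.
    by rewrite mxE !eqxx mulr1 addr0.
  (* The minimizer of the polynomial [qf G (t e_i + v)] in [t]; positivity there is the
     Cauchy-Schwarz inequality for [G]. *)
  pose t := - dotp Y v / G i i.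
  have : 0 <= qf G (t *: ev R i + v).
    by apply: le_trans (Gd _); rewrite mulr_ge0 ?dotp_ge0// ltW.
  rewrite /qf !(bfDl, bfDr, bfZl, bfZr) Yl Yr Ye.
  have -> : t * (t * G i i) + t * dotp Y v + (t * dotp Y v + bf G v v) =
     (G i i * bf G v v - dotp Y v ^+ 2) / G i i by rewrite /t; field; rewrite gt_eqF.
  by rewrite pmulr_lge0 ?invr_gt0// subr_ge0.
exists ((Num.sqrt (dotp Y Y))^-1 *: Y), (dotp Y Y / G i i); split.
- by rewrite !(dotpZl, dotpZr) mulrA -expr2 exprVn sqr_sqrtr ?mulVf ?gt_eqF// ltW.
- apply: (@le_trans _ _ (\sum_(k < n) G i i)); first by apply: ler_sum => k _; exact: imax.
  rewrite sumr_const card_ord -[_ *+ n]mulr_natl ler_pM2l ?ltr0n// ler_pdivlMr//.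
  by apply: le_trans (dotp_coord Y i); rewrite mxE expr2.
- move=> v; rewrite dotpZl exprMn exprVn (sqr_sqrtr (ltW YY)).
  have -> : dotp Y Y / G i i * ((dotp Y Y)^-1 * dotp Y v ^+ 2) = dotp Y v ^+ 2 / G i i.
    by field; rewrite !gt_eqF.
  by rewrite ler_pdivrMr// mulrC CS.
Qed.

Lemma qf_sub_rank1 A (k : R) e v :
  qf (fun i j => A i j - k * (e 0 i * e 0 j)) v = qf A v - k * dotp e v ^+ 2.
Proof.
have -> : dotp e v ^+ 2 = \sum_i \sum_j (e 0 i * v 0 i) * (e 0 j * v 0 j).
  by rewrite expr2 /dotp mulr_suml; apply: eq_bigr => i _; rewrite mulr_sumr.
rewrite /qf /bf mulr_sumr -sumrB; apply: eq_bigr => i _.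
rewrite mulr_sumr -sumrB; apply: eq_bigr => j _; ring.
Qed.

(** From |v_i v_j| <= (v_i^2 + v_j^2) / 2, summed over all entries. *)
Lemma qf_diff_le A G (z : R) v : (forall i j, `|A i j - G i j| <= z) ->
  `|qf A v - qf G v| <= z * n%:R * dotp v v.
Proof.
move=> h; have -> : z * n%:R * dotp v v = \sum_i \sum_j z * ((v 0 i ^+ 2 + v 0 j ^+ 2) / 2).
  have -> : \sum_(i < n) \sum_(j < n) z * ((v 0 i ^+ 2 + v 0 j ^+ 2) / 2) =
      \sum_(i < n) (z / 2 * n%:R * v 0 i ^+ 2 + z / 2 * dotp v v).
    apply: eq_bigr => i _; rewrite /dotp.
    have -> : z / 2 * n%:R * v 0 i ^+ 2 = \sum_(j < n) z / 2 * v 0 i ^+ 2.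
      by rewrite sumr_const card_ord -mulr_natl; ring.
    by rewrite mulr_sumr -big_split; apply: eq_bigr => j _ /=; field.
  rewrite big_split /= -mulr_sumr sumr_const card_ord -[_ *+ n]mulr_natl.
  have -> : \sum_(i < n) v 0 i ^+ 2 = dotp v v by apply: eq_bigr => i _; rewrite expr2.
  by field.
rewrite /qf /bf -sumrB; apply: (le_trans (ler_norm_sum _ _ _)); apply: ler_sum => i _.
rewrite -sumrB; apply: (le_trans (ler_norm_sum _ _ _)); apply: ler_sum => j _.
have -> : v 0 i * A i j * v 0 j - v 0 i * G i j * v 0 j = (A i j - G i j) * (v 0 i * v 0 j) by ring.
rewrite normrM; apply: ler_pM => //; rewrite ler_norml.
move: (v 0 i) (v 0 j) => a b'; have := sqr_ge0 (a + b'); have := sqr_ge0 (a - b') => h1 h2.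
by apply/andP; split; nra.
Qed.

(* Positive definiteness of this matrix is the subsolution inequality; the matrix
   vanishes exactly when (m, U) solves the nonlinear system with |m|^2 = n q rh. *)
Definition gapm (q rh : R) m (U : 'M[R]_n) (i j : 'I_n) : R :=
  q * (i == j)%:R - m 0 i * m 0 j / rh + U i j.

Lemma tr_gapm (q rh : R) m (U : 'M[R]_n) : \tr U = 0 -> \sum_i gapm q rh m U i i = n%:R * q - dotp m m / rh.
Proof.
move=> trU; rewrite /gapm big_split /= -/(mxtrace U) trU addr0 sumrB /dotp mulr_suml.
by congr (_ - _); rewrite -mulr_sumr mulrC; congr (_ * _);
  rewrite (eq_bigr (fun=> 1)) ?sumr_const ?card_ord// => i _; rewrite eqxx.
Qed.

(* Moving m along w = s e, with e taken from exists_large_direction and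
   U compensated by b w^T + w b^T, only removes a multiple of e e^T from the gap. *)
Lemma exists_oscillation (q rh : R) m (U : 'M[R]_n) (d M s : R) : (3 <= n)%N -> 0 < rh -> 0 < d -> 0 <= s -> 0 <= M ->
  (forall i j, U i j = U j i) -> \tr U = 0 ->
  (forall v, d * dotp v v <= qf (gapm q rh m U) v) ->
  dotp m m <= M ^+ 2 -> s * (2 * M + s) <= rh * (n%:R * q - dotp m m / rh) / (2 * n%:R) ->
  exists w b xi, [/\ dotp w w = s ^+ 2, [/\ dotp xi xi = 1, dotp xi w = 0 & dotp xi b = 0], dotp b w = 0 &
    forall t, `|t| <= 1 -> forall v,
      d / 2 * dotp v v <= qf (gapm q rh (m + t *: w) (U + t *: sy b w)) v].
Proof.
move=> n3 rh0 d0 s0 M0 Us trU Gd mM sle; have n0 : (0 < n)%N by exact: leq_trans n3.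
have nR0 : 0 < n%:R :> R by rewrite ltr0n.
have Gs i j : gapm q rh m U i j = gapm q rh m U j i by rewrite /gapm Us eq_sym [m 0 i * _]mulrC.
have [e [lam [e1 lamtr lamG]]] := exists_large_direction n0 d0 Gs Gd.
(* Both [w] and [b] will lie in the span of [m] and [e]. *)
have [xi [xi1 xim xie]] := exists_unit_orthogonal m e n3.
(* The part of [m] orthogonal to [e], over [rh]: it cancels the mixed part of (m w^T + w m^T) / rh,
   so that only multiples of e e^T remain. *)
pose b : 'rV[R]_n := rh^-1 *: (m + (- dotp m e) *: e).
have me : `|dotp m e| <= M.
  rewrite -ler_sqr ?nnegrE// real_normK ?num_real//.
  exact: le_trans (dotp_unit_le m e1) mM.
have be : dotp b e = 0 by rewrite dotpZl dotpDl dotpZl e1 mulr1 subrr mulr0.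
have xib : dotp xi b = 0 by rewrite dotpZr dotpDr dotpZr xim xie mulr0 addr0 mulr0.
exists (s *: e), b, xi; split.
- by rewrite dotpZl dotpZr e1 mulr1 expr2.
- by split=> //; rewrite dotpZr xie mulr0.
- by rewrite dotpZr be mulr0.
move=> t t1 v; set k := (2 * t * s * dotp m e + t ^+ 2 * s ^+ 2) / rh.
rewrite (_ : gapm q rh (m + t *: (s *: e)) (U + t *: sy b (s *: e)) =
  fun i j => gapm q rh m U i j - k * (e 0 i * e 0 j)); last first.
  apply/funext => i; apply/funext => j; rewrite /gapm /k.
  have -> : (U + t *: sy b (s *: e)) i j = U i j + t * s / rh *
      ((m 0 i - dotp m e * e 0 i) * e 0 j + e 0 i * (m 0 j - dotp m e * e 0 j)).
    by rewrite !mxE; ring.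
  have E k' : (m + t *: (s *: e)) 0 k' = m 0 k' + t * (s * e 0 k') by rewrite !mxE.
  rewrite !E.
  by field; rewrite gt_eqF.
rewrite qf_sub_rank1.
have kl : k <= lam / 2.
  rewrite /k ler_pdivrMr//; apply: (@le_trans _ _ (s * (2 * M + s))).
    move: me t1; rewrite !ler_norml => /andP[h1 h2] /andP[h3 h4].
    have h5 : t * dotp m e <= M by nra.
    have h6 : t ^+ 2 <= 1 by nra.
    by rewrite mulrDr; apply: lerD; nra.
  apply: (le_trans sle); rewrite -(tr_gapm _ _ _ trU).
  rewrite ler_pdivrMr ?mulr_gt0//.
  have := lamtr; rewrite -(ler_pM2l rh0) => h; apply: (le_trans h).
  by rewrite le_eqVlt; apply/orP; left; apply/eqP; field.
(* At most half of [lam] is spent, and Q - (lam / 2) E >= Q / 2 because Q >= lam E; this turns [d]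
   into [d / 2]. *)
have h1 := lamG v; have h2 := Gd v; have h3 := sqr_ge0 (dotp e v); have h4 := dotp_ge0 v.
move: h1 h2 h3 h4; move: (qf _ v) (dotp e v ^+ 2) (dotp v v) => Q E V h1 h2 h3 h4.
have : k * E <= lam / 2 * E by rewrite ler_wpM2r.
lra.
Qed.

End LinearAlgebra.

(** * The oscillation step *)

Section Grid.
Context {R : realType} {n : nat}.
Variables (c : R) (N : nat).
Implicit Types (x y : 'rV[R]_n) (k : {ffun 'I_n -> 'I_N.+1}).

Let h : R := N.+1%:R^-1.
Let h0 : 0 < h. Proof. by rewrite invr_gt0. Qed.
Let hN : N.+1%:R * h = 1. Proof. by rewrite divff. Qed.

Definition grid_corner k : 'rV[R]_n := \row_i (c + (k i)%:R * h).
Definition grid_center k : 'rV[R]_n := \row_i (c + (k i)%:R * h + h / 2).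

Lemma grid_step k i : 0 <= (k i)%:R * h /\ (k i)%:R * h + h <= 1.
Proof.
split; first by rewrite mulr_ge0// ltW.
have : ((k i)%:R + 1) * h <= N.+1%:R * h by rewrite ler_pM2r// natr1 ler_nat ltn_ord.
by rewrite hN mulrDl mul1r.
Qed.

Lemma grid_box k i : c <= grid_corner k 0 i /\ grid_corner k 0 i + h <= c + 1.
Proof. by have [h1 h2] := grid_step k i; rewrite mxE; split; lra. Qed.

Lemma grid_center_in k i : c <= grid_center k 0 i - h / 2 /\ grid_center k 0 i + h / 2 <= c + 1.
Proof. by have [h1 h2] := grid_step k i; rewrite mxE; split; lra. Qed.

Lemma cube_grid_center k : cube c (grid_center k).
Proof.
apply/cubeP => i; have [h1 h2] := grid_center_in k i.
by have := h0 => h3; apply/andP; split; lra.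
Qed.

Lemma grid_cover x : cube c x -> exists k, box (grid_corner k) h x.
Proof.
move=> /cubeP xc.
have H i : exists j : 'I_N.+1, j%:R * h <= x 0 i - c < j%:R * h + h.
  have /andP[x1 x2] := xc i; have z0 : 0 <= (x 0 i - c) * N.+1%:R by rewrite mulr_ge0// subr_ge0.
  have /andP[] := truncn_itv z0; set z := Num.truncn _ => t1 t2.
  have tN : (z < N.+1)%N.
    rewrite -(ltr_nat R); apply: (le_lt_trans t1).
    by rewrite -[ltRHS]mul1r ltr_pM2r// ltrBlDr addrC.
  exists (Ordinal tN) => /=; apply/andP; split.
    by rewrite /h ler_pdivrMr.
  have -> : z%:R * h + h = z.+1%:R * h by rewrite -natr1 mulrDl mul1r.
  by rewrite ltr_pdivlMr.
have [k kP] := choice H; exists [ffun i => k i] => i; rewrite mxE ffunE.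
by have /andP[h1 h2] := kP i; apply/andP; split; lra.
Qed.

Lemma grid_near x k : box (grid_corner k) h x -> forall i, `|x 0 i - grid_center k 0 i| <= h / 2.
Proof.
move=> kx i; move: (kx i); rewrite !mxE ler_norml => /andP[h1 h2].
by move: h1 h2; set a := _ * h; move=> h1 h2; apply/andP; split; lra.
Qed.

(** A cell perturbation vanishes as soon as one coordinate is at distance [h / 2] from its centre,
    so at most one of them is active at each point. *)
Lemma grid_far x k k' : box (grid_corner k) h x -> k' != k ->
  exists i, h / 2 <= `|x 0 i - grid_center k' 0 i|.
Proof.
move=> kx kk; have [i ki] : exists i, k' i != k i.
  apply/existsP; apply: contraNT kk; rewrite negb_exists => /forallP H.
  by apply/eqP/ffunP => i; have := H i; rewrite negbK => /eqP.
exists i; have /andP[h1 h2] := kx i; move: h1 h2; rewrite !mxE => h1 h2.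
have := h0; case: (ltngtP (k' i) (k i)) ki => [lt _|lt _|/val_inj->]; last by rewrite eqxx.
- have : ((k' i)%:R + 1) * h <= (k i)%:R * h by rewrite ler_pM2r// natr1 ler_nat.
  move: ((k' i)%:R) ((k i)%:R : R) h1 h2 => a b h1 h2 h3 h4.
  by apply: le_trans (ler_norm _); nra.
- have : ((k i)%:R + 1) * h <= (k' i)%:R * h by rewrite ler_pM2r// natr1 ler_nat.
  move: ((k' i)%:R) ((k i)%:R : R) h1 h2 => a b h1 h2 h3 h4.
  by rewrite distrC; apply: le_trans (ler_norm _); nra.
Qed.

Lemma mean_le_grid (f : 'rV[R]_n -> R) (u : {ffun 'I_n -> 'I_N.+1} -> R) : bm c f ->
  (forall k, 0 <= u k) ->
  (forall x k, cube c x -> box (grid_corner k) h x -> f x <= u k) ->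
  mean c f <= \sum_k h ^+ n * u k.
Proof.
move=> bf u0 fu.
have B k := @mean_box _ _ c (grid_corner k) h (ltW h0) (grid_box k).
apply: (@le_trans _ _ (mean c (fun x => \sum_k u k * \1_(box (grid_corner k) h) x))).
  apply: le_mean => //.
    by apply: bm_sum => k _; apply: bmM; [exact: bm_cst|case: (B k)].
  move=> x xc; have [k kx] := grid_cover xc.
  rewrite (bigD1 k)//= indicE mem_set// mulr1; apply: (le_trans (fu _ _ xc kx)).
  by rewrite lerDl sumr_ge0// => k' _; rewrite mulr_ge0// indicE.
rewrite mean_sum => [|k _]; last by apply: bmM; [exact: bm_cst|case: (B k)].
by apply: ler_sum => k _; have [b1 b2] := B k; rewrite meanZ// b2 mulrC.
Qed.

End Grid.

Section UniformGrid.
Context {R : realType} {n : nat}.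

Lemma near_grid_unif (c : R) (f : 'rV[R]_n -> R) (e : R) : continuous f -> 0 < e ->
  \forall N \near \oo, forall x y, cube c x -> cube c y ->
    (forall i, `|x 0 i - y 0 i| <= (N.+1%:R : R)^-1 / 2) -> `|f x - f y| <= e.
Proof.
move=> cf e0; have [d d0 fd] := continuous_cube_unif c cf e0.
near=> N => x y xc yc xy; apply/ltW/fd => // i; apply: (le_lt_trans (xy i)).
have : (N.+1%:R : R)^-1 < d by near: N; exact: (near_infty_natSinv_lt (PosNum d0)).
have : 0 < (N.+1%:R : R)^-1 by rewrite invr_gt0.
by move: (_^-1) => z z0 zd; lra.
Unshelve. all: by end_near. Qed.

Lemma near_small_mul (a e : R) : 0 < e -> \forall t \near 0^'+, t * a <= e.
Proof.
move=> e0; have a1 : 0 < `|a| + 1 by rewrite ltr_wpDl.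
near=> t; have t0 : 0 < t by near: t; exact: nbhs_right_gt.
have : t < e / (`|a| + 1) by near: t; apply: nbhs_right_lt; exact: divr_gt0.
rewrite ltr_pdivlMr// => h; apply: le_trans (ltW h).
by rewrite ler_pM2l// (le_trans (ler_norm a))// lerDl.
Unshelve. all: by end_near. Qed.

End UniformGrid.

(** * Linearity of the weak identities *)

Section WeakLinearity.
Context {R : realType} {n : nat}.
Implicit Types (c : R) (B : 'M[R]_n) (m : 'rV[R]_n -> 'rV[R]_n) (U : 'rV[R]_n -> 'M[R]_n).

Lemma mass_integrand_eq0 m psi x : m x = 0 -> mass_integrand m psi x = 0.
Proof. by move=> m0; rewrite /mass_integrand m0 big1// => i _; rewrite mxE mul0r. Qed.

Lemma mom_form_eq0 B m U Phi x : m x = 0 -> U x = 0 -> mom_form B m U Phi x = 0.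
Proof.
move=> m0 U0; rewrite /mom_form /ctr m0 U0 [X in X + _]big1 ?[X in _ + X]big1 ?addr0// => i _.
  by rewrite big1 ?mulr0// => j _; rewrite mxE mulr0.
by rewrite big1// => j _; rewrite mxE mul0r.
Qed.

Lemma mom_integrand_eq0 B rho m Phi x : m x = 0 -> mom_integrand B rho m Phi x = 0.
Proof.
move=> m0; rewrite /mom_integrand m0 [X in X + _]big1 ?[X in _ + X]big1 ?addr0// => i _.
  by rewrite big1 ?mulr0// => j _; rewrite mxE mulr0.
by rewrite big1// => j _; rewrite mxE !mul0r.
Qed.

Lemma bm_mass_integrand c m psi : (forall i, bm c (fun x => m x 0 i)) -> smooth psi ->
  bm c (mass_integrand m psi).
Proof.
move=> bmm sp; apply: bm_sum => i _; apply: bmM => //.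
by apply: bm_cont; apply: (@Ck_cont _ _ 0); apply: Ck_partial; exact: smooth_Ck.
Qed.

Lemma bm_mom_form c B m U Phi : (forall i, bm c (fun x => m x 0 i)) ->
  (forall i j, bm c (fun x => U x i j)) -> smooth_vf Phi -> bm c (mom_form B m U Phi).
Proof.
move=> bmm bmU sP; apply: bmD.
  apply: bm_sum => i _; apply: bm_sum => j _; apply: bmM => //.
  by apply: bm_cont; apply: (@Ck_cont _ _ 0); apply: Ck_partial; apply: smooth_Ck; exact: sP.
apply: bm_sum => i _; apply: bmM; first by apply: bm_cont; apply: (@Ck_cont _ _ 0); apply: smooth_Ck; exact: sP.
by apply: bm_sum => j _; apply: bmM => //; exact: bm_cst.
Qed.

Lemma weak_massD c m1 m2 : (forall i, bm c (fun x => m1 x 0 i)) -> (forall i, bm c (fun x => m2 x 0 i)) ->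
  weak_mass c m1 -> weak_mass c m2 -> weak_mass c (fun x => m1 x + m2 x).
Proof.
move=> b1 b2 h1 h2 psi sp.
rewrite (_ : mass_integrand _ _ = fun x => mass_integrand m1 psi x + mass_integrand m2 psi x).
  by rewrite meanD; [rewrite h1// h2// addr0|exact: bm_mass_integrand..].
apply/funext => x; rewrite /mass_integrand -big_split; apply: eq_bigr => i _.
by rewrite mxE mulrDl.
Qed.

Lemma weak_momD c B m1 m2 U1 U2 :
  (forall i, bm c (fun x => m1 x 0 i)) -> (forall i, bm c (fun x => m2 x 0 i)) ->
  (forall i j, bm c (fun x => U1 x i j)) -> (forall i j, bm c (fun x => U2 x i j)) ->
  weak_mom c B m1 U1 -> weak_mom c B m2 U2 ->
  weak_mom c B (fun x => m1 x + m2 x) (fun x => U1 x + U2 x).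
Proof.
move=> b1 b2 B1 B2 h1 h2 Phi sP dP.
rewrite (_ : mom_form _ _ _ _ = fun x => mom_form B m1 U1 Phi x + mom_form B m2 U2 Phi x).
  by rewrite meanD; [rewrite h1// h2// addr0|exact: bm_mom_form..].
apply/funext => x; rewrite /mom_form ctrD addrACA; congr (_ + _).
rewrite -big_split; apply: eq_bigr => i _ /=; rewrite -mulrDr; congr (_ * _).
by rewrite -big_split; apply: eq_bigr => j _; rewrite mxE mulrDr.
Qed.

Lemma bm_row_sum c I (s : seq I) (ws : I -> 'rV[R]_n -> 'rV[R]_n) :
  (forall k i, bm c (fun x => ws k x 0 i)) -> forall i, bm c (fun x => (\sum_(k <- s) ws k x) 0 i).
Proof.
move=> h i; rewrite (_ : (fun x => _) = fun x => \sum_(k <- s) ws k x 0 i); last by apply/funext => x; rewrite summxE.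
exact: bm_sum.
Qed.

Lemma bm_mx_sum c I (s : seq I) (Us : I -> 'rV[R]_n -> 'M[R]_n) :
  (forall k i j, bm c (fun x => Us k x i j)) -> forall i j, bm c (fun x => (\sum_(k <- s) Us k x) i j).
Proof.
move=> h i j; rewrite (_ : (fun x => _) = fun x => \sum_(k <- s) Us k x i j); last by apply/funext => x; rewrite summxE.
exact: bm_sum.
Qed.

Lemma weak_mass_sum c I (s : seq I) (ws : I -> 'rV[R]_n -> 'rV[R]_n) :
  (forall k i, bm c (fun x => ws k x 0 i)) -> (forall k, weak_mass c (ws k)) ->
  weak_mass c (fun x => \sum_(k <- s) ws k x).
Proof.
move=> bw h; elim: s => [|a s IH].
  move=> psi _; rewrite -(@mean0 _ n c); apply: eq_mean => x _.
  by apply: mass_integrand_eq0; rewrite big_nil.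
rewrite (_ : (fun x => _) = fun x => ws a x + \sum_(k <- s) ws k x); last by apply/funext => x; rewrite big_cons.
by apply: weak_massD => // i; exact: bm_row_sum.
Qed.

Lemma weak_mom_sum c B I (s : seq I) (ws : I -> 'rV[R]_n -> 'rV[R]_n) (Us : I -> 'rV[R]_n -> 'M[R]_n) :
  (forall k i, bm c (fun x => ws k x 0 i)) -> (forall k i j, bm c (fun x => Us k x i j)) ->
  (forall k, weak_mom c B (ws k) (Us k)) ->
  weak_mom c B (fun x => \sum_(k <- s) ws k x) (fun x => \sum_(k <- s) Us k x).
Proof.
move=> bw bU h; elim: s => [|a s IH].
  move=> Phi _ _; rewrite -(@mean0 _ n c); apply: eq_mean => x _.
  by apply: mom_form_eq0; rewrite big_nil.
rewrite (_ : (fun x => \sum_(k <- _) ws k x) = fun x => ws a x + \sum_(k <- s) ws k x); last by apply/funext => x; rewrite big_cons.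
rewrite (_ : (fun x => \sum_(k <- _) Us k x) = fun x => Us a x + \sum_(k <- s) Us k x); last by apply/funext => x; rewrite big_cons.
by apply: weak_momD => // *; [exact: bm_row_sum|exact: bm_mx_sum].
Qed.

(** The coordinate function is an admissible test function, as nothing is asked of [psi] at the
    boundary. *)
Lemma weak_mass_mean c m i : weak_mass c m -> mean c (fun x => m x 0 i) = 0.
Proof.
move=> /(_ _ (smooth_coord i)) <-; apply: eq_mean => x _.
rewrite /mass_integrand (bigD1 i)//= (partialE (is_derive_coord i i x)) eqxx mulr1.
by rewrite big1 ?addr0// => j ji; rewrite (partialE (is_derive_coord i j x)) (negbTE ji) mulr0.
Qed.

End WeakLinearity.

(** * Subsolutions and their improvement *)

Section Step.
Context {R : realType} {n : nat}.
Variables (c : R) (B : 'M[R]_n) (rho q : 'rV[R]_n -> R).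
Hypotheses (n3 : (3 <= n)%N) (crho : continuous rho) (cq : continuous q).
Hypotheses (rho0 : forall x, 0 < rho x) (q0 : forall x, 0 < q x).
Implicit Types (m : 'rV[R]_n -> 'rV[R]_n) (U : 'rV[R]_n -> 'M[R]_n) (x y : 'rV[R]_n).

Let nR0 : 0 < n%:R :> R. Proof. by rewrite ltr0n (leq_trans _ n3). Qed.

(** The trace of [gapm] for traceless [U]; it is a function of [m] alone. *)
Definition gap m x : R := n%:R * q x - dotp (m x) (m x) / rho x.

Definition subsol m U : Prop :=
  [/\ (forall i, continuous (fun x => m x 0 i)) /\ (forall i j, continuous (fun x => U x i j)),
      (forall x i j, U x i j = U x j i) /\ (forall x, \tr (U x) = 0),
      weak_mass c m, weak_mom c B m U &
      exists2 d, 0 < d & forall x, cube c x -> forall v,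
        d * dotp v v <= qf (gapm (q x) (rho x) (m x) (U x)) v].

Lemma continuous_inv_rho : continuous (fun x => (rho x)^-1).
Proof. by move=> x; have rx := @crho x; apply: cvgV rx; exact: lt0r_neq0. Qed.

Lemma continuous_dotp m1 m2 : (forall i, continuous (fun x => m1 x 0 i)) ->
  (forall i, continuous (fun x => m2 x 0 i)) -> continuous (fun x => dotp (m1 x) (m2 x)).
Proof. by move=> c1 c2; apply: continuous_sum => i; apply: continuous_mul. Qed.

Lemma continuous_gap m : (forall i, continuous (fun x => m x 0 i)) -> continuous (gap m).
Proof.
move=> cm; apply: continuous_add; first by apply: continuous_mul => //; exact: cst_continuous.
by apply: continuous_opp; apply: continuous_mul; [exact: continuous_dotp|exact: continuous_inv_rho].
Qed.

Lemma subsol_gap_ge0 m U x : subsol m U -> cube c x -> 0 <= gap m x.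
Proof.
move=> [_ [_ trU] _ _ [d d0 H]] xc; rewrite /gap -(tr_gapm _ _ _ (trU x)).
apply: sumr_ge0 => i _; have := H x xc (ev R i); rewrite /qf bf_evl (bigD1 i)//= big1 => [|j ji]; last first.
  by rewrite mxE (negbTE ji) andbF mulr0.
rewrite mxE !eqxx mulr1 addr0; apply: le_trans.
by rewrite mulr_ge0 ?dotp_ge0// ltW.
Qed.

Lemma gap_le m x : gap m x <= n%:R * q x.
Proof. by rewrite lerBlDr lerDl mulr_ge0 ?dotp_ge0// invr_ge0 ltW. Qed.

Lemma subsol_sqr_le m U x : subsol m U -> cube c x -> dotp (m x) (m x) <= n%:R * q x * rho x.
Proof.
move=> S xc; have := subsol_gap_ge0 S xc; rewrite /gap subr_ge0 ler_pdivrMr//.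
Qed.

(** The tolerance for [m] and [U] is [2 * eta]: one [eta] from moving to the centre of the cell, one
    from the wave approximation. As [eta <= 1], both vectors have entries bounded by [P + 2]. *)
Lemma gapm_close (qx qy rx ry r1 P eta : R) (m' u : 'rV[R]_n) (U' V : 'M[R]_n) i j :
  0 <= eta -> eta <= 1 -> `|qx - qy| <= eta -> `|rx^-1 - ry^-1| <= eta ->
  `|rx^-1| <= r1 -> (forall k, `|u 0 k| <= P) -> (forall k, `|m' 0 k - u 0 k| <= 2 * eta) ->
  `|U' i j - V i j| <= 2 * eta ->
  `|gapm qx rx m' U' i j - gapm qy ry u V i j| <= eta * (3 + 4 * (P + 2) * r1 + (P + 2) ^+ 2).
Proof.
move=> e0 e1 hq hr hr1 hu hm hU; have P0 : 0 <= P by apply: le_trans (hu i).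
rewrite (_ : _ - _ = (qx - qy) * (i == j)%:R + (U' i j - V i j)
  - ((m' 0 i - u 0 i) * m' 0 j * rx^-1 + u 0 i * (m' 0 j - u 0 j) * rx^-1 + u 0 i * u 0 j * (rx^-1 - ry^-1))); last first.
  by rewrite /gapm; move: (rx^-1) (ry^-1) => s t; ring.
have hm' k : `|m' 0 k| <= P + 2.
  rewrite (_ : m' 0 k = (m' 0 k - u 0 k) + u 0 k); last by ring.
  apply: (le_trans (ler_normD _ _)); have := hm k; have := hu k; lra.
have hu' k : `|u 0 k| <= P + 2 by apply: le_trans (hu k) _; lra.
have M3 (a b d A' B' D' : R) : `|a| <= A' -> `|b| <= B' -> `|d| <= D' -> `|a * b * d| <= A' * B' * D'.
  by move=> ha hb hd; rewrite !normrM; apply: ler_pM => //; apply: ler_pM.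
have t1 := M3 _ _ _ _ _ _ (hm i) (hm' j) hr1.
have t2 := M3 _ _ _ _ _ _ (hu' i) (hm j) hr1.
have t3 := M3 _ _ _ _ _ _ (hu' i) (hu' j) hr.
have t4 : `|(qx - qy) * (i == j)%:R| <= eta.
  by case: eqP => _; rewrite ?mulr1// mulr0 normr0.
apply: (le_trans (ler_normB _ _)); apply: (@le_trans _ _ ((eta + 2 * eta) +
  (2 * eta * (P + 2) * r1 + (P + 2) * (2 * eta) * r1 + (P + 2) * (P + 2) * eta))).
  apply: lerD; first by apply: (le_trans (ler_normD _ _)); exact: lerD.
  by apply: (le_trans (ler_normD _ _)); apply: lerD => //; apply: (le_trans (ler_normD _ _)); exact: lerD.
by rewrite le_eqVlt; apply/orP; left; apply/eqP; ring.
Qed.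


Section Assembly.
Variables (m : 'rV[R]_n -> 'rV[R]_n) (U : 'rV[R]_n -> 'M[R]_n) (N : nat) (d eta r1 P : R).
Let h : R := N.+1%:R^-1.
Notation cell := {ffun 'I_n -> 'I_N.+1}.
Notation y := (@grid_center R n c N).
Variables (w b : cell -> 'rV[R]_n) (wt : cell -> 'rV[R]_n -> 'rV[R]_n).
Variables (Ut : cell -> 'rV[R]_n -> 'M[R]_n) (tau : cell -> 'rV[R]_n -> R).
Hypotheses (d0 : 0 < d) (eta0 : 0 < eta) (eta1 : eta <= 1) (sub : subsol m U).
Hypothesis cells : forall k, cell_perturbation c B (y k) (h / 2) (w k) (b k) eta (wt k) (Ut k) (tau k).
Hypothesis osc : forall k t, `|t| <= 1 -> forall v, d / 2 * dotp v v <=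
  qf (gapm (q (y k)) (rho (y k)) (m (y k) + t *: w k) (U (y k) + t *: sy (b k) (w k))) v.
Hypothesis near_y : forall x z, cube c x -> cube c z -> (forall i, `|x 0 i - z 0 i| <= h / 2) ->
  [/\ `|q x - q z| <= eta, `|(rho x)^-1 - (rho z)^-1| <= eta,
      forall i, `|m x 0 i - m z 0 i| <= eta & forall i j, `|U x i j - U z i j| <= eta].
Hypothesis rho_r1 : forall x, cube c x -> `|(rho x)^-1| <= r1.
Hypothesis m_le : forall k i, `|m (y k) 0 i| + `|w k 0 i| <= P.

Lemma active_cell x : cube c x -> exists k, box (grid_corner c k) h x /\
  forall k', k' != k -> [/\ wt k' x = 0, Ut k' x = 0 & tau k' x = 0].
Proof.
move=> xc; have [k kx] := grid_cover N xc; exists k; split=> // k' kk.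
have [i hi] := grid_far kx kk; have [_ H _ _ _] := cells k'.
exact: (H x i hi).
Qed.

Lemma sum_active (V : zmodType) (F : cell -> V) k : (forall k', k' != k -> F k' = 0) ->
  \sum_k' F k' = F k.
Proof. by move=> H; rewrite (bigD1 k)//= big1 ?addr0. Qed.

Definition pm x := m x + \sum_k wt k x.
Definition pU x := U x + \sum_k Ut k x.

Lemma wt_cont k i : continuous (fun x => wt k x 0 i).
Proof. by have [[H _ _] _ _ _ _] := cells k; exact: H. Qed.

Lemma pm_cont i : continuous (fun x => pm x 0 i).
Proof.
have [[cm _] _ _ _ _] := sub.
rewrite (_ : (fun x => _) = fun x => m x 0 i + \sum_k wt k x 0 i); last by apply/funext => x; rewrite mxE summxE.
by apply: continuous_add => //; apply: continuous_sum => k; exact: wt_cont.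
Qed.

Lemma pU_cont i j : continuous (fun x => pU x i j).
Proof.
have [[_ cU] _ _ _ _] := sub.
rewrite (_ : (fun x => _) = fun x => U x i j + \sum_k Ut k x i j); last by apply/funext => x; rewrite mxE summxE.
by apply: continuous_add => //; apply: continuous_sum => k; have [[_ H _] _ _ _ _] := cells k.
Qed.

Lemma subsol_assembled :
  eta * (3 + 4 * (P + 2) * r1 + (P + 2) ^+ 2) * n%:R <= d / 4 -> subsol pm pU.
Proof.
move=> small; have [[cm cU] [sU tU] wm wM _] := sub; split.
- by split; [exact: pm_cont|exact: pU_cont].
- split=> [x i j|x].
    rewrite !mxE sU !summxE; congr (_ + _); apply: eq_bigr => k _.
    by have [_ _ _ [H _] _] := cells k.
  rewrite raddfD /= tU add0r raddf_sum /= big1// => k _.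
  by have [_ _ _ [_ H] _] := cells k.
- apply: weak_massD => // [i|i|]; first exact: bm_cont.
    by apply: bm_row_sum => k i'; apply: bm_cont; exact: wt_cont.
  apply: weak_mass_sum => k => [i|]; first by apply: bm_cont; exact: wt_cont.
  by have [_ _ _ _ [H _ _]] := cells k.
- apply: weak_momD => // [i|i|i j|i j|].
  + exact: bm_cont.
  + by apply: bm_row_sum => k i'; apply: bm_cont; exact: wt_cont.
  + exact: bm_cont.
  + by apply: bm_mx_sum => k i' j'; apply: bm_cont; have [[_ H _] _ _ _ _] := cells k.
  + apply: weak_mom_sum => k => [i|i j|].
    * by apply: bm_cont; exact: wt_cont.
    * by apply: bm_cont; have [[_ H _] _ _ _ _] := cells k.
    * by have [_ _ _ _ [_ H _]] := cells k.
(* Of the [d / 2] granted by [osc] at the centre of the active cell, at most [d / 4] is lost to the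
   errors. *)
exists (d / 4); first by apply: divr_gt0.
move=> x xc v; have [k [kx kz]] := active_cell xc.
have [hq hr hm hU] := near_y xc (cube_grid_center c k) (grid_near kx).
have [_ _ /(_ x xc)[ht hw hu] _ _] := cells k.
have em : pm x = m x + wt k x by rewrite /pm (sum_active (k := k))// => k' /kz[].
have eU : pU x = U x + Ut k x by rewrite /pU (sum_active (k := k))// => k' /kz[].
have O := osc k ht v.
have Q : `|qf (gapm (q x) (rho x) (pm x) (pU x)) v -
    qf (gapm (q (y k)) (rho (y k)) (m (y k) + tau k x *: w k) (U (y k) + tau k x *: sy (b k) (w k))) v|
    <= eta * (3 + 4 * (P + 2) * r1 + (P + 2) ^+ 2) * n%:R * dotp v v.
  apply: qf_diff_le => i j; apply: gapm_close => //; first exact: ltW.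
  + exact: rho_r1.
  + move=> l; rewrite !mxE; apply: le_trans (m_le k l); apply: (le_trans (ler_normD _ _)).
    by rewrite lerD2l normrM ler_piMl.
  + move=> l; rewrite em !mxE.
    rewrite (_ : _ - _ = (m x 0 l - m (y k) 0 l) + (wt k x 0 l - tau k x * w k 0 l)); last by ring.
    by apply: (le_trans (ler_normD _ _)); have := hm l; have := hw l; lra.
  + rewrite eU [X in `|X - _|]mxE [X in `|_ - X|]mxE [X in _ - (_ + X)]mxE.
    rewrite (_ : _ - _ = (U x i j - U (y k) i j) + (Ut k x i j - tau k x * sy (b k) (w k) i j)); last by ring.
    by apply: (le_trans (ler_normD _ _)); have := hU i j; have := hu i j; lra.
have V := ler_wpM2r (dotp_ge0 v) small.
move: Q; rewrite ler_norml => /andP[Q _].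
move: O V Q; move: (qf _ v) (qf _ v) (dotp v v) (_ * n%:R * _) => a1 a2 a3 a4; lra.
Qed.

Lemma pm_sub x : pm x - m x = \sum_k wt k x.
Proof. by rewrite /pm addrC addKr. Qed.

(** Each cell perturbation has mean 0, so the value of [g] at the centre of the cell may be
    subtracted; what remains is the variation of [g], at most [eta], against waves with entries of
    size at most [W + 1]. *)
Lemma orthogonal_assembled (W : R) (g : 'rV[R]_n -> 'rV[R]_n) : (forall i, continuous (fun x => g x 0 i)) ->
  (forall k i, `|w k 0 i| <= W) ->
  (forall x z, cube c x -> cube c z -> (forall i, `|x 0 i - z 0 i| <= h / 2) ->
     forall i, `|g x 0 i - g z 0 i| <= eta) ->
  `|mean c (fun x => dotp (g x) (pm x - m x))| <= eta * (n%:R * (W + 1)).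
Proof.
move=> cg wW hg.
pose f x := \sum_k \sum_i (g x 0 i - g (y k) 0 i) * wt k x 0 i.
have cf : continuous f.
  apply: continuous_sum => k; apply: continuous_sum => i; apply: continuous_mul; last exact: wt_cont.
  by apply: continuous_add => //; exact: cst_continuous.
have -> : mean c (fun x => dotp (g x) (pm x - m x)) = mean c f.
  pose f0 x := \sum_k \sum_i g (y k) 0 i * wt k x 0 i.
  have cf0 : continuous f0.
    by apply: continuous_sum => k; apply: continuous_sum => i; apply: continuous_mul; [exact: cst_continuous|exact: wt_cont].
  have f00 : mean c f0 = 0.
    rewrite /f0 mean_sum => [|k _]; last first.
      by apply: bm_cont; apply: continuous_sum => i; apply: continuous_mul; [exact: cst_continuous|exact: wt_cont].
    rewrite big1// => k _; rewrite mean_sum => [|i _]; last first.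
      by apply: bm_cont; apply: continuous_mul; [exact: cst_continuous|exact: wt_cont].
    rewrite big1// => i _; rewrite meanZ; last by apply: bm_cont; exact: wt_cont.
    by have [_ _ _ _ [H _ _]] := cells k; rewrite (weak_mass_mean i H) mulr0.
  rewrite -[RHS]addr0 -f00 -meanD; [|exact: bm_cont..].
  apply: eq_mean => x _; rewrite pm_sub /dotp /f /f0 -big_split [RHS]/=.
  under [in RHS]eq_bigr => k _ do rewrite -big_split.
  rewrite exchange_big; apply: eq_bigr => i _ /=; rewrite summxE mulr_sumr.
  by apply: eq_bigr => k _; rewrite -mulrDl subrK.
apply: norm_mean_le; first exact: bm_cont.
move=> x xc; have [k [kx kz]] := active_cell xc.
rewrite /f (sum_active (k := k)) => [|k' /kz[-> _ _]]; last first.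
  by apply: big1 => i _; rewrite mxE mulr0.
apply: (le_trans (ler_norm_sum _ _ _)).
apply: (@le_trans _ _ (\sum_(i < n) eta * (W + 1))); last by rewrite sumr_const card_ord -[_ *+ n]mulr_natl mulrCA.
apply: ler_sum => i _; rewrite normrM; apply: ler_pM => //.
  exact: hg (cube_grid_center c k) (grid_near kx) i.
have [_ _ /(_ x xc)[ht hw _] _ _] := cells k.
rewrite (_ : wt k x 0 i = (wt k x 0 i - tau k x * w k 0 i) + tau k x * w k 0 i); last by ring.
apply: (le_trans (ler_normD _ _)); rewrite addrC; apply: lerD.
  by apply: le_trans (wW k i); rewrite normrM ler_piMl.
exact: le_trans (hw i) eta1.
Qed.

(** In a cell the energy gained is about |w|^2 tau^2 / rho with |w| = kap gap; the mean of
    [tau ^+ 2] is at least (h / 2n)^n / 16, and summing h^n gap^2 over the cells recovers the mean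
    of gap^2. These factors make up [K]. *)
Lemma gain_assembled (W kap rho1 K : R) :
  K = kap ^+ 2 * (1 / 16 * (2 * n%:R) ^- n) / rho1 -> 0 < rho1 -> (forall x, cube c x -> rho x <= rho1) ->
  (forall k i, `|w k 0 i| <= W) -> (forall k, dotp (w k) (w k) = (kap * gap m (y k)) ^+ 2) ->
  (forall x z, cube c x -> cube c z -> (forall i, `|x 0 i - z 0 i| <= h / 2) ->
     `|gap m x ^+ 2 - gap m z ^+ 2| <= eta) ->
  K * mean c (fun x => gap m x ^+ 2) <=
  mean c (fun x => dotp (pm x - m x) (pm x - m x) / rho x) + eta * (K + 2 * n%:R * W / rho1).
Proof.
move=> eK r10 rr wW ww hg; have [[cm cU] _ _ _ _] := sub.
have h0 : 0 < h by rewrite invr_gt0.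
have cg := continuous_gap cm.
have cg2 : continuous (fun x => gap m x ^+ 2) by exact: continuous_mul.
have ctau k : continuous (tau k) by have [[_ _ H] _ _ _ _] := cells k.
have ct2 k : bm c (fun x => tau k x ^+ 2).
  by apply: bm_cont; apply: continuous_mul.
have G1 : mean c (fun x => gap m x ^+ 2) <= \sum_(k : cell) h ^+ n * (gap m (y k) ^+ 2 + eta).
  apply: mean_le_grid; first exact: bm_cont.
    by move=> k; apply: addr_ge0; [exact: sqr_ge0|exact: ltW].
  move=> x k xc kx; have := hg _ _ xc (cube_grid_center c k) (grid_near kx).
  by rewrite ler_norml => /andP[_]; rewrite lerBlDl.
have G2 : \sum_(k : cell) h ^+ n * (gap m (y k) ^+ 2 + eta) = \sum_(k : cell) h ^+ n * gap m (y k) ^+ 2 + eta.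
  under eq_bigr => k _ do rewrite mulrDr.
  rewrite big_split /=; congr (_ + _); rewrite sumr_const card_ffun !card_ord -mulr_natl natrX mulrA -exprMn.
  by rewrite divff// expr1n mul1r.
pose s k := kap * gap m (y k).
have low x : cube c x -> (rho1)^-1 * (\sum_k s k ^+ 2 * tau k x ^+ 2 - 2 * n%:R * W * eta) <=
    dotp (pm x - m x) (pm x - m x) / rho x.
  move=> xc; have [k [kx kz]] := active_cell xc.
  rewrite pm_sub (sum_active (k := k)) => [|k' /kz[_ _ ->]]; last by rewrite expr0n mulr0.
  rewrite (sum_active (k := k)) => [|k' /kz[]//].
  apply: (@le_trans _ _ (rho1^-1 * dotp (wt k x) (wt k x))); last first.
    rewrite mulrC ler_wpM2l ?dotp_ge0// lef_pV2 ?posrE//; exact: rr.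
  rewrite ler_pM2l ?invr_gt0// /s -ww.
  have [_ _ /(_ x xc)[ht hw _] _ _] := cells k.
  have -> : dotp (w k) (w k) * tau k x ^+ 2 - 2 * n%:R * W * eta =
      \sum_(i < n) ((tau k x * w k 0 i) ^+ 2 - 2 * W * eta).
    rewrite sumrB sumr_const card_ord -[_ *+ n]mulr_natl; congr (_ - _); last by ring.
    by rewrite /dotp mulr_suml; apply: eq_bigr => i _; ring.
  apply: ler_sum => i _; have := hw i; have : `|tau k x * w k 0 i| <= W.
    by apply: le_trans (wW k i); rewrite normrM ler_piMl.
  move: (wt k x 0 i) (tau k x * w k 0 i) => a t; rewrite !ler_norml => /andP[t1 t2] /andP[a1 a2].
  have : `|t * (a - t)| <= W * eta.
    by rewrite normrM; apply: ler_pM => //; rewrite ler_norml; apply/andP; split.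
  rewrite ler_norml => /andP[h1 _]; have := sqr_ge0 (a - t).
  (* Replacing the wave by its model costs at most [2 * W * eta] per coordinate, as the first square
     is nonnegative. *)
  rewrite (_ : a * a = (a - t) ^+ 2 + 2 * (t * (a - t)) + t ^+ 2); last by ring.
  move: ((a - t) ^+ 2) (t * (a - t)) (t ^+ 2) h1 => A1 A2 A3; rewrite -[2 * W * eta]mulrA; lra.
have cJ : bm c (fun x => dotp (pm x - m x) (pm x - m x) / rho x).
  apply: bm_cont; apply: continuous_mul; last exact: continuous_inv_rho.
  have cd i : continuous (fun x => (pm x - m x) 0 i).
    rewrite (_ : (fun x => _) = fun x => pm x 0 i + - m x 0 i); last by apply/funext => x; rewrite !mxE.
    by apply: continuous_add; [exact: pm_cont|exact: continuous_opp].
  exact: continuous_dotp.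
have bS k : bm c (fun x => s k ^+ 2 * tau k x ^+ 2) by apply: bmM; [exact: bm_cst|].
have L := le_mean _ cJ low.
have {}L : rho1^-1 * (\sum_k s k ^+ 2 * mean c (fun x => tau k x ^+ 2) - 2 * n%:R * W * eta) <=
    mean c (fun x => dotp (pm x - m x) (pm x - m x) / rho x).
  apply: le_trans (L _).
    rewrite meanZ ?meanB ?mean_cst ?mean_sum; [|by []|exact: bm_sum|exact: bm_cst|by apply: bmB; [exact: bm_sum|exact: bm_cst]].
    by rewrite le_eqVlt; apply/orP; left; apply/eqP; congr (_ * (_ - _)); apply: eq_bigr => k _; rewrite meanZ.
  by apply: bmM; [exact: bm_cst|apply: bmB; [exact: bm_sum|exact: bm_cst]].
have T k : 1 / 16 * (2 * n%:R) ^- n * h ^+ n <= mean c (fun x => tau k x ^+ 2).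
  have [_ _ _ _ [_ _ H]] := cells k; apply: le_trans H.
  rewrite -mulrA -exprVn -exprMn le_eqVlt; apply/orP; left; apply/eqP; congr (_ * _ ^+ _).
  by rewrite invfM; move: h => z; field; rewrite gt_eqF.
have S2 : kap ^+ 2 * (1 / 16 * (2 * n%:R) ^- n) * \sum_(k : cell) h ^+ n * gap m (y k) ^+ 2 <=
    \sum_k s k ^+ 2 * mean c (fun x => tau k x ^+ 2).
  rewrite mulr_sumr; apply: ler_sum => k _; have := ler_wpM2l (sqr_ge0 (s k)) (T k).
  by apply: le_trans; rewrite le_eqVlt; apply/orP; left; apply/eqP; rewrite /s exprMn; ring.
have K0 : 0 <= K.
  rewrite eK; apply: mulr_ge0; last by rewrite invr_ge0 ltW.
  apply: mulr_ge0; first exact: sqr_ge0.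
  by apply: mulr_ge0; rewrite ?divr_ge0// invr_ge0 exprn_ge0// mulr_ge0// ler0n.
have := ler_wpM2l K0 G1; rewrite G2 => G3; apply: (le_trans G3).
have i0 : 0 <= rho1^-1 by rewrite invr_ge0 ltW.
have := ler_wpM2l i0 S2; move: L.
have -> : K * (\sum_(k : cell) h ^+ n * gap m (y k) ^+ 2 + eta) =
    rho1^-1 * (kap ^+ 2 * (1 / 16 * (2 * n%:R) ^- n) * \sum_(k : cell) h ^+ n * gap m (y k) ^+ 2) + eta * K.
  by rewrite eK; move: ((2 * n%:R) ^- n) (\sum_(k : cell) _) (rho1^-1) => a1 a2 a3; ring.
have -> : eta * (K + 2 * n%:R * W / rho1) = eta * K + rho1^-1 * (2 * n%:R * W * eta) by ring.
rewrite mulrBr; move: (rho1^-1 * _) (rho1^-1 * _) (rho1^-1 * _) (mean _ _) (eta * K) => a1 a2 a3 a4 a5; lra.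
Qed.

End Assembly.


(** With an amplitude proportional to the gap, both sides of the smallness condition of
    [exists_oscillation] carry a factor [gap m y]; what is left is a condition on [kap], uniform in
    the subsolution. *)
Lemma ex_cell m U (d M W kap eta : R) y r : 0 < d -> (forall i j, U y i j = U y j i) -> \tr (U y) = 0 ->
  (forall v, d * dotp v v <= qf (gapm (q y) (rho y) (m y) (U y)) v) -> 0 <= gap m y ->
  0 <= M -> dotp (m y) (m y) <= M ^+ 2 -> n%:R * q y <= W -> 0 <= kap -> kap <= 1 ->
  kap * (2 * M + W) <= rho y / (2 * n%:R) ->
  0 < eta -> 0 < r -> (forall i, c <= y 0 i - r /\ y 0 i + r <= c + 1) ->
  exists w b wt Ut tau, [/\ cell_perturbation c B y r w b eta wt Ut tau,
    forall t, `|t| <= 1 -> forall v, d / 2 * dotp v v <=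
      qf (gapm (q y) (rho y) (m y + t *: w) (U y + t *: sy b w)) v,
    dotp w w = (kap * gap m y) ^+ 2 & forall i, `|w 0 i| <= W].
Proof.
move=> d0 Us trU Gd g0 M0 mM qW k0 k1 kM eta0 r0 hy.
have gW : gap m y <= W by exact: le_trans (gap_le m y) qW.
have s0 : 0 <= kap * gap m y by exact: mulr_ge0.
have sg : kap * gap m y <= gap m y by rewrite ler_piMl.
have sle : kap * gap m y * (2 * M + kap * gap m y) <= rho y * (n%:R * q y - dotp (m y) (m y) / rho y) / (2 * n%:R).
  have -> : rho y * (n%:R * q y - dotp (m y) (m y) / rho y) / (2 * n%:R) = gap m y * (rho y / (2 * n%:R)).
    by rewrite -/(gap m y); move: (_^-1) (gap m y) => a a'; ring.
  have -> : kap * gap m y * (2 * M + kap * gap m y) = gap m y * (kap * (2 * M + kap * gap m y)) by ring.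
  rewrite ler_wpM2l//.
  by apply: le_trans kM; rewrite ler_wpM2l// lerD2l (le_trans sg).
have [w [b [xi [ww [xi1 xiw xib] bw osc]]]] := exists_oscillation n3 (rho0 y) d0 s0 M0 Us trU Gd mM sle.
have n0 : (0 < n)%N by exact: leq_trans n3.
have [wt [Ut [tau H]]] := ex_cell_perturbation B n0 r0 hy xi1 xiw xib bw eta0.
exists w, b, wt, Ut, tau; split=> // i.
apply: le_trans gW; apply: le_trans sg; rewrite -ler_sqr ?nnegrE// real_normK ?num_real// -ww.
exact: dotp_coord.
Qed.

(** The order of quantifiers is the point: [K] is built from bounds of [rho] and [q] on the cube
    before the subsolution and its positivity constant are known. *)
Lemma oscillation_step : exists2 K : R, 0 < K & forall m U, subsol m U ->
  forall L (g : 'I_L -> 'rV[R]_n -> 'rV[R]_n), (forall l i, continuous (fun x => g l x 0 i)) ->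
  forall eps : R, 0 < eps -> exists m' U', [/\ subsol m' U',
    forall l, `|mean c (fun x => dotp (g l x) (m' x - m x))| <= eps &
    K * mean c (fun x => gap m x ^+ 2) <= mean c (fun x => dotp (m' x - m x) (m' x - m x) / rho x) + eps].
Proof.
have [rho1 rho10 Hrho] := continuous_cube_bounded c crho.
have [r1 r10 Hr] := continuous_cube_bounded c continuous_inv_rho.
have [q1 q10 Hq] := continuous_cube_bounded c cq.
have rr x : cube c x -> rho x <= rho1 by move=> /Hrho; apply: le_trans; exact: ler_norm.
have qq x : cube c x -> n%:R * q x <= n%:R * q1.
  by move=> /Hq h; rewrite ler_pM2l//; apply: le_trans h; exact: ler_norm.
have ri x : cube c x -> r1^-1 <= rho x.
  move=> /Hr h; rewrite -[rho x]invrK lef_pV2 ?posrE ?invr_gt0//; apply: le_trans h; exact: ler_norm.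
set W := n%:R * q1; have W0 : 0 < W by rewrite mulr_gt0.
(* [M ^+ 2] exceeds [rho1 * W], hence |m|^2, with no square root. *)
set M := 1 + rho1 * W; have M1 : 1 <= M by rewrite lerDl mulr_ge0// ltW.
(* Chosen so that kap <= 1 and 2 n kap (2 M + W) <= 1 / r1, a lower bound for [rho]. *)
set kap := r1^-1 / (2 * n%:R * (2 * M + W) + r1^-1).
have ri0 : 0 < r1^-1 by rewrite invr_gt0.
have D0 : 0 < 2 * n%:R * (2 * M + W) by rewrite !mulr_gt0//; lra.
have kap0 : 0 < kap by rewrite divr_gt0// addr_gt0.
have kap1 : kap <= 1 by rewrite ler_pdivrMr ?addr_gt0// mul1r lerDr ltW.
have kapr x : cube c x -> kap * (2 * M + W) <= rho x / (2 * n%:R).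
  move=> xc; rewrite ler_pdivlMr ?mulr_gt0//; apply: le_trans (ri _ xc).
  have -> : kap * (2 * M + W) * (2 * n%:R) =
      r1^-1 * (2 * n%:R * (2 * M + W) / (2 * n%:R * (2 * M + W) + r1^-1)).
    by rewrite /kap; move: (2 * n%:R * (2 * M + W) + r1^-1) (r1^-1) (2 * M + W) => a a' a''; ring.
  by rewrite ler_piMr ?(ltW ri0)// ler_pdivrMr ?addr_gt0// mul1r lerDl ltW.
pose K := kap ^+ 2 * (1 / 16 * (2 * n%:R) ^- n) / rho1.
have K0 : 0 < K.
  rewrite /K; apply: mulr_gt0; last by rewrite invr_gt0.
  apply: mulr_gt0; first exact: exprn_gt0.
  by apply: mulr_gt0; rewrite ?divr_gt0// invr_gt0 exprn_gt0// mulr_gt0.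
exists K => // m U sub L g cg eps eps0.
have [[cm cU] [sU tU] _ _ [d d0 Gd]] := sub.
have mM x : cube c x -> dotp (m x) (m x) <= M ^+ 2.
  move=> xc; apply: (le_trans (subsol_sqr_le sub xc)).
  apply: (@le_trans _ _ (W * rho1)).
    by apply: ler_pM; [rewrite mulr_ge0// ltW|exact: ltW|exact: qq|exact: rr].
  by rewrite mulrC /M; have := mulr_ge0 (ltW rho10) (ltW W0); move: (rho1 * W) => a a0; nra.
pose P := M + W; pose T := (3 + 4 * (P + 2) * r1 + (P + 2) ^+ 2) * n%:R.
(* Here [d] and [eps] enter: the tolerance, and with it the grid, adapts to the subsolution at
   hand. *)
have [eta [eta0 eta1 etaT etaW etaK]] : exists eta : R, [/\ 0 < eta, eta <= 1, eta * T <= d / 4,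
    eta * (n%:R * (W + 1)) <= eps & eta * (K + 2 * n%:R * W / rho1) <= eps].
  have d40 : 0 < d / 4 by exact: divr_gt0.
  have : \forall e \near 0^'+, [/\ 0 < e, e <= 1, e * T <= d / 4,
      e * (n%:R * (W + 1)) <= eps & e * (K + 2 * n%:R * W / rho1) <= eps].
    near=> e; split; near: e; [exact: nbhs_right_gt|exact: nbhs_right_le|exact: near_small_mul..].
  by move=> /filter_ex.
have cg2 : continuous (fun x => gap m x ^+ 2) by apply: continuous_mul; exact: continuous_gap.
have [N [N1 N2 N3 [N4 N5 N6]]] : exists N : nat,
    let F f := forall x z, cube c x -> cube c z -> (forall i, `|x 0 i - z 0 i| <= (N.+1%:R : R)^-1 / 2) ->
      `|f x - f z| <= eta in
    [/\ F q, F (fun x => (rho x)^-1), forall i, F (fun x => m x 0 i) &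
      [/\ forall p : 'I_n * 'I_n, F (fun x => U x p.1 p.2),
          forall p : 'I_L * 'I_n, F (fun x => g p.1 x 0 p.2) & F (fun x => gap m x ^+ 2)]].
  apply: (@filter_ex _ \oo); near=> N; split; [| | |split]; near: N.
  - exact: near_grid_unif.
  - by apply: near_grid_unif => //; exact: continuous_inv_rho.
  - by apply: filter_forall => i; exact: near_grid_unif.
  - by apply: filter_forall => p; exact: near_grid_unif.
  - by apply: filter_forall => p; exact: near_grid_unif.
  - exact: near_grid_unif.
have h0 : 0 < (N.+1%:R : R)^-1 / 2 by rewrite divr_gt0// invr_gt0.
pose y k := @grid_center R n c N k.
have cells k : exists p : ('rV[R]_n * 'rV[R]_n) * (('rV[R]_n -> 'rV[R]_n) * ('rV[R]_n -> 'M[R]_n) * ('rV[R]_n -> R)),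
    [/\ cell_perturbation c B (y k) (N.+1%:R^-1 / 2) p.1.1 p.1.2 eta p.2.1.1 p.2.1.2 p.2.2,
    forall t, `|t| <= 1 -> forall v, d / 2 * dotp v v <= qf (gapm (q (y k)) (rho (y k))
      (m (y k) + t *: p.1.1) (U (y k) + t *: sy p.1.2 p.1.1)) v,
    dotp p.1.1 p.1.1 = (kap * gap m (y k)) ^+ 2 & forall i, `|p.1.1 0 i| <= W].
  have yc := cube_grid_center c k.
  have [w [b [wt [Ut [tau H]]]]] := ex_cell d0 (sU _) (tU _) (Gd _ yc) (subsol_gap_ge0 sub yc)
    (le_trans ler01 M1) (mM _ yc) (qq _ yc) (ltW kap0) kap1 (kapr _ yc) eta0 h0 (grid_center_in c k).
  by exists (w, b, (wt, Ut, tau)).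
have [p Hp] := choice cells.
pose w k := (p k).1.1; pose b k := (p k).1.2.
pose wt k := (p k).2.1.1; pose Ut k := (p k).2.1.2; pose tau k := (p k).2.2.
have H1 k : cell_perturbation c B (y k) (N.+1%:R^-1 / 2) (w k) (b k) eta (wt k) (Ut k) (tau k) by case: (Hp k).
have H2 k t : `|t| <= 1 -> forall v, d / 2 * dotp v v <= qf (gapm (q (y k)) (rho (y k))
    (m (y k) + t *: w k) (U (y k) + t *: sy (b k) (w k))) v by case: (Hp k) => _ H _ _; exact: H.
have H4 k i : `|w k 0 i| <= W by case: (Hp k).
have mP k i : `|m (y k) 0 i| + `|w k 0 i| <= P.
  apply: lerD => //; rewrite -ler_sqr ?nnegrE//; last exact: le_trans M1.
  by rewrite real_normK ?num_real//; apply: le_trans (dotp_coord _ _) (mM _ (cube_grid_center c k)).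
have H3 k : dotp (w k) (w k) = (kap * gap m (y k)) ^+ 2 by case: (Hp k).
have ny x z : cube c x -> cube c z -> (forall i, `|x 0 i - z 0 i| <= (N.+1%:R : R)^-1 / 2) ->
  [/\ `|q x - q z| <= eta, `|(rho x)^-1 - (rho z)^-1| <= eta,
      forall i, `|m x 0 i - m z 0 i| <= eta & forall i j, `|U x i j - U z i j| <= eta].
  move=> xc zc xz; split; [exact: N1|exact: N2|by move=> i; exact: N3|].
  by move=> i j; exact: (N4 (i, j)).
exists (pm m wt), (pU U Ut); split.
- apply: (subsol_assembled d0 eta0 eta1 sub H1 H2 ny Hr mP).
  by rewrite -mulrA.
- move=> l; apply: le_trans etaW.
  apply: (orthogonal_assembled m eta1 H1) => // x z xc zc xz i.
  exact: (N5 (l, i)).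
- apply: le_trans (gain_assembled eta0 sub H1 erefl rho10 rr H4 H3 N6) _.
  by rewrite lerD2l.
Unshelve. all: by end_near. Qed.

End Step.

(** * Iteration and passage to the limit *)

Section Iteration.
Context {R : realType} {n : nat}.
Variables (c : R) (B : 'M[R]_n) (rho q : 'rV[R]_n -> R).
Hypotheses (n3 : (3 <= n)%N) (crho : continuous rho) (cq : continuous q).
Hypotheses (rho0 : forall x, 0 < rho x) (q0 : forall x, 0 < q x).
Notation field := ('rV[R]_n -> 'rV[R]_n).
Implicit Types (m g : 'rV[R]_n -> 'rV[R]_n) (U : 'rV[R]_n -> 'M[R]_n) (x : 'rV[R]_n).

Let nR0 : 0 < n%:R :> R. Proof. by rewrite ltr0n (leq_trans _ n3). Qed.

Definition cfield g := forall i, continuous (fun x => g x 0 i).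

Lemma cfield0 : cfield (fun=> 0).
Proof. by move=> i x; exact: cst_continuous. Qed.

Lemma cfieldB m g : cfield m -> cfield g -> cfield (fun x => m x - g x).
Proof.
move=> cm cg i; rewrite (_ : (fun x => _) = fun x => m x 0 i + - g x 0 i); last by apply/funext => x; rewrite !mxE.
by apply: continuous_add => //; exact: continuous_opp.
Qed.

Lemma cfieldZ (f : 'rV[R]_n -> R) g : continuous f -> cfield g -> cfield (fun x => f x *: g x).
Proof.
move=> cf cg i; rewrite (_ : (fun x => _) = fun x => f x * g x 0 i); last by apply/funext => x; rewrite !mxE.
exact: continuous_mul.
Qed.

Let mrho m : field := fun x => (rho x)^-1 *: m x.

Let cmrho m : cfield m -> cfield (mrho m).
Proof. by apply: cfieldZ; exact: continuous_inv_rho. Qed.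

Lemma continuous_cube_lower (f : 'rV[R]_n -> R) : continuous f -> (forall x, 0 < f x) ->
  exists2 d, 0 < d & forall x, cube c x -> d <= f x.
Proof.
move=> cf f0; have [M M0 H] := continuous_cube_bounded c (continuous_inv_rho cf f0).
exists M^-1; first by rewrite invr_gt0.
move=> x /H; rewrite ger0_norm => [h|]; last by rewrite invr_ge0 (ltW (f0 x)).
by rewrite -[f x]invrK lef_pV2 ?posrE ?invr_gt0.
Qed.

(** The iteration starts from rest, where the gap matrix is [q I]. *)
Lemma subsol0 : subsol c B rho q (fun=> 0) (fun=> 0).
Proof.
split.
- by split; [exact: cfield0|move=> i j x; exact: cst_continuous].
- by split=> [x i j|x]; rewrite ?mxE ?raddf0.
- move=> psi _; rewrite -(@mean0 R n c); apply: eq_mean => x _.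
  exact: mass_integrand_eq0.
- move=> Phi _ _; rewrite -(@mean0 R n c); apply: eq_mean => x _.
  exact: mom_form_eq0.
have [d d0 H] := continuous_cube_lower cq q0.
exists d => // x xc v; have -> : qf (gapm (q x) (rho x) 0 0) v = q x * dotp v v.
  rewrite /qf /bf /dotp mulr_sumr; apply: eq_bigr => i _; rewrite (bigD1 i)//= big1 ?addr0.
    by rewrite /gapm !mxE eqxx !mul0r subr0 addr0 mulr1; ring.
  by move=> j ji; rewrite /gapm !mxE eq_sym (negbTE ji) !mul0r mulr0 subr0 addr0 mulr0 mul0r.
by rewrite ler_wpM2r ?dotp_ge0// H.
Qed.

(** The tail from [k] on sums to 2^-k / 2: pairings with increments add up to at most half of 2^-k,
    and to at most 1/2 from the start. *)
Let eps (k : nat) : R := 2^-1 ^+ k / 4.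
Let eps0 k : 0 < eps k.
Proof. by rewrite divr_gt0// exprn_gt0// invr_gt0. Qed.

Let Jdist m g : R := mean c (fun x => dotp (m x - g x) (m x - g x) / rho x).

(* Near-orthogonality of each increment to all earlier momenta turns the gain of
   energy into control of the L^2 distances, hence a Cauchy sequence. *)
Lemma ex_sequence (gs : seq field) : (forall l, cfield (nth (fun=> 0) gs l)) ->
  exists2 K, 0 < K & exists (m : nat -> field) (U : nat -> 'rV[R]_n -> 'M[R]_n), m 0 = (fun=> 0) /\
  forall k, [/\ subsol c B rho q (m k) (U k),
    forall l, (l < size gs)%N -> `|mean c (fun x => dotp (nth (fun=> 0) gs l x) (m k.+1 x - m k x))| <= eps k,
    forall j, (j <= k)%N -> `|mean c (fun x => dotp (mrho (m j) x) (m k.+1 x - m k x))| <= eps k &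
    K * mean c (fun x => gap rho q (m k) x ^+ 2) <= Jdist (m k.+1) (m k) + eps k].
Proof.
move=> cgs; have [K K0 step] := oscillation_step c B n3 crho cq rho0 q0; exists K => //.
(* A state carries the fields to be tested against, a list extended by m / rho at each step, and the
   current pair. *)
pose state := (seq field * field * ('rV[R]_n -> 'M[R]_n))%type.
pose good (s : state) := subsol c B rho q s.1.2 s.2 /\ forall l, cfield (nth (fun=> 0) s.1.1 l).
(* Choice needs a total function, so a state that is not [good] gets a dummy successor. *)
have /choice[F HF] : forall p : nat * state, exists s : state, good p.2 ->
    [/\ good s, s.1.1 = rcons p.2.1.1 (mrho s.1.2),
     forall l, (l < size p.2.1.1)%N -> `|mean c (fun x => dotp (nth (fun=> 0) p.2.1.1 l x) (s.1.2 x - p.2.1.2 x))| <= eps p.1 &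
     K * mean c (fun x => gap rho q p.2.1.2 x ^+ 2) <= Jdist s.1.2 p.2.1.2 + eps p.1].
  move=> [k [[h m] U]] /=; have [gd|] := pselect (good (h, m, U)); last by exists (h, m, U).
  have [sub ch] := gd.
  have [m' [U' [sub' orth gain]]] := step m U sub (size h) (fun l => nth (fun=> 0) h l) (fun l => ch l) (eps k) (eps0 k).
  exists (rcons h (mrho m'), m', U') => _; split => //=.
  - split=> //= l; rewrite nth_rcons; case: ltnP => _; first exact: ch.
    case: eqP => _; last exact: cfield0.
    by apply: cmrho; case: sub' => -[].
  - by move=> l lh; have := orth (Ordinal lh).
pose fix st (k : nat) : state := if k is k'.+1 then F (k', st k') else (rcons gs (mrho (fun=> 0)), (fun=> 0), (fun=> 0)).
have gst k : good (st k).
  elim: k => [|k IH]; last by have [] := HF (k, st k) IH.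
  split; first exact: subsol0.
  move=> l /=; rewrite nth_rcons; case: ltnP => _; first exact: cgs.
  by case: eqP => _; [apply: cmrho|]; exact: cfield0.
pose m k := (st k).1.2; pose U k := (st k).2.
have hist k : (st k).1.1 = gs ++ mkseq (fun j => mrho (m j)) k.+1.
  elim: k => [|k IH]; first by rewrite /= cats1.
  have [_ -> _ _] := HF (k, st k) (gst k).
  by rewrite [LHS]/= IH rcons_cat [in RHS]mkseqS.
exists m, U; split=> // k; have [_ _ orth gain] := HF (k, st k) (gst k).
split=> //; first by case: (gst k).
- move=> l lg; have := orth l; rewrite /= hist size_cat nth_cat lg; apply.
  by rewrite ltn_addr.
- move=> j jk; have := orth (size gs + j)%N; rewrite /= hist size_cat nth_cat size_mkseq.
  rewrite [(_ < size gs)%N]ltnNge leq_addr /= addKn nth_mkseq ?ltnS//; apply.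
  by rewrite ltn_add2l ltnS.
Qed.


(** The energies converge, which makes both distances and gaps tend to 0; a subsequence supplies the
    geometric rate used for almost everywhere convergence. *)
Lemma ex_fast_sequence (gs : seq field) : (forall l, cfield (nth (fun=> 0) gs l)) ->
  exists (m : nat -> field) (U : nat -> 'rV[R]_n -> 'M[R]_n), forall k, [/\ subsol c B rho q (m k) (U k),
    forall l, (l < size gs)%N -> `|mean c (fun x => dotp (nth (fun=> 0) gs l x) (m k x))| <= 2^-1,
    Jdist (m k.+1) (m k) <= 4^-1 ^+ k & mean c (fun x => gap rho q (m k) x ^+ 2) <= 4^-1 ^+ k].
Proof.
move=> cgs; have [K K0 [m [U [m0 H]]]] := ex_sequence cgs.
have cm k : cfield (m k) by have [[[h _] _ _ _ _] _ _ _] := H k.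
have bmd g g' : cfield g -> cfield g' -> bm c (fun x => dotp (g x) (g' x)).
  by move=> cg cg'; apply: bm_cont; exact: continuous_dotp.
pose e (k : nat) : R := 2^-1 ^+ k.
have e0 k : 0 < e k by rewrite exprn_gt0// invr_gt0.
have eS k : e k.+1 = e k / 2 by rewrite /e exprS mulrC.
have epsE k : eps k = e k / 4 by [].
have tele g k l : cfield g -> (k <= l)%N ->
    (forall i, (k <= i)%N -> `|mean c (fun x => dotp (g x) (m i.+1 x - m i x))| <= eps i) ->
    `|mean c (fun x => dotp (g x) (m l x - m k x))| <= (e k - e l) / 2.
  move=> cg kl hg; rewrite -(subnK kl); move: (l - k)%N => j {l kl}.
  elim: j => [|j IH].
    rewrite add0n subrr mul0r (_ : (fun x => _) = fun=> 0) ?mean0 ?normr0//.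
    by apply/funext => x; rewrite subrr /dotp big1// => i _; rewrite mxE mulr0.
  rewrite addSn.
  have -> : mean c (fun x => dotp (g x) (m (j + k).+1 x - m k x)) =
      mean c (fun x => dotp (g x) (m (j + k).+1 x - m (j + k)%N x)) +
      mean c (fun x => dotp (g x) (m (j + k)%N x - m k x)).
    rewrite -meanD; [|by apply: bmd => //; exact: cfieldB..].
    by apply: eq_mean => x _; rewrite -dotpDr addrA subrK.
  apply: (le_trans (ler_normD _ _)); have := hg (j + k)%N (leq_addl _ _); rewrite epsE eS.
  by move: IH; move: (`|_|) (`|_|) (e k) (e (j + k)%N) => a1 a2 a3 a4; lra.
pose J k := mean c (fun x => dotp (m k x) (m k x) / rho x).
have bir : bm c (fun x => (rho x)^-1) by apply: bm_cont; exact: continuous_inv_rho.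
have Jdist_le k l : (k <= l)%N -> Jdist (m l) (m k) <= J l - J k + (e k - e l).
  move=> kl; have cr := cmrho (cm k).
  have := tele _ k l cr kl (fun i ki => let: And4 _ _ h _ := H i in h k ki).
  (* From |m_l - m_k|^2 = |m_l|^2 - |m_k|^2 - 2 m_k . (m_l - m_k); the last term is small by
     near-orthogonality. *)
  have -> : Jdist (m l) (m k) = J l - J k - 2 * mean c (fun x => dotp (mrho (m k) x) (m l x - m k x)).
    rewrite /Jdist /J -meanB; [|by apply: bmM => //; exact: bmd..].
    rewrite -meanZ; last by apply: bmd => //; exact: cfieldB.
    rewrite -meanB; last 2 first.
    - by apply: bmB; apply: bmM => //; exact: bmd.
    - by apply: bmM; [exact: bm_cst|apply: bmd => //; exact: cfieldB].
    apply: eq_mean => x _; rewrite /mrho dotpZl -scaleN1r !(dotpDl, dotpDr, dotpZl, dotpZr) (dotpC (m l x) (m k x)).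
    by move: ((rho x)^-1) => a; ring.
  rewrite ler_norml => /andP[h1 h2]; move: h1 h2; set a := mean _ _; lra.
have Jd0 k l : 0 <= Jdist (m l) (m k).
  by apply: mean_ge0 => x _; rewrite mulr_ge0 ?dotp_ge0// invr_ge0 ltW.
pose a k := J k - e k.
have a_mono : nondecreasing_seq a.
  move=> k l kl; have := Jdist_le _ _ kl; have := Jd0 k l; rewrite /a.
  by move: (Jdist _ _) => z; lra.
have a_ub : has_ubound (range a).
  exists (mean c (fun x => n%:R * q x)) => _ [k _ <-]; rewrite /a.
  have : J k <= mean c (fun x => n%:R * q x).
    apply: le_mean; first by apply: bmM => //; exact: bmd.
      by apply: bmM; [exact: bm_cst|exact: bm_cont].
    move=> x xc; have [sub _ _ _] := H k; have := subsol_gap_ge0 sub xc.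
    by rewrite /gap subr_ge0.
  by have := e0 k; lra.
have ac := nondecreasing_is_cvgn a_mono a_ub.
have al k : a k <= limn a by exact: nondecreasing_cvgn_le.
pose b k := limn a - a k + e k.
have Jb k l : (k <= l)%N -> Jdist (m l) (m k) <= b k.
  move=> kl; have := Jdist_le _ _ kl; have := al l; have := e0 l; have := e0 k; rewrite /b /a; lra.
have b0 : b @ \oo --> 0.
  rewrite -[X in _ --> X](addr0 (0 : R)); apply: cvgD.
    rewrite -(subrr (limn a)); apply: cvgB => //; exact: cvg_cst.
  by apply: cvg_expr; rewrite ger0_norm ?invr_ge0// invf_lt1// ltr1n.
have small i : exists N, forall k, (N <= k)%N -> b k <= 4^-1 ^+ i /\ (b k + e k) / K <= 4^-1 ^+ i.
  have f0 : 0 < (4^-1 : R) ^+ i by rewrite exprn_gt0// invr_gt0.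
  have d0 : 0 < K * 4^-1 ^+ i / 2 by rewrite divr_gt0// mulr_gt0.
  have /cvgrPdist_le /(_ _ f0) [N1 _ HN1] := b0.
  have /cvgrPdist_le /(_ _ d0) [N2 _ HN2] := b0.
  exists (maxn N1 N2) => k; rewrite geq_max => /andP[k1 k2].
  have := HN1 k k1; have := HN2 k k2; rewrite /= sub0r normrN => h2 h1.
  have eb : e k <= b k by rewrite /b lerDr subr_ge0.
  split; first exact: le_trans (ler_norm _) h1.
  rewrite ler_pdivrMr// mulrC; have := le_trans (ler_norm _) h2; lra.
have [N HN] := choice small.
(* Summing the thresholds gives a monotone choice of indices that dominates [N]. *)
pose phi i := (i + \sum_(j < i.+1) N j)%N.
have phiN i : (N i <= phi i)%N by rewrite /phi big_ord_recr/= addnA leq_addl.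
have phiS i : (phi i <= phi i.+1)%N by rewrite /phi (big_ord_recr i.+1)/= addSn addnA ltnW// ltnS leq_addr.
exists (m \o phi), (U \o phi) => k /=; have [sub orth _ gain] := H (phi k); split => //.
- move=> l lg; have := tele (nth (fun=> 0) gs l) 0%N (phi k) (cgs l) (leq0n _) (fun i _ => let: And4 _ h _ _ := H i in h l lg).
  rewrite m0 (_ : (fun x => dotp _ (m (phi k) x - 0)) = fun x => dotp (nth (fun=> 0) gs l x) (m (phi k) x)); last first.
    by apply/funext => x; rewrite subr0.
  move=> /le_trans; apply; have := e0 (phi k); rewrite /e expr0; lra.
- by apply: le_trans (Jb _ _ (phiS k)) _; have [] := HN k _ (phiN k).
- have [_] := HN k _ (phiN k); apply: le_trans.
  rewrite ler_pdivlMr// mulrC; apply: (le_trans gain).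
  have := Jb _ _ (leqnSn (phi k)); have := e0 (phi k); rewrite epsE; lra.
Qed.

End Iteration.

(** * Almost everywhere convergence on the cube *)

Section AlmostEverywhere.
Context {R : realType} {n : nat}.
Variable c : R.
Implicit Types (x : 'rV[R]_n) (f g : 'rV[R]_n -> R) (Z : set 'rV[R]_n).

Let tcube : set (n.-tuple R) := @t2rv R n @^-1` cube c.

(** Null for the law on the cube: the complement of the cube is then null as well, so an exceptional
    set may absorb it. *)
Definition null Z := measurableN Z /\ mu c n (@t2rv R n @^-1` Z) = 0%E.

Lemma null_ae Z (P : n.-tuple R -> Prop) : null Z -> (forall t, ~ Z (t2rv t) -> P t) ->
  {ae mu c n, forall t, P t}.
Proof.
move=> [mZ Z0] H; exists (@t2rv R n @^-1` Z); split=> // t /= nP.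
by apply: contrapT => nZ; apply: nP; exact: H.
Qed.

Lemma null_off_cube : null (~` cube c).
Proof.
split; first by apply: measurableC; exact: measurable_cube.
rewrite preimage_setC; transitivity (1 - mu c n (@t2rv R n @^-1` cube c))%E.
  by apply: probability_setC; exact: measurable_cube.
by rewrite mu_cube subee.
Qed.

Lemma nullU Z1 Z2 : null Z1 -> null Z2 -> null (Z1 `|` Z2).
Proof.
move=> [m1 h1] [m2 h2]; split; first by rewrite /measurableN preimage_setU; exact: measurableU.
rewrite preimage_setU; exact: null_set_setU.
Qed.

Lemma mean_dct Z (F : nat -> 'rV[R]_n -> R) f (M : R) : null Z ->
  (forall k, bm c (F k)) -> bm c f -> (forall k x, cube c x -> `|F k x| <= M) ->
  (forall x, cube c x -> ~ Z x -> F ^~ x @ \oo --> f x) ->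
  (fun k => mean c (F k)) @ \oo --> mean c f.
Proof.
move=> nZ bF bf FM Ff.
have mE g : bm c g -> (\int[mu c n]_(t in tcube) (g (t2rv t))%:E)%E = (mean c g)%:E.
  move=> [/mfunNP mg [N gN]]; apply: Rintegral_EFin; first exact: measurable_tcube.
    exact: measurable_funTS.
  by exists N => t tc; exact: gN.
have ae1 : {ae mu c n, forall t, tcube t -> (fun k => (F k (t2rv t))%:E) @ \oo --> (f (t2rv t))%:E}.
  by apply: (null_ae nZ) => t nZt tc; apply: cvg_EFin; [exact: nearW|exact: Ff].
have ae2 : {ae mu c n, forall t k, tcube t -> (`|(F k (t2rv t))%:E| <= M%:E)%E}.
  by apply: (null_ae nZ) => t _ k tc; rewrite lee_fin; exact: FM.
have [_ _] := @dominated_convergence _ _ _ (mu c n) tcube (measurable_tcube c)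
  (fun k t => (F k (t2rv t))%:E) (fun t => (f (t2rv t))%:E) (fun=> M%:E)
  (fun k => measurable_int _ (bm_integrable (bF k))) (measurable_int _ (bm_integrable bf))
  ae1 (bm_integrable (bm_cst c M)) ae2.
rewrite mE//; under eq_fun do rewrite mE//.
by move=> /fine_cvgP[_].
Qed.

Lemma sum_half k : \sum_(0 <= i < k) (2^-1 : R) ^+ i <= 2.
Proof.
suff -> : \sum_(0 <= i < k) (2^-1 : R) ^+ i = 2 - 2 * 2^-1 ^+ k.
  by rewrite lerBlDr lerDl mulr_ge0// exprn_ge0// invr_ge0.
elim: k => [|k IH]; first by rewrite big_nil expr0 mulr1 subrr.
by rewrite big_nat_recr//= IH exprS; move: (2^-1 ^+ k) => a; field.
Qed.

(** The sum of the series has finite integral by monotone convergence, so it is finite outside a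
    null set. *)
Lemma ae_summable (F : nat -> 'rV[R]_n -> R) (C : R) :
  (forall k, bm c (F k)) -> (forall k x, cube c x -> 0 <= F k x) ->
  (forall k, mean c (F k) <= C * 2^-1 ^+ k) ->
  exists2 Z, null Z & forall x, cube c x -> ~ Z x -> cvgn (series (F ^~ x)).
Proof.
move=> bF F0 FC.
pose S t : \bar R := (\sum_(0 <= i <oo) (F i (t2rv t))%:E)%E.
have mF k : measurable_fun tcube (fun t => (F k (t2rv t))%:E).
  exact: measurable_int _ (bm_integrable (bF k)).
have F0' k t : tcube t -> (0 <= (F k (t2rv t))%:E)%E by move=> tc; rewrite lee_fin F0.
have SI : (mu c n).-integrable tcube S.
  apply/integrableP; split; first by apply: ge0_emeasurable_sum => // k t tc _; exact: F0'.
  have -> : (\int[mu c n]_(t in tcube) `|S t| = \int[mu c n]_(t in tcube) S t)%E.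
    apply: eq_integral => t /set_mem tc; rewrite gee0_abs//; apply: nneseries_ge0 => k _ _; exact: F0'.
  rewrite integral_nneseries//; last exact: measurable_tcube.
  apply: (@le_lt_trans _ _ (C * 2)%:E); last exact: ltry.
  apply: lime_le; first by apply: is_cvg_nneseries => k _ _; apply: integral_ge0 => t; exact: F0'.
  near=> k; rewrite (eq_bigr (fun i => (mean c (F i))%:E)); last first.
    move=> i _; have [/mfunNP mg [N gN]] := bF i; apply: Rintegral_EFin; first exact: measurable_tcube.
      exact: measurable_funTS.
    by exists N => t tc; exact: gN.
  rewrite sumEFin lee_fin; apply: (@le_trans _ _ (\sum_(0 <= i < k) C * 2^-1 ^+ i)).
    exact: ler_sum.
  rewrite -mulr_sumr ler_wpM2l ?sum_half//.
  by have := le_trans (mean_ge0 (F0 0%N)) (FC 0%N); rewrite expr0 mulr1.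
have [N [mN N0 NS]] := integrable_ae (measurable_tcube c) SI.
pose r2t x : n.-tuple R := [tuple x 0 i | i < n].
have r2tK : @t2rv R n @^-1` (r2t @^-1` N) = N.
  rewrite -comp_preimage (_ : r2t \o _ = id)// funeqE => t /=.
  by apply: eq_from_tnth => i; rewrite tnth_mktuple mxE.
exists (r2t @^-1` N); first by split; rewrite /measurableN r2tK.
move=> x xc nx; have tx : t2rv (r2t x) = x by apply/rowP => i; rewrite mxE tnth_mktuple.
have tc : tcube (r2t x) by rewrite /tcube /= tx.
have fS : S (r2t x) \is a fin_num.
  by apply: contrapT => nf; apply: nx; apply: NS => /= /(_ tc).
apply: nondecreasing_is_cvgn; first by apply: nondecreasing_series => k _ _; exact: F0.
exists (fine (S (r2t x))) => _ [k _ <-].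
rewrite -lee_fin fineK// /series/= -sumEFin.
have := @nneseries_lim_ge R (fun i => (F i (t2rv (r2t x)))%:E) xpredT 0 k (fun i _ _ => F0' i _ tc).
have -> // : \sum_(0 <= i < k) (F i x)%:E = \sum_(0 <= i < k) (F i (t2rv (r2t x)))%:E by rewrite tx.
Unshelve. all: by end_near. Qed.

End AlmostEverywhere.

Section BoundedConvergence.
Context {R : realType} {n : nat}.
Variables (c : R) (Z : set 'rV[R]_n).
Implicit Types (x : 'rV[R]_n) (f g : 'rV[R]_n -> R) (F G : nat -> 'rV[R]_n -> R).

(** Bounded convergence off [Z]. It is stable under sums and products, so limits of the weak forms
    follow from those of the components. *)
Definition bcv F f := [/\ forall k, bm c (F k), bm c f,
  exists M, forall k x, cube c x -> `|F k x| <= M &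
  forall x, cube c x -> ~ Z x -> F ^~ x @ \oo --> f x].

Lemma bcv_cst f : bm c f -> bcv (fun=> f) f.
Proof.
move=> bf; split=> //; last by move=> x _ _; exact: cvg_cst.
by have [_ [M H]] := bf; exists M.
Qed.

Lemma bcvD F G f g : bcv F f -> bcv G g -> bcv (fun k x => F k x + G k x) (fun x => f x + g x).
Proof.
move=> [bF bf [M FM] Ff] [bG bg [N GN] Gg]; split.
- by move=> k; exact: bmD.
- exact: bmD.
- exists (M + N) => k x xc; apply: (le_trans (ler_normD _ _)).
  by apply: lerD; [exact: FM|exact: GN].
- by move=> x xc Zx; apply: cvgD; [exact: Ff|exact: Gg].
Qed.

Lemma bcvM F G f g : bcv F f -> bcv G g -> bcv (fun k x => F k x * G k x) (fun x => f x * g x).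
Proof.
move=> [bF bf [M FM] Ff] [bG bg [N GN] Gg]; split.
- by move=> k; exact: bmM.
- exact: bmM.
- exists (M * N) => k x xc; rewrite normrM.
  by apply: ler_pM => //; [exact: FM|exact: GN].
- by move=> x xc Zx; apply: cvgM; [exact: Ff|exact: Gg].
Qed.

Lemma bcv_sum I (r : seq I) (F : I -> nat -> 'rV[R]_n -> R) (f : I -> 'rV[R]_n -> R) :
  (forall i, bcv (F i) (f i)) ->
  bcv (fun k x => \sum_(i <- r) F i k x) (fun x => \sum_(i <- r) f i x).
Proof.
move=> h; elim: r => [|a r IH].
  rewrite (_ : (fun k x => _) = fun _ _ => 0); last by apply/funext => k; apply/funext => x; rewrite big_nil.
  rewrite (_ : (fun x => _) = fun=> 0); last by apply/funext => x; rewrite big_nil.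
  by apply: bcv_cst; exact: bm_cst.
rewrite (_ : (fun k x => _) = fun k x => F a k x + \sum_(i <- r) F i k x); last by apply/funext => k; apply/funext => x; rewrite big_cons.
rewrite (_ : (fun x => _) = fun x => f a x + \sum_(i <- r) f i x); last by apply/funext => x; rewrite big_cons.
exact: bcvD.
Qed.

Lemma bcv_mean F f : null c Z -> bcv F f -> (fun k => mean c (F k)) @ \oo --> mean c f.
Proof. by move=> nZ [bF bf [M FM] Ff]; exact: mean_dct nZ bF bf FM Ff. Qed.

Lemma bcv_mean_le F f (a : R) : null c Z -> bcv F f -> (forall k, `|mean c (F k)| <= a) -> `|mean c f| <= a.
Proof.
move=> nZ Ff Fa; have /cvg_norm H := bcv_mean nZ Ff.
rewrite -(cvg_lim _ H)//; apply: limr_le; first by apply/cvg_ex; eexists; exact: H.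
exact: nearW.
Qed.

Lemma bcv_mean0 F f : null c Z -> bcv F f -> (forall k, mean c (F k) = 0) -> mean c f = 0.
Proof.
move=> nZ Ff F0; apply/eqP; rewrite -normr_le0.
by apply: (bcv_mean_le nZ Ff) => k; rewrite F0 normr0.
Qed.

End BoundedConvergence.

(** * Exact solutions on the cube *)

Section Solution.
Context {R : realType} {n : nat}.
Variables (c : R) (B : 'M[R]_n) (rho q : 'rV[R]_n -> R).
Hypotheses (n3 : (3 <= n)%N) (crho : continuous rho) (cq : continuous q).
Hypotheses (rho0 : forall x, 0 < rho x) (q0 : forall x, 0 < q x).
Notation field := ('rV[R]_n -> 'rV[R]_n).
Implicit Types (m g : 'rV[R]_n -> 'rV[R]_n) (x : 'rV[R]_n).

Let nR0 : 0 < n%:R :> R. Proof. by rewrite ltr0n (leq_trans _ n3). Qed.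

(** The modulus is prescribed at every point of the cube, which spares the final identities any
    exceptional set. *)
Definition cube_sol m :=
  [/\ forall i, mfunN (fun x => m x 0 i),
      forall x, cube c x -> dotp (m x) (m x) = n%:R * q x * rho x,
      weak_mass c m & weak_mom c B m (fun x => (rho x)^-1 *: ten (m x) (m x))].

(** Positivity on e_i + e_j and e_i - e_j gives 2 |G_ij| <= G_ii + G_jj. *)
Lemma gapm_entry_le (d : R) (G : 'I_n -> 'I_n -> R) i j : 0 <= d -> (forall a b, G a b = G b a) ->
  (forall v, d * dotp v v <= qf G v) -> `|G i j| <= \sum_k G k k.
Proof.
move=> d0 Gs Gd; have G0 v : 0 <= qf G v by apply: le_trans (Gd v); rewrite mulr_ge0 ?dotp_ge0.
have bfee a b : bf G (ev R a) (ev R b) = G a b.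
  rewrite bf_evl (bigD1 b)//= mxE !eqxx mulr1 big1 ?addr0// => k kb.
  by rewrite mxE (negbTE kb) andbF mulr0.
have Gkk k : 0 <= G k k by have := G0 (ev R k); rewrite /qf bfee.
have tr k : G k k <= \sum_k G k k by rewrite [leRHS](bigD1 k)//= lerDl sumr_ge0.
have h1 := G0 (ev R i + ev R j); have h2 := G0 (ev R i + (-1) *: ev R j).
move: h1 h2; rewrite /qf !(bfDl, bfDr, bfZl, bfZr) !bfee (Gs j i) => h1 h2.
have ti := tr i; have tj := tr j; rewrite ler_norml.
by move: ti tj h1 h2; move: (\sum_k _) (G i i) (G j j) (G i j) => a1 a2 a3 a4 *; apply/andP; split; lra.
Qed.

Lemma cvg_sumR I (r : seq I) (u : I -> nat -> R) (l : I -> R) : (forall i, u i @ \oo --> l i) ->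
  (fun k => \sum_(i <- r) u i k) @ \oo --> \sum_(i <- r) l i.
Proof.
move=> h; elim: r => [|a r IH].
  rewrite big_nil (_ : (fun k => _) = fun=> 0); first exact: cvg_cst.
  by apply/funext => k; rewrite big_nil.
rewrite big_cons (_ : (fun k => _) = fun k => u a k + \sum_(i <- r) u i k); last by apply/funext => k; rewrite big_cons.
exact: cvgD.
Qed.

(** Young's inequality, used with e = 2^-k in place of Cauchy-Schwarz: squares with mean of order
    4^-k have roots with mean of order 2^-k. *)
Lemma norm_le_weighted (e t : R) : 0 < e -> `|t| <= e + e^-1 * t ^+ 2.
Proof.
move=> e0; have h : 0 <= e^-1 * (`|t| - e) ^+ 2 by rewrite mulr_ge0 ?sqr_ge0// invr_ge0 ltW.
have : e^-1 * (`|t| - e) ^+ 2 = e^-1 * `|t| ^+ 2 - 2 * `|t| + e by field; rewrite gt_eqF.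
rewrite real_normK ?num_real// => E; move: h; rewrite E.
by move: (e^-1 * _) (normr_ge0 t) => a; lra.
Qed.

(** [g] is the witness that later solutions must nearly avoid. Its pairing with [m] can be
    normalized because the means of m_k . m tend to the mean of |m|^2, which is positive. *)
Lemma ex_solution (gs : seq field) : (forall l, cfield (nth (fun=> 0) gs l)) ->
  exists m g, [/\ cube_sol m,
    forall l, (l < size gs)%N -> `|mean c (fun x => dotp (nth (fun=> 0) gs l x) (m x))| <= 2^-1,
    cfield g & mean c (fun x => dotp (g x) (m x)) = 1].
Proof.
move=> cgs; have [m [U H]] := ex_fast_sequence c B n3 crho cq rho0 q0 cgs.
have [rho1 rho10 Hrho] := continuous_cube_bounded c crho.
have rr x : cube c x -> rho x <= rho1 by move=> /Hrho; apply: le_trans; exact: ler_norm.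
have [q1 q10 Hq] := continuous_cube_bounded c cq.
have qq x : cube c x -> n%:R * q x <= n%:R * q1.
  by move=> /Hq h; rewrite ler_pM2l//; apply: le_trans h; exact: ler_norm.
have cm k i : continuous (fun x => m k x 0 i) by have [[[h _] _ _ _ _] _ _ _] := H k.
have g0 k x : cube c x -> 0 <= gap rho q (m k) x.
  by have [sub _ _ _] := H k; exact: subsol_gap_ge0 sub.
have cgap k : continuous (gap rho q (m k)) by apply: continuous_gap.
pose e k : R := 2^-1 ^+ k; have e0 k : 0 < e k by rewrite exprn_gt0// invr_gt0.
have e4 k : 4^-1 ^+ k = e k ^+ 2 by rewrite /e -exprM mulnC exprM; congr (_ ^+ k); field.
(* Summability of [F] controls the gap and all coordinates of the increments at once. *)
pose F k x := `|gap rho q (m k) x| + \sum_(j < n) `|m k.+1 x 0 j - m k x 0 j|.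
have bd k j : bm c (fun x => m k.+1 x 0 j - m k x 0 j) by apply: bmB; exact: bm_cont.
have bg k : bm c (gap rho q (m k)) by exact: bm_cont.
have mean_norm_le k (f h : 'rV[R]_n -> R) (C : R) : bm c f -> bm c h ->
    (forall x, cube c x -> f x ^+ 2 <= h x) -> mean c h <= C * e k ^+ 2 ->
    mean c (fun x => `|f x|) <= (1 + C) * e k.
  move=> bf bh fh hC; apply: (@le_trans _ _ (mean c (fun x => e k + (e k)^-1 * h x))).
    apply: le_mean; [exact: bm_norm|by apply: bmD; [exact: bm_cst|apply: bmM => //; exact: bm_cst]|].
    move=> x xc; apply: (le_trans (norm_le_weighted _ (e0 k))).
    by rewrite lerD2l ler_pM2l ?invr_gt0// fh.
  rewrite meanD; [|exact: bm_cst|by apply: bmM => //; exact: bm_cst].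
  rewrite mean_cst meanZ// mulrDl mul1r lerD2l ler_pdivrMl//.
  by apply: le_trans hC _; rewrite expr2 mulrCA mulrA.
have FC k : mean c (F k) <= (2 + n%:R * (1 + rho1)) * 2^-1 ^+ k.
  rewrite /F meanD; [|exact: bm_norm|by apply: bm_sum => j _; exact: bm_norm].
  rewrite mean_sum => [|j _]; last exact: bm_norm.
  have [_ _ J1 J2] := H k; rewrite mulrDl; apply: lerD.
    rewrite -[X in _ <= X * _]/(1 + 1); apply: (mean_norm_le k _ (fun x => gap rho q (m k) x ^+ 2)) => //.
      by apply: bmM.
    by rewrite mul1r -e4.
  rewrite -/(e k) -mulrA.
  apply: (@le_trans _ _ (\sum_(j < n) (1 + rho1) * e k)); last by rewrite sumr_const card_ord -[_ *+ n]mulr_natl.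
  apply: ler_sum => j _.
  pose h x := dotp (m k.+1 x - m k x) (m k.+1 x - m k x) / rho x.
  have bh : bm c h.
    apply: bm_cont; apply: continuous_mul; last exact: continuous_inv_rho.
    by apply: continuous_dotp; apply: cfieldB => i; exact: cm.
  apply: (mean_norm_le k _ (fun x => rho1 * h x)) => //.
  - by apply: bmM => //; exact: bm_cst.
  - move=> x xc; rewrite mulrCA; apply: (@le_trans _ _ (dotp (m k.+1 x - m k x) (m k.+1 x - m k x))).
      by have := dotp_coord (m k.+1 x - m k x) j; rewrite !mxE.
    by rewrite -[leLHS]mulr1 ler_wpM2l ?dotp_ge0// ler_pdivlMr// mul1r rr.
  - by rewrite meanZ// ler_pM2l// -e4.
have bF k : bm c (F k) by apply: bmD; [exact: bm_norm|apply: bm_sum => j _; exact: bm_norm].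
have F0 k x : cube c x -> 0 <= F k x by move=> _; rewrite addr_ge0// sumr_ge0.
have [Z0 nZ0 Zc] := ae_summable bF F0 FC.
pose Z := Z0 `|` ~` cube c.
have nZ : null c Z by apply: nullU => //; exact: null_off_cube.
have FZ x : ~ Z x -> cvgn (series (F ^~ x)).
  by move=> /not_orP[nz nc]; apply: Zc => //; exact: contrapT.
have F0' k x : 0 <= F k x by rewrite addr_ge0// sumr_ge0.
have gap_cvg x : ~ Z x -> (fun k => gap rho q (m k) x) @ \oo --> 0.
  move=> /FZ cF; apply/norm_cvg0P; apply: cvg_series_cvg_0; apply: (series_le_cvg _ (F0' ^~ x)) cF => // k.
  by rewrite lerDl sumr_ge0.
have m_cvg x j : ~ Z x -> cvgn (fun k => m k x 0 j).
  move=> /FZ cF; have : cvgn (series (telescope (fun k => m k x 0 j))).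
    apply: normed_cvg; apply: (series_le_cvg _ (F0' ^~ x)) cF => // k; first exact: normr_ge0.
    by rewrite /F /telescope /= (bigD1 j)//= addrCA lerDl addr_ge0// sumr_ge0.
  move=> ct; rewrite (_ : (fun k => m k x 0 j) = fun k => m 0 x 0 j + series (telescope (fun k => m k x 0 j)) k).
    by apply: is_cvgD => //; exact: is_cvg_cst.
  by apply/funext => k; rewrite [LHS](eq_sum_telescope (fun k => m k x 0 j)).
have n0 : (0 < n)%N by exact: leq_trans n3.
pose i0 : 'I_n := Ordinal n0.
pose fb x : R := Num.sqrt (n%:R * q x * rho x).
have cfb : continuous fb.
  move=> x; apply: continuous_comp; last exact: sqrt_continuous.
  by apply: (continuous_mul _ crho); apply: continuous_mul => //; exact: cst_continuous.
(* On the null set Z the limit is replaced by a field of the prescribed modulus,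
   so that |mm|^2 = n q rho holds at every point of the cube. *)
pose mm x : 'rV[R]_n := \row_j if `[< Z x >] then fb x * (j == i0)%:R else limn (fun k => m k x 0 j).
(* Measurable functions converging to [mm] at every point, whence the measurability of [mm]; off [Z]
   they are the iterates. *)
pose h k j x := fb x * (j == i0)%:R * \1_Z x + m k x 0 j * (1 - \1_Z x).
have b1Z : bm c (\1_Z : 'rV[R]_n -> R).
  split; last by exists 1 => x _; rewrite indicE; case: (x \in Z); rewrite ?normr1 ?normr0.
  by apply/mfunNP; exact: (@measurable_indic _ (n.-tuple R) R setT (@t2rv R n @^-1` Z) nZ.1).
have bh k j : bm c (h k j).
  apply: bmD; apply: bmM => //.
  - by apply: bmM; [exact: bm_cont|exact: bm_cst].
  - exact: bm_cont.
  - by apply: bmB => //; exact: bm_cst.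
have h_cvg x j : (fun k => h k j x) @ \oo --> mm x 0 j.
  rewrite mxE; case: asboolP => Zx.
    rewrite (_ : (fun k => _) = fun=> fb x * (j == i0)%:R); first exact: cvg_cst.
    by apply/funext => k; rewrite /h indicE mem_set// mulr1 subrr mulr0 addr0.
  rewrite (_ : (fun k => _) = fun k => m k x 0 j); first exact: m_cvg.
  by apply/funext => k; rewrite /h indicE memNset// mulr0 add0r subr0 mulr1.
have mm_cvg x j : ~ Z x -> (fun k => m k x 0 j) @ \oo --> mm x 0 j.
  by move=> Zx; rewrite mxE asboolF//; exact: m_cvg.
have mmm j : mfunN (fun x => mm x 0 j).
  apply/mfunNP; apply: (measurable_fun_cvg (h := fun k t => h k j (t2rv t))) => //.
  by move=> k; apply/mfunNP; case: (bh k j).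
have mm_eq x : cube c x -> dotp (mm x) (mm x) = n%:R * q x * rho x.
  move=> xc; have [Zx|Zx] := pselect (Z x).
    rewrite /dotp (bigD1 i0)//= !mxE asboolT// eqxx mulr1 -expr2 sqr_sqrtr ?mulr_ge0 ?ltW//.
    by rewrite big1 ?addr0// => j ji; rewrite !mxE asboolT// (negbTE ji) !mulr0.
  have c1 : (fun k => gap rho q (m k) x) @ \oo --> n%:R * q x - dotp (mm x) (mm x) / rho x.
    apply: cvgB; first exact: cvg_cst.
    apply: cvgM; last exact: cvg_cst.
    by apply: cvg_sumR => j; apply: cvgM; exact: mm_cvg.
  have l0 : limn (fun k => gap rho q (m k) x) = 0 by apply: cvg_lim => //; exact: gap_cvg.
  have l1 : limn (fun k => gap rho q (m k) x) = n%:R * q x - dotp (mm x) (mm x) / rho x by exact: cvg_lim.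
  move/eqP: l1; rewrite l0 eq_sym subr_eq0 => /eqP ->.
  by rewrite divfK// gt_eqF.
have coord_le x j (a : 'rV[R]_n) : cube c x -> dotp a a <= n%:R * q x * rho x -> `|a 0 j| <= 1 + n%:R * q1 * rho1.
  move=> xc ha; have h1 : dotp a a <= n%:R * q1 * rho1.
    apply: (le_trans ha); apply: ler_pM => //; [by rewrite mulr_ge0// ltW|exact: ltW|exact: qq|exact: rr].
  have := le_trans (dotp_coord a j) h1; rewrite -real_normK ?num_real//.
  by move: (normr_ge0 (a 0 j)); move: (`|_|) (_ * rho1) => s t; nra.
have bmm j : bm c (fun x => mm x 0 j).
  split=> //; exists (1 + n%:R * q1 * rho1) => x xc; apply: (coord_le x) => //.
  by rewrite mm_eq.
have bcm j : bcv c Z (fun k x => m k x 0 j) (fun x => mm x 0 j).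
  split=> //; [by move=> k; exact: bm_cont| |by move=> x _; exact: mm_cvg].
  exists (1 + n%:R * q1 * rho1) => k x xc; apply: (coord_le x) => //.
  by have [sub _ _ _] := H k; exact: subsol_sqr_le sub xc.
have bir : bm c (fun x => (rho x)^-1) by apply: bm_cont; exact: continuous_inv_rho.
pose G k i j x := gapm (q x) (rho x) (m k x) (U k x) i j.
have GE k i j x : G k i j x = q x * (i == j)%:R - m k x 0 i * m k x 0 j / rho x + U k x i j by [].
have G_le k i j x : cube c x -> `|G k i j x| <= gap rho q (m k) x.
  move=> xc; have [[_ [sU tU] _ _ [d d0 Gd]] _ _ _] := H k.
  rewrite /gap -(tr_gapm _ _ _ (tU x)); apply: gapm_entry_le (ltW d0) _ (Gd x xc) => a b.
  by rewrite /gapm sU eq_sym [m k x 0 a * _]mulrC.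
have bG i j : bcv c Z (fun k x => G k i j x) (fun=> 0).
  split=> [k|||x xc Zx].
  - apply: bmD; last by apply: bm_cont; have [[[_ cU] _ _ _ _] _ _ _] := H k; exact: cU.
    apply: bmB; first by apply: bmM; [exact: bm_cont|exact: bm_cst].
    by apply: bmM => //; apply: bmM; exact: bm_cont.
  - exact: bm_cst.
  - exists (n%:R * q1) => k x xc; apply: (le_trans (G_le _ _ _ _ xc)).
    by apply: le_trans (qq _ xc); apply: gap_le.
  - apply/norm_cvg0P; apply: (@squeeze_cvgr _ _ _ _ (fun=> 0) (fun k => gap rho q (m k) x)); [|exact: cvg_cst|exact: gap_cvg].
    by apply: nearW => k; rewrite normr_ge0 G_le.
have smc psi : smooth psi -> forall i, bm c (partial i psi).
  move=> sp i; apply: bm_cont; apply: (@Ck_cont _ _ 0); apply: Ck_partial; exact: smooth_Ck.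
have solm : cube_sol mm.
  split=> //.
  - move=> psi sp; apply: (bcv_mean0 nZ (F := fun k => mass_integrand (m k) psi)).
      apply: bcv_sum => i; apply: bcvM => //; apply: bcv_cst; exact: smc.
    by move=> k; have [[_ _ wm _ _] _ _ _] := H k; exact: wm.
  - move=> Phi sP dP.
    pose f x := mom_form B mm (fun x => (rho x)^-1 *: ten (mm x) (mm x)) Phi x.
    (* As G = q I - m m^T / rho + U, this is the linear form of [(m k, U k)] up to the invisible
       [q I], so its mean is 0; in the limit the part with [G] disappears. *)
    pose E k x := \sum_i \sum_j G k i j x * grad Phi x i j + mom_form B (m k) (fun x => (rho x)^-1 *: ten (m k x) (m k x)) Phi x.
    have bgr i j : bm c (fun x => grad Phi x i j) by exact: smc.
    have bP i : bm c (fun x => Phi x 0 i) by apply: bm_cont; apply: (@Ck_cont _ _ 0); apply: smooth_Ck; exact: sP.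
    apply: (bcv_mean0 nZ (F := E)).
      rewrite (_ : mom_form _ _ _ _ = fun x => \sum_i \sum_j 0 * grad Phi x i j + f x); last first.
        by apply/funext => x; rewrite [X in X + _]big1 ?add0r// => i _; rewrite big1// => j _; rewrite mul0r.
      apply: bcvD.
        by apply: bcv_sum => i; apply: bcv_sum => j; apply: bcvM => //; exact: bcv_cst.
      apply: bcvD.
        apply: bcv_sum => i; apply: bcv_sum => j; apply: bcvM; last exact: bcv_cst.
        rewrite (_ : (fun k x => _) = fun k x => (rho x)^-1 * (m k x 0 i * m k x 0 j)); last by apply/funext => k; apply/funext => x; rewrite !mxE.
        rewrite (_ : (fun x => _) = fun x => (rho x)^-1 * (mm x 0 i * mm x 0 j)); last by apply/funext => x; rewrite 2!mxE.
        by apply: bcvM; [exact: bcv_cst|exact: bcvM].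
      apply: bcv_sum => i; apply: bcvM; first exact: bcv_cst.
      by apply: bcv_sum => j; apply: bcvM => //; apply: bcv_cst; exact: bm_cst.
    move=> k; have [[_ _ _ wM _] _ _ _] := H k; rewrite -(wM Phi sP dP); apply: eq_mean => x _.
    rewrite /E /mom_form addrA; congr (_ + _); rewrite -[LHS]subr0 -[X in _ - X](ctr_scalar (q x) x dP).
    rewrite /ctr -big_split -sumrB; apply: eq_bigr => i _ /=; rewrite -big_split -sumrB; apply: eq_bigr => j _ /=.
    by rewrite GE !mxE mulr_natr; ring.
have orth l : (l < size gs)%N -> `|mean c (fun x => dotp (nth (fun=> 0) gs l x) (mm x))| <= 2^-1.
  move=> lg; apply: (bcv_mean_le nZ (F := fun k x => dotp (nth (fun=> 0) gs l x) (m k x))).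
    by apply: bcv_sum => i; apply: bcvM => //; apply: bcv_cst; apply: bm_cont; exact: cgs.
  by move=> k; have [_ o _ _] := H k; exact: o.
have pos : 0 < mean c (fun x => dotp (mm x) (mm x)).
  have [d d0 hd] := continuous_cube_lower c (continuous_mul cq crho) (fun x => mulr_gt0 (q0 x) (rho0 x)).
  apply: (@lt_le_trans _ _ (n%:R * d)); first exact: mulr_gt0.
  rewrite -(@mean_cst R n c (n%:R * d)); apply: le_mean; first exact: bm_cst.
    by apply: bm_sum => i _; exact: bmM.
  by move=> x xc; rewrite mm_eq// -mulrA ler_pM2l// hd.
have cp : (fun k => mean c (fun x => dotp (m k x) (mm x))) @ \oo --> mean c (fun x => dotp (mm x) (mm x)).
  by apply: bcv_mean nZ _; apply: bcv_sum => i; apply: bcvM => //; exact: bcv_cst.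
have [k hk] : exists k, 0 < mean c (fun x => dotp (m k x) (mm x)).
  have /filter_ex[k hk] : \forall k \near \oo, 0 < mean c (fun x => dotp (m k x) (mm x)) by exact: cvgr_gt cp _ pos.
  by exists k.
exists mm, (fun x => (mean c (fun x => dotp (m k x) (mm x)))^-1 *: m k x); split=> //.
  by apply: cfieldZ => // x; exact: cst_continuous.
rewrite -[RHS](mulVf (lt0r_neq0 hk)) -meanZ; last by apply: bm_sum => i _; apply: bmM => //; exact: bm_cont.
by apply: eq_mean => x _; rewrite dotpZl.
Qed.


Lemma ex_solution_sequence : exists m g : nat -> field, forall k,
  [/\ cube_sol (m k), cfield (g k), mean c (fun x => dotp (g k x) (m k x)) = 1 &
   forall l, (l < k)%N -> `|mean c (fun x => dotp (g l x) (m k x))| <= 2^-1].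
Proof.
pose good (gs : seq field) := forall l, cfield (nth (fun=> 0) gs l).
have /choice[F HF] : forall gs : seq field, exists p : field * field, good gs ->
    [/\ cube_sol p.1, forall l, (l < size gs)%N -> `|mean c (fun x => dotp (nth (fun=> 0) gs l x) (p.1 x))| <= 2^-1,
     cfield p.2 & mean c (fun x => dotp (p.2 x) (p.1 x)) = 1].
  move=> gs; have [ggs|] := pselect (good gs); last by exists (fun=> 0, fun=> 0).
  by have [m [g H]] := ex_solution ggs; exists (m, g).
pose fix st k : seq field := if k is k'.+1 then rcons (st k') (F (st k')).2 else [::].
have gst k : good (st k).
  elim: k => [|k IH] l; first by rewrite nth_nil; exact: cfield0.
  rewrite /= nth_rcons; case: ltnP => _; first exact: IH.
  by case: eqP => _; [case: (HF _ IH)|exact: cfield0].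
have stE k : st k = mkseq (fun j => (F (st j)).2) k by elim: k => //= k IH; rewrite mkseqS -IH.
exists (fun k => (F (st k)).1), (fun k => (F (st k)).2) => k; have [h1 h2 h3 h4] := HF _ (gst k).
split=> // l lk; have := h2 l; rewrite {1 2}stE size_mkseq nth_mkseq//; exact.
Qed.

End Solution.

(** * From the cube to the torus and the whole space *)

Section CubeIntegral.
Context {R : realType}.

(* No measurability is needed: the integral of a nonnegative function is a
   supremum over the simple functions below it. *)
Lemma le_integral_nonneg (f g : R -> \bar R) : (forall t, 0 <= f t)%E -> (forall t, f t <= g t)%E ->
  (\int[@lebesgue_measure R]_(t in setT) f t <= \int[@lebesgue_measure R]_(t in setT) g t)%E.
Proof.
move=> f0 fg; rewrite ge0_integralTE// ge0_integralTE => [|t]; last exact: le_trans (f0 t) (fg t).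
apply: ereal_sup_le => _ [h /= hf <-]; exists h => //= t.
exact: le_trans (hf t) (fg t).
Qed.

Lemma le_iint_nonneg n (f g : 'rV[R]_n -> R) : (forall x, 0 <= f x) -> (forall x, f x <= g x) ->
  (0 <= iint f)%E /\ (iint f <= iint g)%E.
Proof.
elim: n f g => [|n IH] f g f0 fg /=; first by rewrite !lee_fin.
pose sec (k : 'rV[R]_n.+1 -> R) t := fun y : 'rV[R]_n => k (row_mx (const_mx t : 'rV[R]_1) y).
have H t := IH (sec f t) (sec g t) (fun y => f0 _) (fun y => fg _).
split; first by apply: integral_ge0 => t _; case: (H t).
by apply: le_integral_nonneg => t; case: (H t).
Qed.

Context {n : nat}.
Variable c : R.
Implicit Types (x : 'rV[R]_n) (f g : 'rV[R]_n -> R) (A : set 'rV[R]_n).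

Lemma mfunN_indic A : measurableN A -> mfunN (\1_A : 'rV[R]_n -> R).
Proof.
by move=> mA; apply/mfunNP; exact: (@measurable_indic _ (n.-tuple R) R setT (@t2rv R n @^-1` A) mA).
Qed.

Lemma mfunNM f g : mfunN f -> mfunN g -> mfunN (fun x => f x * g x).
Proof. by move=> /mfunNP mf /mfunNP mg; apply/mfunNP; exact: measurable_funM. Qed.

Lemma iint_cube f g : bm c g -> (forall x, f x = \1_(cube c) x * g x) -> iint f = (mean c g)%:E.
Proof.
move=> [mg [M gM]] fE; have -> : f = (fun x => \1_(cube c) x * g x) by exact/funext.
rewrite (@iintE _ c).
- transitivity (\int[mu c n]_(t in @t2rv R n @^-1` cube c) (g (t2rv t))%:E)%E; last first.
    apply: Rintegral_EFin; first exact: measurable_tcube.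
      by move/mfunNP: mg; exact: measurable_funTS.
    by exists M => t; exact: gM.
  rewrite [RHS]integral_mkcond; apply: eq_integral => t _; rewrite patchE indicE.
  have -> : (t2rv t \in cube c) = (t \in @t2rv R n @^-1` cube c) by apply/idP/idP; rewrite !inE.
  by case: ifP; rewrite ?mul1r ?mul0r.
- by apply: mfunNM => //; apply: mfunN_indic; exact: measurable_cube.
- exists `|M| => x; rewrite indicE; case: (boolP (x \in cube c)) => [/set_mem xc|_].
    by rewrite mul1r; apply: le_trans (gM x xc) (ler_norm _).
  by rewrite mul0r normr0.
- by move=> x xc; rewrite indicE memNset// mul0r.
Qed.

(** Volume is an integral over the whole space, means are over the cube; monotonicity of [iint]
    bounds the share of [N] in the cube by [volN N], which is 0. *)
Lemma negligible_mean A f g : negligibleN A -> bm c f -> bm c g ->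
  (forall x, cube c x -> ~ A x -> f x = g x) -> mean c f = mean c g.
Proof.
move=> [N [mN AN N0]] bf bg fg.
have b1 : bm c (\1_N : 'rV[R]_n -> R).
  by split; [exact: mfunN_indic|exists 1 => x _; rewrite indicE; case: (x \in N); rewrite ?normr1 ?normr0].
have m0 : mean c (\1_N) = 0.
  have [] := @le_iint_nonneg n (fun x => \1_(cube c) x * \1_N x) (\1_N).
  - by move=> x; rewrite mulr_ge0// indicE.
  - by move=> x; rewrite ler_piMl// !indicE//; case: (x \in cube c).
  rewrite (@iint_cube _ (\1_N))// -/(volN N) N0 !lee_fin => h1 h2.
  by apply/eqP; rewrite eq_le h1 h2.
have [bd [M dM]] := bmB bf bg.
apply/eqP; rewrite -subr_eq0 -normr_le0 -meanB//.
apply: (@le_trans _ _ (mean c (fun x => M * \1_N x))); last by rewrite meanZ// m0 mulr0.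
apply: (@le_trans _ _ (mean c (fun x => `|f x - g x|))).
  exact: (norm_mean (bmB bf bg)).
apply: le_mean; [by apply: bm_norm; exact: bmB|by apply: bmM => //; exact: bm_cst|].
move=> x xc; rewrite indicE; case: (boolP (x \in N)) => [_|/negP nN].
  by rewrite mulr1 dM.
rewrite mulr0 fg ?subrr ?normr0// => Ax; apply: nN; apply/mem_set; exact: AN.
Qed.

End CubeIntegral.

Lemma negligibleN0 (R : realType) n : negligibleN (set0 : set 'rV[R]_n).
Proof.
exists set0; split=> //; first exact: measurable0.
rewrite /volN (_ : \1_set0 = fun=> 0); last by apply/funext => x; rewrite indicE in_set0.
rewrite (@iint_cube R n 0 _ (fun=> 0)); first by rewrite mean0.
  exact: bm_cst.
by move=> x; rewrite mulr0.
Qed.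

Lemma ae_onT (R : realType) n (D : set 'rV[R]_n) (P : 'rV[R]_n -> Prop) : (forall x, P x) -> ae_on D P.
Proof.
move=> H; rewrite /ae_on (_ : [set x | _] = set0); first exact: negligibleN0.
by apply/seteqP; split => // x [_]; apply.
Qed.

(** * Extension by zero of a solution on the cube *)

Section CubeSolution.
Context {R : realType} {n : nat}.
Variables (c : R) (B : 'M[R]_n) (rho q : 'rV[R]_n -> R).
Hypotheses (n3 : (3 <= n)%N) (crho : continuous rho) (cq : continuous q).
Hypotheses (rho0 : forall x, 0 < rho x) (q0 : forall x, 0 < q x).
Implicit Types (m u : 'rV[R]_n -> 'rV[R]_n) (x : 'rV[R]_n).

(** Extension by zero creates no boundary term, because the weak identities on the cube hold against
    all smooth test fields. *)
Definition velocity m x : 'rV[R]_n := (\1_(cube c) x * (rho x)^-1) *: m x.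

Lemma velocity_off m x : ~ cube c x -> velocity m x = 0.
Proof. by move=> xc; rewrite /velocity indicE memNset// mul0r scale0r. Qed.

Lemma momentum_in m x : cube c x -> rho x *: velocity m x = m x.
Proof. by move=> xc; rewrite /velocity indicE mem_set// mul1r scalerA divff ?scale1r// gt_eqF. Qed.

Lemma sol_coord_le m : cube_sol c B rho q m -> exists2 M, 0 <= M & forall x i, cube c x -> `|m x 0 i| <= M.
Proof.
move=> [_ mm _ _].
have cd : continuous (fun x => n%:R * q x * rho x).
  by apply: continuous_mul => //; apply: continuous_mul => // x; exact: cst_continuous.
have [M M0 H] := continuous_cube_bounded c cd.
exists (1 + M); first by rewrite addr_ge0// ltW.
move=> x i xc; have := dotp_coord (m x) i; rewrite mm// => h.
have := le_trans h (le_trans (ler_norm _) (H x xc)); rewrite -real_normK ?num_real//.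
by move: (normr_ge0 (m x 0 i)); move: (`|_|) => s; nra.
Qed.

Lemma bm_sol m i : cube_sol c B rho q m -> bm c (fun x => m x 0 i).
Proof.
move=> S; have [M _ H] := sol_coord_le S; have [mm _ _ _] := S.
by split=> //; exists M => x xc; exact: H.
Qed.

Lemma measurable_velocity m : cube_sol c B rho q m -> mvfN (velocity m).
Proof.
move=> [mm _ _ _] i.
rewrite (_ : (fun x => _) = fun x => \1_(cube c) x * (rho x)^-1 * m x 0 i); last by apply/funext => x; rewrite mxE.
apply: mfunNM => //; apply: mfunNM.
  by apply: mfunN_indic; exact: measurable_cube.
by apply: continuous_mfunN; exact: continuous_inv_rho.
Qed.

Lemma velocity_bounded m : cube_sol c B rho q m -> exists M, forall x i, `|velocity m x 0 i| <= M.
Proof.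
move=> S; have [M M0 H] := sol_coord_le S.
have [r1 r10 Hr] := continuous_cube_bounded c (continuous_inv_rho crho rho0).
exists (r1 * M) => x i; have [xc|xc] := pselect (cube c x); last first.
  by rewrite velocity_off// mxE normr0 mulr_ge0// ltW.
rewrite mxE normrM indicE mem_set// mul1r; apply: ler_pM => //; [exact: Hr|exact: H].
Qed.

Lemma sqnorm_velocity m x : cube_sol c B rho q m ->
  sqnorm (velocity m x) = n%:R * (\1_(cube c) x * q x) / rho x.
Proof.
move=> [_ mm _ _]; have -> : sqnorm (velocity m x) = dotp (velocity m x) (velocity m x).
  by apply: eq_bigr => i _; rewrite expr2.
have [xc|xc] := pselect (cube c x); last first.
  by rewrite velocity_off// indicE memNset// mul0r mulr0 mul0r /dotp big1// => i _; rewrite mxE mul0r.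
rewrite dotpZl dotpZr mm// indicE mem_set// !mul1r.
by field; rewrite gt_eqF.
Qed.

(** [rh] has to agree with [rho] on the cube only: on the whole space the density is constant there
    and may vary elsewhere. *)
Lemma iint_mom rh m v Phi : cube_sol c B rho q m -> smooth_vf Phi -> div_free Phi ->
  (forall x, cube c x -> rh x = rho x /\ v x = m x) -> (forall x, ~ cube c x -> v x = 0) ->
  iint (mom_integrand B rh v Phi) = 0%E.
Proof.
move=> S sP dP vin vout; have [_ _ _ wM] := S.
transitivity (mean c (mom_form B m (fun x => (rho x)^-1 *: ten (m x) (m x)) Phi))%:E; last by rewrite wM.
apply: iint_cube.
  apply: bm_mom_form => //; first by move=> i; exact: bm_sol.
  move=> i j; rewrite (_ : (fun x => _) = fun x => (rho x)^-1 * (m x 0 i * m x 0 j)); last by apply/funext => x; rewrite 2!mxE.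
  apply: bmM; first by apply: bm_cont; exact: continuous_inv_rho.
  by apply: bmM; exact: bm_sol.
move=> x; rewrite indicE; case: (boolP (x \in cube c)) => [/set_mem xc|/negP xc].
  rewrite mul1r /mom_integrand /mom_form; have [-> ->] := vin x xc; congr (_ + _).
  apply: eq_bigr => i _; apply: eq_bigr => j _; rewrite 2!mxE; congr (_ * _).
  by rewrite mulrC.
by rewrite mul0r mom_integrand_eq0// vout// => h; apply: xc; apply/mem_set.
Qed.

Lemma iint_mass m v psi : cube_sol c B rho q m -> smooth psi ->
  (forall x, cube c x -> v x = m x) -> (forall x, ~ cube c x -> v x = 0) ->
  iint (mass_integrand v psi) = 0%E.
Proof.
move=> S sp vin vout; have [_ _ wm _] := S.
transitivity (mean c (mass_integrand m psi))%:E; last by rewrite wm.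
apply: iint_cube.
  by apply: bm_mass_integrand => // i; exact: bm_sol.
move=> x; rewrite indicE; case: (boolP (x \in cube c)) => [/set_mem xc|/negP xc].
  by rewrite mul1r /mass_integrand vin.
by rewrite mul0r mass_integrand_eq0// vout// => h; apply: xc; apply/mem_set.
Qed.

(** Equality almost everywhere would make the means of [g l] against [m l] and [m k] agree, but the
    first is 1 and the second at most 1/2. *)
Lemma ae_distinct (D : set 'rV[R]_n) (m g : nat -> 'rV[R]_n -> 'rV[R]_n) (V : nat -> 'rV[R]_n -> 'rV[R]_n) :
  cube c `<=` D ->
  (forall k, [/\ cube_sol c B rho q (m k), cfield (g k), mean c (fun x => dotp (g k x) (m k x)) = 1 &
    forall l, (l < k)%N -> `|mean c (fun x => dotp (g l x) (m k x))| <= 2^-1]) ->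
  (forall k x, cube c x -> V k x = velocity (m k) x) ->
  pairwise_ae_distinct D V.
Proof.
move=> cD H VE; suff K k l : (l < k)%N -> ~ ae_on D (fun x => V k x = V l x).
  move=> k l /eqP; rewrite neq_ltn => /orP[kl|lk]; last exact: K.
  have e : [set x | D x /\ V k x <> V l x] = [set x | D x /\ V l x <> V k x].
    by apply/seteqP; split => x [Dx Vx]; split => // E; apply: Vx.
  by rewrite /ae_on e; exact: K.
move=> lk ae; have [Sk _ _ ol] := H k; have [Sl cg m1 _] := H l.
have bk (i : nat) : cube_sol c B rho q (m i) -> bm c (fun x => dotp (g l x) (m i x)).
  by move=> S; apply: bm_sum => j _; apply: bmM; [apply: bm_cont; exact: cg|exact: bm_sol].
have := ol l lk; rewrite (negligible_mean ae (bk k Sk) (bk l Sl)).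
  by rewrite m1 normr1 => h; have : (1 : R) <= 2^-1 := h; lra.
move=> x xc nA; congr dotp; rewrite -(momentum_in (m k) xc) -(momentum_in (m l) xc).
rewrite -!VE//; congr (_ *: _).
by apply: contrapT => ne; apply: nA; split => //; exact: cD.
Qed.

End CubeSolution.

(** * Periodic extension from the fundamental domain *)

Section Periodization.
Context {R : realType} {n : nat}.
Implicit Types (x : 'rV[R]_n) (f : 'rV[R]_n -> R) (u : 'rV[R]_n -> 'rV[R]_n).

Lemma rV_normP x (M : R) : `|x| <= M <-> 0 <= M /\ forall i, `|x 0 i| <= M.
Proof.
rewrite /Num.norm /= mx_normrE; split=> [/bigmax_leP[M0 H]|[M0 H]].
  by split=> // i; exact: (H (0, i)).
apply/bigmax_leP; split=> // -[j i] _ /=; rewrite (ord1 j); exact: H.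
Qed.

Lemma coord_le_norm x i : `|x 0 i| <= `|x|.
Proof. by have /rV_normP[_] := lexx `|x|; apply. Qed.

Lemma continuous_bounded f (M : R) : continuous f -> exists K, forall x, `|x| <= M -> `|f x| <= K.
Proof.
move=> cf; have cA : compact [set x : 'rV[R]_n | forall i, x ord0 i \in `[- M, M]].
  by apply: (rV_compact (A := fun=> `[- M, M]%classic)) => _; exact: segment_compact.
have : compact (f @` [set x : 'rV[R]_n | forall i, x ord0 i \in `[- M, M]]).
  by apply: continuous_compact => //; exact: continuous_subspaceT.
move=> /compact_bounded[K [_ /(_ (`|K| + 1))]]; rewrite (le_lt_trans (ler_norm K)) ?ltrDl//.
move=> /(_ isT) H; exists (`|K| + 1) => x /rV_normP[_ xM]; apply: H; exists x => // i.
by rewrite in_itv/= -ler_norml; exact: xM.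
Qed.

Lemma cube01E : @cube01 R n = cube 0.
Proof. by apply/seteqP; split => x; rewrite cubeP add0r. Qed.

Definition frac x : 'rV[R]_n := \row_i (x 0 i - (Num.floor (x 0 i))%:~R).

Lemma frac_in x : cube 0 (frac x).
Proof.
apply/cubeP => i; rewrite mxE; have /andP[h1 h2] := floor_itv (x 0 i).
by rewrite add0r subr_ge0 h1 ltrBlDl -intrD1.
Qed.

Lemma frac_id x : cube 0 x -> frac x = x.
Proof.
move=> /cubeP xc; apply/rowP => i; rewrite mxE; have := xc i; rewrite add0r => xi.
by rewrite (@floor_def _ _ 0) ?subr0// add0r.
Qed.

Lemma frac_periodic (T : Type) (g : 'rV[R]_n -> T) : Zn_periodic (g \o frac).
Proof.
move=> x i /=; congr g; apply/rowP => j; rewrite !mxE /=.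
case: eqP => _; last by rewrite addr0.
by rewrite mulr1n floorDrz ?int_num1// floor1 intrD; ring.
Qed.

Lemma periodicZ (T : Type) (g : 'rV[R]_n -> T) x i (z : int) : Zn_periodic g -> g (x + z%:~R *: ev R i) = g x.
Proof.
move=> pg; have pn y (k : nat) : g (y + k%:R *: ev R i) = g y.
  by elim: k => [|k IH]; rewrite ?scale0r ?addr0// -natr1 scalerDl scale1r addrA pg.
case: z => k; first exact: pn.
by rewrite NegzE mulrNz scaleNr -(pn (_ - _) k.+1) subrK.
Qed.

Lemma periodic_frac (T : Type) (g : 'rV[R]_n -> T) x : Zn_periodic g -> g (frac x) = g x.
Proof.
move=> pg; have ps (s : seq 'I_n) y (z : 'I_n -> int) : g (y + \sum_(i <- s) (z i)%:~R *: ev R i) = g y.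
  elim: s => [|a s IH]; first by rewrite big_nil addr0.
  by rewrite big_cons addrC -addrA [_ + y]addrC addrC periodicZ.
rewrite -(ps (index_enum 'I_n) (frac x) (fun i => Num.floor (x 0 i))); congr g; apply/rowP => j.
rewrite !mxE summxE (bigD1 j)//= !mxE !eqxx mulr1 big1 => [|i ij]; first by rewrite addr0 subrK.
by rewrite !mxE eq_sym (negbTE ij) andbF mulr0.
Qed.

Lemma measurable_frac f : mfunN f -> mfunN (f \o frac).
Proof.
move=> /mfunNP mf; apply/mfunNP.
pose phi (t : n.-tuple R) := [tuple tnth t i - (Num.floor (tnth t i))%:~R | i < n].
have -> : (f \o frac) \o @t2rv R n = (f \o @t2rv R n) \o phi.
  apply/funext => t /=; congr f; apply/rowP => i; by rewrite !mxE tnth_mktuple.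
apply: measurableT_comp => //; apply/measurable_fun_tnthP => i.
have -> : (@tnth n R ^~ i) \o phi = fun t => tnth t i - (Num.floor (tnth t i))%:~R.
  by apply/funext => t /=; rewrite tnth_mktuple.
have m1 : measurable_fun setT (fun t : n.-tuple R => tnth t i) by exact: measurable_tnth.
apply: measurable_funB => //.
have m2 : measurable_fun setT (fun s : R => (Num.floor s)%:~R : R); last exact: measurableT_comp m2 m1.
by apply: nondecreasing_measurable => // s t st; rewrite ler_int le_floor.
Qed.

End Periodization.

(** * Compactly supported solutions on the whole space *)

Section WholeSpace.
Context {R : realType} {n : nat}.

Lemma whole_space_solutions (B : 'M[R]_n) (Omega : set 'rV[R]_n) (rhobar : R) (rho : 'rV[R]_n -> R) :
  (3 <= n)%N -> bounded_setN Omega -> mfunN rho -> (exists M, forall x, `|rho x| <= M) ->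
  (forall x, 0 < rho x) -> (forall x, ~ Omega x -> rho x = rhobar) -> 0 < rhobar ->
  exists q : 'rV[R]_n -> R,
  exists U : nat -> 'rV[R]_n -> 'rV[R]_n,
    pairwise_ae_distinct setT U /\
    forall k,
      cpt_supp (U k) /\ mvfN (U k) /\ ess_bdd_on setT (U k) /\
      weak_sol_Rn B rho (fun x => rho x *: U k x) /\
      ae_on setT (fun x => sqnorm (U k x) = n%:R * q x / rho x).
Proof.
(* A cube whose coordinates are all at least |M| + 1 misses Omega, where every coordinate is at most
   [M]. *)
move=> n3 [M OM] mrho [Mr rhoM] rho0 rhoE rb0; pose c := `|M| + 1.
have cOut x : cube c x -> rho x = rhobar.
  move=> /cubeP xc; apply: rhoE => Ox; pose i : 'I_n := Ordinal (leq_trans (leq_trans (leqnSn 1) (leqnSn 2)) n3 : 0 < n)%N.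
  have /andP[h _] := xc i; have := le_trans (ler_norm _) (le_trans (coord_le_norm x i) (OM x Ox)).
  by have := ler_norm M; move: h; rewrite /c; lra.
have cr : continuous (fun _ : 'rV[R]_n => rhobar) by move=> x; exact: cst_continuous.
have c1 : continuous (fun _ : 'rV[R]_n => 1 : R) by move=> x; exact: cst_continuous.
(* On this cube the density is the constant [rhobar], and 1 is taken for [q]; its extension by zero
   is the indicator used below. *)
have [m [g H]] := ex_solution_sequence c B n3 cr c1 (fun=> rb0) (fun=> ltr01).
pose U k := velocity c (fun=> rhobar) (m k).
exists (\1_(cube c)), U; split.
  by apply: (ae_distinct cr c1 (fun=> rb0) _ H) => //.
move=> k; have [S _ _ _] := H k.
have [K HK] := velocity_bounded cr c1 (fun=> rb0) S.
have vin x : cube c x -> rho x *: U k x = m k x.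
  by move=> xc; rewrite cOut//; exact: (@momentum_in _ _ c (fun=> rhobar) (fun=> rb0) (m k) x xc).
have vout x : ~ cube c x -> rho x *: U k x = 0.
  by move=> xc; rewrite /U velocity_off// scaler0.
have mU : mvfN (U k) by exact: (@measurable_velocity R n c B (fun=> rhobar) (fun=> 1) cr (fun=> rb0) (m k) S).
split; [|split=> //; split; [|split]].
- exists (`|c| + 1) => x hx; apply: velocity_off => /cubeP xc.
  move: hx; rewrite ltNge => /negP; apply; apply/rV_normP; split; first by rewrite addr_ge0.
  move=> i; have /andP[h1 h2] := xc i; have c0 : 0 <= c by rewrite addr_ge0.
  by rewrite !ger0_norm//; [exact: ltW|exact: le_trans h1].
- by exists K; apply: ae_onT => x i; exact: HK.
- split=> //; split; first by exists Mr; apply: ae_onT.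
  split=> //; split.
    by move=> i; rewrite (_ : (fun x => _) = fun x => rho x * U k x 0 i); [exact: mfunNM|apply/funext => x; rewrite mxE].
  split.
    exists (Mr * K); apply: ae_onT => x i; rewrite mxE normrM; apply: ler_pM => //; exact: HK.
  split=> [Phi sP dP _|psi sp _].
    by apply: (iint_mom cr c1 (fun=> rb0) S sP dP) => // x xc; split; [exact: cOut|exact: vin].
  exact: (iint_mass cr c1 S sp).
- apply: ae_onT => x; rewrite (sqnorm_velocity (fun=> rb0) x S) mulr1.
  have [xc|xc] := pselect (cube c x); first by rewrite cOut.
  by rewrite indicE memNset// mulr0 !mul0r.
Qed.

End WholeSpace.

Theorem theorem1p1 (R : realType) (n : nat) (p : R -> R) (B : 'M[R]_n) :
  (3 <= n)%N ->
  (* p in C^1((0,oo)) with p' > 0 on (0,oo) *)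
  (forall r : R, 0 < r -> derivable p r 1) ->
  (forall r : R, 0 < r -> {for r, continuous (derive1 p)}) ->
  (forall r : R, 0 < r -> 0 < derive1 p r) ->
  (* (a) the torus T^n *)
  (forall rho q : 'rV[R]_n -> R,
     continuous rho -> Zn_periodic rho -> (forall x, 0 < rho x) ->
     continuous q -> Zn_periodic q -> (forall x, 0 < q x) ->
     exists U : nat -> 'rV[R]_n -> 'rV[R]_n,
       pairwise_ae_distinct (@cube01 R n) U /\
       forall k,
         Zn_periodic (U k) /\ mvfN (U k) /\ ess_bdd_on (@cube01 R n) (U k) /\
         weak_sol_Tn B rho (fun x => rho x *: U k x) /\
         ae_on (@cube01 R n) (fun x => sqnorm (U k x) = n%:R * q x / rho x))
  /\
  (* (b) R^n, B = a I_n, rho in C^1 *)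
  (forall (Omega : set 'rV[R]_n) (a rhobar : R) (rho : 'rV[R]_n -> R),
     open Omega -> bounded_setN Omega ->
     0 < a -> B = a%:M ->
     C1 rho -> (forall x, 0 < rho x) -> 0 < rhobar ->
     (forall x, ~ Omega x -> rho x = rhobar) ->
     iint (fun x => \1_Omega x * p (rho x)) = ((p rhobar)%:E * volN Omega)%E ->
     exists q : 'rV[R]_n -> R,
     exists U : nat -> 'rV[R]_n -> 'rV[R]_n,
       pairwise_ae_distinct setT U /\
       forall k,
         cpt_supp (U k) /\ mvfN (U k) /\ ess_bdd_on setT (U k) /\
         weak_sol_Rn B rho (fun x => rho x *: U k x) /\
         ae_on setT (fun x => sqnorm (U k x) = n%:R * q x / rho x))
  /\
  (* (c) R^n, general B, 0 < rho < rhobar in Omega *)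
  (forall (Omega : set 'rV[R]_n) (rhobar : R) (rho : 'rV[R]_n -> R),
     open Omega -> bounded_setN Omega ->
     mfunN rho -> 0 < rhobar ->
     (forall x, ~ Omega x -> rho x = rhobar) ->
     (forall x, Omega x -> 0 < rho x < rhobar) ->
     exists q : 'rV[R]_n -> R,
     exists U : nat -> 'rV[R]_n -> 'rV[R]_n,
       pairwise_ae_distinct setT U /\
       forall k,
         cpt_supp (U k) /\ mvfN (U k) /\ ess_bdd_on setT (U k) /\
         weak_sol_Rn B rho (fun x => rho x *: U k x) /\
         ae_on setT (fun x => sqnorm (U k x) = n%:R * q x / rho x)).
Proof.
move=> n3 _ _ _; split; [|split].
- move=> rho q crho prho rho0 cq pq q0.
  have [m [g H]] := ex_solution_sequence 0 B n3 crho cq rho0 q0.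
  have frho x : rho (frac x) = rho x by exact: periodic_frac.
  have fq x : q (frac x) = q x by exact: periodic_frac.
  pose u k := velocity 0 rho (m k).
  (* The velocity on the fundamental cube is repeated periodically. *)
  exists (fun k => u k \o frac); split.
    rewrite cube01E; apply: (ae_distinct crho cq rho0 _ H) => // k x xc.
    by rewrite /= frac_id.
  move=> k; have [S _ _ _] := H k.
  have [K HK] := velocity_bounded crho cq rho0 S.
  have [Kr _ HKr] := continuous_cube_bounded 0 crho.
  have mu0 : mvfN (u k \o frac) by move=> i; exact: (measurable_frac (measurable_velocity crho rho0 S i)).
  have rb x : `|rho x| <= Kr by have := HKr _ (frac_in x); rewrite frho.
  split; first exact: frac_periodic.
  split=> //; split; first by exists K; apply: ae_onT => x i; exact: HK.
  split; last first.
    apply: ae_onT => x /=; rewrite (sqnorm_velocity rho0 _ S).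
    by rewrite indicE mem_set ?mul1r ?fq ?frho//; exact: frac_in.
  have vin x : cube 0 x -> rho x *: u k x = m k x by exact: momentum_in.
  have vout x : ~ cube 0 x -> rho x *: u k x = 0 by move=> xc; rewrite /u velocity_off// scaler0.
  split=> //; split; first by move=> x i; rewrite prho frac_periodic.
  split; first exact: continuous_mfunN.
  split; first by exists Kr; apply: ae_onT.
  split=> //; split.
    move=> i; rewrite (_ : (fun x => _) = fun x => rho x * (u k \o frac) x 0 i); last by apply/funext => x; rewrite mxE.
    by apply: mfunNM => //; exact: continuous_mfunN.
  split.
    by exists (Kr * K); apply: ae_onT => x i; rewrite mxE normrM; apply: ler_pM => //; exact: HK.
  split=> [Phi sP dP _|psi sp _].
    (* On the cube [frac] is the identity, so the integrand on the fundamental domain is that of the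
       extension by zero. *)
    rewrite (_ : on_cube _ = mom_integrand B rho (fun x => rho x *: u k x) Phi).
      by apply: (iint_mom crho cq rho0 S sP dP) => // x xc; split=> //; exact: vin.
    apply/funext => x; rewrite /on_cube cube01E indicE; case: (boolP (x \in cube 0)) => [/set_mem xc|/negP xc].
      by rewrite mul1r /mom_integrand /= frac_id.
    by rewrite mul0r mom_integrand_eq0// vout// => h; apply: xc; apply/mem_set.
  rewrite (_ : on_cube _ = mass_integrand (fun x => rho x *: u k x) psi); first exact: (iint_mass crho cq S sp).
  apply/funext => x; rewrite /on_cube cube01E indicE; case: (boolP (x \in cube 0)) => [/set_mem xc|/negP xc].
    by rewrite mul1r /mass_integrand /= frac_id.
  by rewrite mul0r mass_integrand_eq0// vout// => h; apply: xc; apply/mem_set.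
- move=> Omega a rhobar rho _ bO _ _ [crho _] rho0 rb0 rhoE _.
  apply: (@whole_space_solutions R n B Omega rhobar) => //; first exact: continuous_mfunN.
  (* Continuity bounds [rho] on a ball containing Omega; outside Omega it is constant. *)
  have [M OM] := bO; have [K HK] := continuous_bounded M crho.
  exists (`|rhobar| + `|K|) => x; have [Ox|Ox] := pselect (Omega x).
    by apply: le_trans (HK x (OM x Ox)) _; apply: le_trans (ler_norm K) _; rewrite lerDr.
  by rewrite rhoE// lerDl.
- move=> Omega rhobar rho _ bO mrho rb0 rhoE rhoO.
  have rho0 x : 0 < rho x.
    by have [/rhoO/andP[]//|/rhoE->] := pselect (Omega x).
  apply: (@whole_space_solutions R n B Omega rhobar) => //.
  exists rhobar => x; rewrite gtr0_norm//.
  by have [/rhoO/andP[_ /ltW]|/rhoE->] := pselect (Omega x).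
Qed.
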